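(* Let $H$ be a real Hilbert space, $A:\mathcal D(A)\to H$ a positive self-adjoint operator with compact inverse, $V=\mathcal D(A^{1/2})$, $\tau>0$, $\mu$ an admissible memory kernel, and $b\in L^\infty_{loc}(0,+\infty)$ an on--off coefficient with switching times $(t_n)_{n\in\mathbb N}$, interval lengths $T_n=t_{n+1}-t_n$ and bounds $b_{2n+1}$. Consider $$u_{tt}(t)+Au(t)-\int_0^\infty\mu(s)Au(t-s)\,ds+b(t)u_t(t-\tau)=0,\quad t>0,\qquad u(t)=u_0(t),\quad t\le 0.\qquad (P)$$ Assume that $T_{2n}\ge\tau$ and $T_{2n}>\frac1\alpha\ln C$ for all $n\in\mathbb N$, and put $c_n=Ce^{-\alpha T_{2n}}\in(0,1)$, where $C,\alpha$ are the decay constants of the problem without delay feedback. (a) If $$\sum_{n=0}^\infty b_{2n+1}T_{2n+1}<+\infty\quad\text{and}\quad\sum_{n=0}^\infty\ln c_n=-\infty,$$ then $$\sum_{n=0}^\infty\ln\left[e^{2b_{2n+1}T_{2n+1}}\left(c_n+T_{2n+1}b_{2n+1}\right)\right]=-\infty,$$ and consequently (P) is asymptotically stable, i.e. $E_S(t)\to0$ as $t\to+\infty$ for every solution $u$ of (P). (b) In particular, (P) is asymptotically stable if $b\in L^1(0,+\infty)$ and there is $\bar T$ with $\bar T>\frac1\alpha\ln C$ and $\bar T\ge\tau$ such that $T_{2n}\ge\bar T$ for all $n\in\mathbb N$.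
   Context: Admissible memory kernel: $\mu:[0,+\infty)\to[0,+\infty)$ with i) $\mu\in C^1(\mathbb R^+)\cap L^1(\mathbb R^+)$; ii) $\mu(0)=\mu_0>0$; iii) $\int_0^{+\infty}\mu(t)\,dt=\tilde\mu<1$; iv) $\mu'(t)\le-\delta\mu(t)$ for all $t$, for some $\delta>0$. On--off coefficient: there are times $0=t_0<t_1<t_2<\dots$ and numbers $b_{2n+1}>0$ such that, for all $n\in\mathbb N=\{0,1,2,\dots\}$, $b(t)=0$ for $t\in I_{2n}=[t_{2n},t_{2n+1})$ and $|b(t)|<b_{2n+1}$ for $t\in I_{2n+1}=[t_{2n+1},t_{2n+2})$. Write $T_n=t_{n+1}-t_n$. Phase space and solutions: with $\eta^t(s):=u(t)-u(t-s)$, $s>0$, let $\mathcal H=V\times H\times L^2_\mu((0,\infty);V)$, where $L^2_\mu((0,\infty);V)$ has squared norm $\int_0^\infty\mu(s)\|A^{1/2}w(s)\|_H^2ds$, and the squared norm of $\mathcal H$ is $(1-\tilde\mu)\|A^{1/2}u\|_H^2+\|v\|_H^2+\int_0^\infty\mu(s)\|A^{1/2}w(s)\|_H^2ds$. A solution of (P) with initial datum $U_0\in\mathcal H$ is $U=(u,u_t,\eta)\in C([0,\infty);\mathcal H)$ with $U(0)=U_0=(u_0(0),\partial_tu_0(0),\eta_0)$, $\eta_0(s)=u_0(0)-u_0(-s)$, such that for a.e. $t>0$, with $f(t)=-b(t)u_t(t-\tau)$ (which vanishes for $t<\tau$ because $b=0$ on $[0,t_1)$ and $t_1=T_0\ge\tau$),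 $$\langle u_{tt},\tilde v\rangle=-(1-\tilde\mu)\langle A^{1/2}u,A^{1/2}\tilde v\rangle_H-\int_0^\infty\mu(s)\langle A^{1/2}\eta(s),A^{1/2}\tilde v\rangle_Hds+\langle f,\tilde v\rangle_H,$$ $$\int_0^\infty\mu(s)\langle\eta_t(s)+\eta_s(s),A\tilde\eta(s)\rangle_Hds=\int_0^\infty\mu(s)\langle u_t,A\tilde\eta(s)\rangle_Hds$$ for all $\tilde v\in V$ and $\tilde\eta\in L^2_\mu(\mathbb R^+;\mathcal D(A))$. Standard energy: $E_S(t)=\frac12\|u_t(t)\|_H^2+\frac{1-\tilde\mu}2\|A^{1/2}u(t)\|_H^2+\frac12\int_0^\infty\mu(s)\|A^{1/2}\eta^t(s)\|_H^2ds$. Decay constants: it is a known result that for $b\equiv0$ the energy $E_S$ of every solution is non-increasing and there are constants $C>1$, $\alpha>0$, independent of the solution, with $E_S(t)\le Ce^{-\alpha t}E_S(0)$ for all $t\ge0$ and every solution. $C,\alpha$ denote such fixed constants. *)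

(* Defs.v *)
From HB Require Import structures.
From mathcomp Require Import all_boot all_order all_algebra sesquilinear.
From mathcomp Require Import all_classical all_reals all_analysis.
Set Implicit Arguments.
Unset Strict Implicit.
Unset Printing Implicit Defensive.
Import Order.TTheory GRing.Theory Num.Theory.
Import numFieldNormedType.Exports.
Local Open Scope classical_set_scope.
Local Open Scope ring_scope.

Section Operators.
Context {R : realType} {H : completeNormedModType R}.

(* Together with completeness of H, this makes (H, ip) a real Hilbert space. *)
Definition norm_of_inner (ip : {dot H for idfun}) : Prop :=
  forall x, `|x| ^+ 2 = ip x x.

(* A possibly unbounded operator; the values of app outside dom are junk. *)
Record operator := Operator { dom : set H; app :> H -> H }.

Definition linear_operator (A : operator) : Prop :=
  dom A 0 /\
  forall (a : R) x y, dom A x -> dom A y ->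
    dom A (a *: x + y) /\ A (a *: x + y) = a *: A x + A y.

(* The second component says that the graph of the adjoint is that of A. *)
Definition self_adjoint (ip : {dot H for idfun}) (A : operator) : Prop :=
  dense (dom A) /\
  forall y z, (forall x, dom A x -> ip (A x) y = ip x z) <-> dom A y /\ A y = z.

Definition positive_self_adjoint (ip : {dot H for idfun}) (A : operator) : Prop :=
  [/\ linear_operator A, self_adjoint ip A &
      forall x, dom A x -> x != 0 -> 0 < ip (A x) x].

Definition compact_inverse (A : operator) : Prop :=
  exists K : H -> H,
    [/\ forall y, dom A (K y) /\ A (K y) = y,
        forall x, dom A x -> K (A x) = x &
        forall S : set H, bounded_set S -> precompact (K @` S)].

(* Such an S exists, and S is unique up to its values outside dom S. *)
Definition is_positive_sqrt (ip : {dot H for idfun}) (S A : operator) : Prop :=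
  [/\ positive_self_adjoint ip S,
      forall x, dom A x <-> dom S x /\ dom S (S x) &
      forall x, dom A x -> A x = S (S x)].

(* Bochner measurability: pointwise limit of measurable simple functions. *)
Definition strongly_measurable (D : set R) (f : R -> H) : Prop :=
  exists2 g : nat -> {fimfun R >-> H},
    forall n y, measurable (g n @^-1` [set y]) &
    forall s, D s -> g n s @[n --> \oo] --> f s.

End Operators.

Section Calculus.
Context {R : realType} {V : normedModType R}.

(* f' is the derivative of f on [0, +oo[ (a right derivative at 0). *)
Definition derivative_ge0 (f f' : R -> V) : Prop :=
  forall t, 0 <= t ->
    (s - t)^-1 *: (f s - f t) @[s --> within `[0, +oo[ t^'] --> f' t.

End Calculus.

Section Equation.
Context {R : realType} {H : completeNormedModType R}.
Local Notation leb := (@lebesgue_measure R).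

Definition mass (mu : R -> R) : R := \int[leb]_(s in `[0, +oo[) mu s.

Definition admissible_kernel (mu : R -> R) : Prop :=
  [/\ forall t, 0 <= t -> 0 <= mu t,
      leb.-integrable `[0, +oo[ (EFin \o mu),
      0 < mu 0,
      mass mu < 1 &
      exists dmu : R -> R,
        [/\ @derivative_ge0 R R^o mu dmu,
            {within `[0, +oo[, continuous dmu} &
            exists2 delta : R, 0 < delta &
              forall t, 0 <= t -> dmu t <= - delta * mu t]].

Definition on_off_coefficient (b : R -> R) (ts bb : nat -> R) : Prop :=
  [/\ ts 0%N = 0,
      forall n, ts n < ts n.+1,
      forall n, 0 < bb n.*2.+1,
      forall n t, ts n.*2 <= t < ts n.*2.+1 -> b t = 0 &
      forall n t, ts n.*2.+1 <= t < ts n.*2.+2 -> `|b t| < bb n.*2.+1].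

Definition Linfty_loc (b : R -> R) : Prop :=
  measurable_fun (`]0, +oo[ : set R) b /\
  forall K : set R, compact K -> K `<=` `]0, +oo[ ->
    exists M : R, {ae leb, forall t, K t -> `|b t| <= M}.

(* L^2_mu((0, +oo); D(S)), where D(S) carries the norm |S x|; with S the
   square root of A this is L^2_mu((0, +oo); V).  Classes are represented by
   everywhere defined D(S)-valued functions w; as S is an isometry from D(S)
   onto H, measurability of w into D(S) is that of S \o w into H. *)
Definition L2mu (mu : R -> R) (S : @operator R H) (w : R -> H) : Prop :=
  [/\ forall s, 0 < s -> dom S (w s),
      strongly_measurable `]0, +oo[ (S \o w) &
      leb.-integrable `]0, +oo[ (fun s => (mu s * `|S (w s)| ^+ 2)%:E)].

Variables (ip : {dot H for idfun}) (A Ah : @operator R H).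
(* Ah stands for the square root of A, so that V is dom Ah. *)
Variables (mu : R -> R) (tau : R).

Definition in_phase (x y : H) (w : R -> H) : Prop := dom Ah x /\ L2mu mu Ah w.

Definition phase_sqnorm (x y : H) (w : R -> H) : R :=
  (1 - mass mu) * `|Ah x| ^+ 2 + `|y| ^+ 2 +
  \int[leb]_(s in `]0, +oo[) (mu s * `|Ah (w s)| ^+ 2).

(* eta^t(s); u is defined on the whole line and carries its own history. *)
Definition past (u : R -> H) (t s : R) : H := u t - u (t - s).

(* Membership of t |-> (u t, v t, eta^t) in C([0, +oo); phase space). *)
Definition phase_continuous (u v : R -> H) : Prop :=
  forall t, 0 <= t ->
    in_phase (u t) (v t) (past u t) /\
    phase_sqnorm (u s - u t) (v s - v t) (past u s \- past u t)
      @[s --> within `[0, +oo[ (nbhs t)] --> 0.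

Definition dual_V (g : H -> R) : Prop :=
  (forall (a : R) x y, dom Ah x -> dom Ah y ->
     g (a *: x + y) = a * g x + g y) /\
  exists M : R, forall x, dom Ah x -> `|g x| <= M * `|Ah x|.

(* g is the weak V'-valued time derivative of the H-valued function v. *)
Definition dual_derivative (v : R -> H) (g : R -> H -> R) : Prop :=
  (forall t, dual_V (g t)) /\
  forall x, dom Ah x -> forall t, 0 <= t ->
    leb.-integrable `[0, t] (fun r => (g r x)%:E) /\
    ip (v t) x - ip (v 0) x = \int[leb]_(r in `[0, t]) g r x.

Definition delay_term (b : R -> R) (v : R -> H) (t : R) : H :=
  - (b t *: v (t - tau)).

Definition momentum_equation (b : R -> R) (u v : R -> H) (g : R -> H -> R)
    (t : R) : Prop :=
  forall x, dom Ah x ->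
    g t x = - (1 - mass mu) * ip (Ah (u t)) (Ah x)
            - \int[leb]_(s in `]0, +oo[) (mu s * ip (Ah (past u t s)) (Ah x))
            + ip (delay_term b v t) x.

(* The separate partial derivatives of eta need not exist; eta_t + eta_s is
   the derivative of (t, s) |-> eta^t(s) in the direction (1, 1). *)
Definition transport_equation (u v : R -> H) (t : R) : Prop :=
  forall w : R -> H, L2mu mu A w ->
    \int[leb]_(s in `]0, +oo[)
      (mu s * ip ('D_(1, 1) (fun p : R * R => past u p.1 p.2) (t, s)) (A (w s)))
    = \int[leb]_(s in `]0, +oo[) (mu s * ip (v t) (A (w s))).

(* u0 is the history on ]-oo, 0] and v0 the initial velocity: the datum
   (u0 0, v0, s |-> u0 0 - u0 (- s)) is an arbitrary element of the phase space,
   so v0 is a datum of its own rather than a pointwise derivative of u0.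
   v is u_t.  For t < tau the value v (t - tau) is unspecified, but it only occurs
   multiplied by b t, which vanishes there. *)
Definition solution (b : R -> R) (u0 : R -> H) (v0 : H) (u v : R -> H) : Prop :=
  [/\ forall t, t <= 0 -> u t = u0 t,
      v 0 = v0,
      derivative_ge0 u v,
      phase_continuous u v &
      exists2 g : R -> H -> R, dual_derivative v g &
        {ae leb, forall t, 0 < t ->
          momentum_equation b u v g t /\ transport_equation u v t}].

Definition energy (u v : R -> H) (t : R) : R :=
  2^-1 * `|v t| ^+ 2 + (1 - mass mu) / 2 * `|Ah (u t)| ^+ 2 +
  2^-1 * \int[leb]_(s in `]0, +oo[) (mu s * `|Ah (past u t s)| ^+ 2).

Definition asymptotically_stable (b : R -> R) : Prop :=
  forall u0 v0 u v, solution b u0 v0 u v ->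
    energy u v t @[t --> +oo] --> 0.

(* Decay constants of the problem without delay feedback (b = 0). *)
Definition decay_constants (C alpha : R) : Prop :=
  [/\ 1 < C, 0 < alpha &
      forall u0 v0 u v, solution (fun=> 0) u0 v0 u v ->
        forall t, 0 <= t -> energy u v t <= C * expR (- alpha * t) * energy u v 0].

End Equation.

(* Main.v *)
Require Import Defs.
From HB Require Import structures.
From mathcomp Require Import all_boot all_order all_algebra sesquilinear.
From mathcomp Require Import all_classical all_reals all_analysis.
From mathcomp Require Import measurable_realfun ring lra.
Set Implicit Arguments.
Unset Strict Implicit.
Unset Printing Implicit Defensive.
Import Order.TTheory GRing.Theory Num.Theory.
Import numFieldNormedType.Exports.
Local Open Scope classical_set_scope.
Local Open Scope ring_scope.

                                                

(** Everything about stability follows from one fact, [stable_of_integrable]: if [b] is integrable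
    on the half line and vanishes on [0, t_1) with tau <= t_1, then the energy of every solution
    tends to 0. Part (b) assumes integrability. In part (a) it follows because |b| is at most
    b_{2n+1} on odd intervals and 0 on even ones, so the convergent series bounds the integral of
    |b| ([on_off_integrable]).

    The divergence of the logarithmic series is a separate, elementary matter
    ([series_ln_feedback]). With beta_n = b_{2n+1} T_{2n+1}, small for large n, the n-th term is at
    most 6 beta_n + max(ln c_n, - ln 2). Truncating a divergent series of nonpositive terms from
    below keeps it divergent, since otherwise its terms would tend to 0 and the truncation would
    eventually be inactive.

    For the decay let E be the energy, N its memory part, v = u_t and z = A^{1/2} u. Formally E' <=
    - dlt N + |b(t)| |v(t - tau)| |v(t)|. As v takes values in H and not in V, the equation cannot
    be tested with v. It is tested with u(t+h) - u(t-h) instead, and h is sent to 0 at the end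
    ([energy_inequality]). The delayed velocity is only bounded by a supremum of past energies, but
    the tail of the integral of |b| is small, so that supremum can be absorbed: E is bounded
    ([energy_bounded]) and N is integrable ([memory_integral_bounded]).

    Two multipliers turn integrability of N into integrability of E. The pairing of v with a
    weighted average of u(t) - u(t-s) over a short window of s controls the kinetic energy up to
    memory terms, because near s = 0 the kernel is bounded below ([delayed_pairing_increment]). The
    pairing of v with u controls the elastic energy. Combined in [lyapunov] they bound the integral
    of E ([energy_integral_bounded]). Hence E is small at some late time, and after that it can grow
    only by the tail of the integral of |b| ([energy_vanishes]). *)

(** * Inner product algebra *)

Section InnerProduct.
Context {R : realType} {H : completeNormedModType R} (ip : {dot H for idfun}).

Lemma ipC x y : ip x y = ip y x.
Proof. by rewrite hermC expr0 mul1r. Qed.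

Lemma ipDl x y w : ip (x + y) w = ip x w + ip y w.
Proof. exact: linearDl. Qed.

Lemma ipDr x y w : ip w (x + y) = ip w x + ip w y.
Proof. exact: linearDr. Qed.

Lemma ipBl x y w : ip (x - y) w = ip x w - ip y w.
Proof. exact: linearBl. Qed.

Lemma ipBr x y w : ip w (x - y) = ip w x - ip w y.
Proof. exact: linearBr. Qed.

Lemma ipZl a x y : ip (a *: x) y = a * ip x y.
Proof. exact: linearZl_LR. Qed.

Lemma ipZr a x y : ip y (a *: x) = a * ip y x.
Proof. by rewrite ipC ipZl ipC. Qed.

Lemma ip0l x : ip 0 x = 0.
Proof. by rewrite -(scale0r 0) ipZl mul0r. Qed.

Lemma ip0r x : ip x 0 = 0.
Proof. by rewrite ipC ip0l. Qed.

Hypothesis hip : norm_of_inner ip.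

Lemma ip_cauchy_schwarz x y : `|ip x y| <= `|x| * `|y|.
Proof.
suff CS u w : ip u w <= `|u| * `|w|.
  rewrite ler_norml CS andbT lerNl; apply: le_trans (_ : ip (- x) y <= _).
    by rewrite -[- x]scaleN1r ipZl mulN1r.
  by rewrite -[X in _ <= X * _](normrN x) CS.
have [->|w0] := eqVneq w 0; first by rewrite ip0r normr0 mulr0.
have nw : 0 < `|w| by rewrite normr_gt0.
have := sqr_ge0 `|(`|w| *: u - `|u| *: w)|.
rewrite (hip _) ipBl !ipBr !ipZl !ipZr -!(hip _) [ip w u]ipC => h.
have [->|u0] := eqVneq u 0; first by rewrite ip0l normr0 mul0r.
have nu : 0 < `|u| by rewrite normr_gt0.
have nn : 0 < `|u| * `|w| by rewrite mulr_gt0.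
rewrite -(ler_pM2l nn); nra.
Qed.

Lemma ip_le x y : ip x y <= `|x| * `|y|.
Proof. exact: le_trans (ler_norm _) (ip_cauchy_schwarz x y). Qed.

Lemma ipBB_le x y x' y' :
  `|ip x y - ip x' y'| <= `|x - x'| * `|y| + `|x'| * `|y - y'|.
Proof.
have -> : ip x y - ip x' y' = ip (x - x') y + ip x' (y - y').
  by rewrite ipBl ipBr; lra.
apply: le_trans (ler_normD _ _) _.
by rewrite lerD// ip_cauchy_schwarz.
Qed.

Lemma cvg_ip {T : Type} (F : set_system T) {FF : Filter F} (f g : T -> H) a b :
  f @ F --> a -> g @ F --> b -> ip (f x) (g x) @[x --> F] --> ip a b.
Proof.
move=> fa gb.
have h0 : `|f x - a| * `|g x| + `|a| * `|g x - b| @[x --> F] --> 0.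
  have -> : (0 : R) = `|a - a| * `|b| + `|a| * `|b - b| by rewrite !subrr !normr0 mul0r mulr0 addr0.
  apply: cvgD; apply: cvgM.
  - by apply: cvg_norm; apply: cvgB => //; exact: cvg_cst.
  - exact: cvg_norm.
  - exact: cvg_cst.
  - by apply: cvg_norm; apply: cvgB => //; exact: cvg_cst.
apply/cvgrPdist_le => e e0; near=> x.
rewrite distrC; apply: le_trans (ipBB_le _ _ _ _) _.
apply: le_trans (ler_norm _) _; rewrite -[X in `|X|]subr0.
by near: x; exact: (cvgr_distC_le _ _ h0 _ e0).
Unshelve. all: by end_near. Qed.

End InnerProduct.

(** * Moduli of continuity on the half line *)

Section Modulus.
Context {R : realType}.

(** Replaces the argument that a nonpositive derivative forces monotonicity when [G] need not be
    differentiable: chop [a, c] into steps of length d/2, add up the increments, and let the slope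
    bound tend to 0. *)
Lemma le_of_small_increments (G : R -> R) (a c : R) : a <= c ->
  (forall e : R, 0 < e -> exists2 d : R, 0 < d &
    forall s t : R, a <= s -> s <= t -> t <= c -> t - s < d -> G t - G s <= e * (t - s)) ->
  G c <= G a.
Proof.
move=> ac HG; rewrite -subr_le0; apply/ler_addgt0Pr => e e0; rewrite add0r.
have e1 : 0 < e / (1 + (c - a)) by rewrite divr_gt0//; lra.
have [d d0 Hd] := HG _ e1.
have step n : forall s, a <= s -> s <= c -> c - s <= n%:R * (d / 2) ->
    G c - G s <= e / (1 + (c - a)) * (c - s).
  elim: n => [|n IHn] s as_ sc.
    rewrite mul0r => cs; have -> : s = c.
      by apply/eqP; rewrite eq_le; apply/andP; split; lra.
    by rewrite !subrr mulr0.
  rewrite -natr1 mulrDl mul1r => cs.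
  have [cs'|cs'] := leP (c - s) (d / 2).
    by apply: Hd => //; lra.
  have h1 : G (s + d / 2) - G s <= e / (1 + (c - a)) * (s + d / 2 - s).
    by apply: Hd => //; lra.
  have h2 : G c - G (s + d / 2) <= e / (1 + (c - a)) * (c - (s + d / 2)).
    by apply: IHn; lra.
  lra.
have [n Hn] : exists n, c - a <= n%:R * (d / 2).
  exists (Num.truncn ((c - a) / (d / 2))).+1.
  rewrite -ler_pdivrMr; last by lra.
  by apply/ltW; apply: truncnS_gt.
apply: le_trans (step n a (lexx _) ac Hn) _.
rewrite -mulrA [X in _ * X]mulrC ger_pMr// ler_pdivrMr; lra.
Qed.

                                                                                
(** Meant for a squared distance, hence the factor 2 in the triangle inequality. By compactness of
    [0, T] both points may be taken within e/4 of a common centre, and 2 (e/4 + e/4) = e. *)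
Lemma heine (d : R -> R -> R) :
  (forall s t, d s t = d t s) ->
  (forall s r t, d s t <= 2 * (d s r + d r t)) ->
  (forall t, 0 <= t -> d s t @[s --> within `[0, +oo[ (nbhs t)] --> 0) ->
  forall T e : R, 0 < e -> exists2 del : R, 0 < del &
    forall s t : R, 0 <= s <= T -> 0 <= t <= T -> `|s - t| < del -> d s t <= e.
Proof.
move=> dC dtri dlim T e e0.
have e4 : 0 < e / 4 by lra.
have := @segment_compact R 0 T.
move=> /compact_near_coveringP => /(_ R 0^'+ (fun del x => forall t, 0 <= x -> 0 <= t -> `|x - t| < del -> d x t <= e) _).
case.
  move=> x; rewrite /= in_itv/= => /andP[x0 xT].
  have /cvgr_distC_le/(_ _ e4) := dlim _ x0.
  rewrite near_withinE => -[r/= r0 Hr].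
  exists (ball x (r / 2), [set z | z < r / 2]).
    split; first by apply: nbhsx_ballx; lra.
    by apply: nbhs_right_lt; lra.
  move=> [x' del] /= [] xx' del2 t x'0 t0 x't.
  have H1 : d x' x <= e / 4.
    have := Hr x'; rewrite subr0 => h; apply: le_trans (ler_norm _) _; apply: h.
      by move: xx'; rewrite /ball/= => h; lra.
    by rewrite in_itv/= x'0.
  have H2 : d t x <= e / 4.
    have := Hr t; rewrite subr0 => h; apply: le_trans (ler_norm _) _; apply: h.
      move: xx'; rewrite /ball/= => h.
      have -> : x - t = (x - x') + (x' - t) by ring.
      apply: le_lt_trans (ler_normD _ _) _; lra.
    by rewrite in_itv/= t0.
  have := dtri x' x t; rewrite [d x t]dC; lra.
move=> del/= del0 /(_ (del / 2)) /=; rewrite sub0r normrN => h.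
have d2 : 0 < del / 2 by lra.
exists (del / 2) => // s t /andP[s0 sT] /andP[t0 tT] st.
apply: (h _ _ s) => //; first by rewrite gtr0_norm//; lra.
by rewrite /= in_itv/= s0.
Qed.

(** Uniform continuity on each [0, T]; negative times are left out because the velocity is
    unspecified there. *)
Definition ucont {V : normedModType R} (F : R -> V) :=
  forall T e : R, 0 < e -> exists2 d : R, 0 < d &
    forall s t : R, 0 <= s <= T -> 0 <= t <= T -> `|s - t| < d -> `|F s - F t| <= e.

Lemma ucont_bounded {V : normedModType R} (F : R -> V) : ucont F ->
  forall T, exists2 M : R, 0 < M & forall t : R, 0 <= t <= T -> `|F t| <= M.
Proof.
move=> HF T; have [d d0 Hd] := HF T 1 ltr01.
have d2 : 0 < d / 2 by lra.
have step n : forall t, 0 <= t -> t <= T -> t <= n%:R * (d / 2) -> `|F t| <= `|F 0| + n%:R.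
  elim: n => [|n IHn] t t0 tT.
    rewrite mul0r addr0 => t1; have -> // : t = 0.
    by apply/eqP; rewrite eq_le; apply/andP; split; lra.
  rewrite -natr1 mulrDl mul1r => tn.
  have [t2|t2] := leP t (d / 2).
    have : `|F t - F 0| <= 1.
      apply: Hd; rewrite ?t0 ?lexx//= ?(le_trans t0)//.
      by rewrite subr0 ger0_norm//; lra.
    have := ler_normB (F t) (F t - F 0); rewrite subKr.
    have : 0 <= n%:R :> R by []. 
    have := ler_normD (F t - F 0) (F 0); rewrite subrK; lra.
  have IH : `|F (t - d / 2)| <= `|F 0| + n%:R by apply: IHn; lra.
  have : `|F t - F (t - d / 2)| <= 1.
    apply: Hd; first by rewrite t0.
      by apply/andP; split; lra.
    have -> : t - (t - d / 2) = d / 2 by ring.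
    by rewrite gtr0_norm; lra.
  have := ler_normD (F t - F (t - d / 2)) (F (t - d / 2)); rewrite subrK; lra.
have [T0|T0] := ltP T 0.
  by exists 1 => // t /andP[t0 tT]; lra.
exists (`|F 0| + (Num.truncn (T / (d / 2))).+1%:R).
  by rewrite ltr_wpDl.
move=> t /andP[t0 tT]; apply: step => //.
rewrite -ler_pdivrMr//.
apply: (@le_trans _ _ (T / (d / 2))); last by apply/ltW/truncnS_gt.
by rewrite ler_pM2r// invr_gt0.
Qed.

End Modulus.

(** * Primitives and mean value estimates *)

Section Calculus.
Context {R : realType}.

Lemma ucontD {V : normedModType R} (F G : R -> V) : ucont F -> ucont G -> ucont (fun t => F t + G t).
Proof.
move=> HF HG T e e0; have e2 : 0 < e / 2 by lra.
have [d1 d10 H1] := HF T _ e2; have [d2 d20 H2] := HG T _ e2.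
exists (Num.min d1 d2); first by rewrite lt_min d10.
move=> s t sT tT; rewrite lt_min => /andP[st1 st2].
have -> : F s + G s - (F t + G t) = (F s - F t) + (G s - G t) by rewrite opprD addrACA.
apply: le_trans (ler_normD _ _) _.
have := H1 s t sT tT st1; have := H2 s t sT tT st2; lra.
Qed.

Lemma ucontZ {V : normedModType R} (k : R) (F : R -> V) : ucont F -> ucont (fun t => k *: F t).
Proof.
move=> HF T e e0.
have k0 : 0 < `|k| + 1 by rewrite ltr_wpDl.
have ek : 0 < e / (`|k| + 1) by rewrite divr_gt0.
have [d d0 Hd] := HF T _ ek; exists d => // s t sT tT st.
rewrite -scalerBr normrZ; have := Hd s t sT tT st.
rewrite ler_pdivlMr// mulrDr mulr1 [X in X + _]mulrC.
by have := normr_ge0 (F s - F t); lra.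
Qed.

Lemma ucont_shift {V : normedModType R} (h : R) (F : R -> V) : 0 <= h ->
  ucont F -> ucont (fun t => F (t + h)).
Proof.
move=> h0 HF T e e0; have [d d0 Hd] := HF (T + h) e e0.
exists d => // s t /andP[s0 sT] /andP[t0 tT] st; apply: Hd.
- by apply/andP; split; lra.
- by apply/andP; split; lra.
- by have -> : s + h - (t + h) = s - t by ring.
Qed.

(** The mean value property stands in for differentiability: later arguments only use increments,
    and one-sided derivatives at 0 are avoided. *)
Definition primitive (F P : R -> R) := forall a b : R, 0 <= a -> a <= b ->
  exists2 x : R, a <= x <= b & P b - P a = F x * (b - a).

Lemma primitive_increment_le (F P : R -> R) (a b e w : R) : primitive F P ->
  0 <= a -> a <= b -> (forall x : R, a <= x <= b -> `|F x - w| <= e) ->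
  `|P b - P a - (b - a) * w| <= e * (b - a).
Proof.
move=> HP a0 ab Hw; have [x xab ->] := HP a b a0 ab.
have -> : F x * (b - a) - (b - a) * w = (F x - w) * (b - a) by ring.
by rewrite normrM [X in _ * X]ger0_norm ?subr_ge0// ler_wpM2r ?subr_ge0// Hw.
Qed.

Lemma primitive_increment_modulus (F G : R -> R) (T eta d a b : R) : primitive F G ->
  (forall r r' : R, 0 <= r <= T -> 0 <= r' <= T -> `|r - r'| < d -> `|F r - F r'| <= eta) ->
  0 <= a -> a <= b -> b <= T -> b - a < d -> `|G b - G a - (b - a) * F a| <= eta * (b - a).
Proof.
move=> pF Fd a0 ab bT bad; apply: (primitive_increment_le pF) => // x /andP[ax xb].
apply: Fd; first by rewrite (le_trans a0 ax) (le_trans xb bT).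
  by rewrite a0 (le_trans ab bT).
by rewrite ger0_norm ?subr_ge0//; apply: le_lt_trans bad; rewrite lerD2r.
Qed.

Lemma ucont_continuous_max (F : R -> R) : ucont F -> continuous (fun x : R => F (Num.max 0 x)).
Proof.
move=> HF x; apply/cvgrPdist_le => e e0.
have [d d0 Hd] := HF (Num.max 0 x + 1) e e0.
have d1 : 0 < Num.min d 1 by rewrite lt_min d0 ltr01.
exists (Num.min d 1) => //= y /=; rewrite lt_min => /andP[xy xy1].
have mxy : `|Num.max 0 x - Num.max 0 y| <= `|x - y|.
  have h1 := ler_norm (x - y); have h2 := ler_norm (y - x); rewrite distrC in h2.
  by case: (leP 0 x) => ?; case: (leP 0 y) => ?; rewrite ler_norml; apply/andP; split; lra.
apply: Hd; last exact: le_lt_trans xy.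
- by rewrite le_max lexx/= lerDl.
- rewrite le_max lexx/=; move: (le_lt_trans mxy xy1).
  by rewrite ltr_norml => /andP[]; lra.
Qed.

Lemma ucont_primitive (F : R -> R) : ucont F -> exists P, primitive F P.
Proof.
(* Extending [F] by the constant [F 0] gives a continuous function on the line; integrating from -1
   makes 0 an interior point. *)
move=> HF; pose Fp (x : R) := F (Num.max 0 x).
have cFp : continuous Fp := ucont_continuous_max HF.
pose P (t : R) := (\int[lebesgue_measure]_(r in `[(-1), t]) Fp r)%R.
have dP (t : R) : -1 < t -> is_derive t 1 P (Fp t).
  move=> t1; have [||dPt Pt] := @continuous_FTC1_closed R Fp (-1) t (t + 1) _ _ t1 (cFp t).
  - by rewrite ltrDl.
  - apply: continuous_compact_integrable; first exact: segment_compact.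
    exact: continuous_subspaceT.
  apply: DeriveDef; first exact: dPt.
  by rewrite -derive1E; exact: Pt.
exists P => a b a0 ab.
have [||x xab ->] := @MVT_segment R P Fp a b ab.
- by move=> x /[!in_itv]/= /andP[ax xb]; apply: dP; lra.
- apply: derivable_within_continuous => x /[!in_itv]/= /andP[ax xb].
  by have [] : is_derive x 1 P (Fp x) by apply: dP; lra.
move: xab; rewrite in_itv/= => xab; exists x => //.
by rewrite /Fp max_r//; lra.
Qed.

Lemma derivative_ge0_is_derive {V : normedModType R} (f f' : R -> V) (t : R) :
  derivative_ge0 f f' -> 0 < t -> is_derive t 1 f (f' t).
Proof.
move=> Hf t0.
have cv : h^-1 *: (f (h *: 1 + t) - f t) @[h --> 0^'] --> f' t.
  apply/cvgrPdist_le => e e0.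
  move/cvgrPdist_le : (Hf t (ltW t0)) => /(_ e e0).
  rewrite near_withinE => -[d /= d0 Hd].
  have d1 : 0 < Num.min d t by rewrite lt_min d0.
  exists (Num.min d t) => //= h /=; rewrite lt_min sub0r normrN => /andP[hd ht] hn0.
  have := Hd (h *: 1 + t); rewrite [h *: 1]mulr1.
  have -> : h + t - t = h by ring.
  apply.
  - by rewrite /ball/= opprD addrCA subrr addr0 normrN.
  - by apply: contra_neq hn0 => /(congr1 (fun x => x - t)); rewrite addrK subrr.
  - by rewrite in_itv/= andbT; move: ht; rewrite ltr_norml => /andP[]; lra.
apply: DeriveDef; first by apply/cvg_ex; exists (f' t).
exact: cvg_lim cv.
Qed.

End Calculus.

Section VectorIncrements.
Context {R : realType} {H : completeNormedModType R} (ip : {dot H for idfun}).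
Hypothesis hip : norm_of_inner ip.

Lemma ucont_ip (f g : R -> H) : ucont f -> ucont g -> ucont (fun t => ip (f t) (g t)).
Proof.
move=> Hf Hg T e e0.
have [Mf Mf0 HMf] := ucont_bounded Hf T; have [Mg Mg0 HMg] := ucont_bounded Hg T.
have e1 : 0 < e / (Mf + Mg) by rewrite divr_gt0// addr_gt0.
have [d1 d10 H1] := Hf T _ e1; have [d2 d20 H2] := Hg T _ e1.
exists (Num.min d1 d2); first by rewrite lt_min d10.
move=> s t sT tT; rewrite lt_min => /andP[st1 st2].
apply: le_trans (ipBB_le hip _ _ _ _) _.
have -> : e = e / (Mf + Mg) * Mg + Mf * (e / (Mf + Mg)).
  by field; rewrite gt_eqF// addr_gt0.
by rewrite lerD// ler_pM// ?H1 ?H2 ?HMf ?HMg.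
Qed.

Lemma ip_is_derive (f : R -> H) (f' : H) (t : R) x :
  is_derive t 1 f f' -> is_derive t 1 (fun r => ip (f r) x) (ip f' x).
Proof.
move=> [df Df].
have cv : h^-1 *: (ip (f (h *: 1 + t)) x - ip (f t) x) @[h --> 0^'] --> ip f' x.
  under eq_fun do rewrite -ipBl -[_ *: _]ipZl.
  apply: (cvg_ip hip); last exact: cvg_cst.
  by rewrite -Df; exact: df.
apply: DeriveDef; first by apply/cvg_ex; exists (ip f' x).
exact: cvg_lim cv.
Qed.

(** A vector-valued mean value inequality: pair the curve with the deviation [x] itself, apply the
    scalar mean value theorem and Cauchy-Schwarz, then divide by the norm of [x]. *)
Lemma derivative_increment_le (u v : R -> H) (a b e : R) (w : H) :
  derivative_ge0 u v -> 0 < a -> a <= b ->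
  (forall r : R, a <= r <= b -> `|v r - w| <= e) ->
  `|u b - u a - (b - a) *: w| <= e * (b - a).
Proof.
move=> Hu a0 ab Hw; set x := u b - u a - (b - a) *: w.
have dx (r : R) : a <= r -> is_derive r 1 (fun r => ip (u r) x) (ip (v r) x).
  by move=> ar; apply/ip_is_derive/derivative_ge0_is_derive => //; exact: lt_le_trans ar.
have [||r rab E] := @MVT_segment R (fun r => ip (u r) x) (fun r => ip (v r) x) a b ab.
- by move=> r /[!in_itv]/= /andP[/ltW ar _]; exact: dx.
- apply: derivable_within_continuous => r /[!in_itv]/= /andP[ar _].
  by have [] := dx r ar.
have [x0|x0] := eqVneq x 0.
  rewrite x0 normr0 mulr_ge0// ?subr_ge0//.
  by apply: le_trans (Hw a _); rewrite ?normr_ge0 ?lexx.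
have nx : 0 < `|x| by rewrite normr_gt0.
rewrite -(ler_pM2r nx) -expr2 (hip x) {1}/x ipBl ipZl ipBl E mulrC -mulrBr -ipBl.
rewrite [leRHS]mulrAC [leLHS]mulrC ler_wpM2r// ?subr_ge0//.
apply: le_trans (ip_le hip _ _) _.
by rewrite ler_wpM2r// Hw.
Qed.

End VectorIncrements.

(** * Energy inequality for an abstract trajectory *)

Ltac tlra := repeat match goal with
  | H : context [@Num.norm] |- _ => clear H
  | H : forall _, _ |- _ => clear H
  | H : primitive _ _ |- _ => clear H
  | H : ucont _ |- _ => clear H
  end; repeat match goal with x := _ |- _ => clear x end; lra.

Ltac glra := repeat match goal with
  | H : is_true _ |- _ => clear H
  | H : forall _, _ |- _ => clear H
  | H : is_true _ /\ _ |- _ => clear H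
  end; lra.

                              

                                                                               
                                                                              
                                                                              
                                                                    
                                                                                 
                                
(** All that the decay argument needs to know about a solution. [L] is the square root of the
    operator, [N] the memory energy, [Q t y] the elastic force at time t paired with a test vector
    whose image under [L] is y, and [B] the accumulated mass of |b|. The equation enters in
    time-integrated form through [dyn_weak]. The motion of the memory and the decay of the kernel
    enter through [dyn_trapezoid], where the dissipation [dlt * h * N t] appears. *)
Record dynamics {R : realType} {H : completeNormedModType R} (ip : {dot H for idfun})
    (D : set H) (L : H -> H) (u v : R -> H) (m : R) (N : R -> R) (Q : R -> H -> R)
    (B : R -> R) (dlt cT cN : R) : Prop := Dynamics {
  dyn_linear : forall x y, D x -> D y -> D (x - y) /\ L (x - y) = L x - L y;
  dyn_velocity : derivative_ge0 u v;
  dyn_domain : forall t : R, 0 <= t -> D (u t);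
  dyn_ucont_v : ucont v;
  dyn_ucont_z : ucont (fun t => L (u t));
  dyn_mass : m < 1;
  dyn_ucont_N : ucont N;
  dyn_N_ge0 : forall t : R, 0 <= t -> 0 <= N t;
  dyn_QB : forall (t : R) x y, 0 <= t -> Q t (x - y) = Q t x - Q t y;
  dyn_Q_bound : forall (t : R) y, 0 <= t ->
    Q t y ^+ 2 <= 2 * ((1 - m) / 2 * `|L (u t)| ^+ 2 + N t) * `|y| ^+ 2;
  dyn_Q_cont : forall T e : R, 0 < e -> exists2 d : R, 0 < d &
    forall s t : R, 0 <= s <= T -> 0 <= t <= T -> `|s - t| < d ->
      forall y, `|Q s y - Q t y| <= e * `|y|;
  dyn_Q_coercive : forall t : R, 0 <= t ->
    (1 - m) / 2 * `|L (u t)| ^+ 2 - cN * N t <= Q t (L (u t));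
  dyn_trapezoid : forall t h e : R, 0 <= t -> 0 < h -> h <= 1 ->
    (forall r r' : R, t <= r <= t + h -> t <= r' <= t + h -> `|L (u r) - L (u r')| <= e) ->
    ((1 - m) / 2 * `|L (u (t + h))| ^+ 2 + N (t + h))
      - ((1 - m) / 2 * `|L (u t)| ^+ 2 + N t) + dlt * h * N t - cT * h * e ^+ 2 <=
    2^-1 * (Q t (L (u (t + h)) - L (u t)) + Q (t + h) (L (u (t + h)) - L (u t)));
  dyn_B_homo : forall s t : R, 0 <= s -> s <= t -> B s <= B t;
  dyn_weak : forall (s t M e : R) x, 0 <= s -> s <= t -> D x ->
    (forall r : R, 0 <= r -> r <= t -> `|v r| <= M) ->
    (forall (r : R) y, s <= r <= t -> `|Q r y - Q s y| <= e * `|y|) ->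
    `|ip (v t - v s) x + (t - s) * Q s (L x)| <=
      e * (t - s) * `|L x| + M * `|x| * (B t - B s) }.

Section Core.
Context {R : realType} {H : completeNormedModType R} (ip : {dot H for idfun}).
Hypothesis hip : norm_of_inner ip.
Variables (D : set H) (L : H -> H) (u v : R -> H) (m : R) (N : R -> R)
  (Q : R -> H -> R) (B : R -> R) (dlt cT cN : R).
Hypothesis dyn : dynamics ip D L u v m N Q B dlt cT cN.
Local Notation z t := (L (u t)).
Definition elastic_energy t := (1 - m) / 2 * `|z t| ^+ 2 + N t.
Local Notation P := elastic_energy.

Lemma Qbound (t : R) y : 0 <= t -> Q t y ^+ 2 <= 2 * P t * `|y| ^+ 2.
Proof. exact: (dyn_Q_bound dyn). Qed.

Lemma trapezoid (t h e : R) : 0 <= t -> 0 < h -> h <= 1 ->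
  (forall r r' : R, t <= r <= t + h -> t <= r' <= t + h -> `|z r - z r'| <= e) ->
  P (t + h) - P t + dlt * h * N t - cT * h * e ^+ 2 <=
  2^-1 * (Q t (z (t + h) - z t) + Q (t + h) (z (t + h) - z t)).
Proof. exact: (dyn_trapezoid dyn). Qed.

(** The product rule for the pairing of v with w, stated for increments because v has no derivative
    in H. The error splits into the weak form tested with [ws], the deviation of w from its linear
    approximation, and the variation of v against [w']. *)
Lemma pairing_increment (s t M e : R) (ws wt w' : H) : 0 <= s -> s <= t -> D ws ->
  (forall r : R, 0 <= r -> r <= t -> `|v r| <= M) ->
  (forall (r : R) y, s <= r <= t -> `|Q r y - Q s y| <= e * `|y|) ->
  `|v t - v s| <= e -> `|wt - ws - (t - s) *: w'| <= e * (t - s) ->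
  `|ip (v t) wt - ip (v s) ws - (t - s) * (ip (v s) w' - Q s (L ws))| <=
    (t - s) * (e * (`|L ws| + M + `|w'|)) + M * `|ws| * (B t - B s).
Proof.
move=> s0 st Dw vM Qe ve we.
have h1 := dyn_weak dyn s0 st Dw vM Qe.
have h2 : `|ip (v t) (wt - ws - (t - s) *: w')| <= M * (e * (t - s)).
  apply: le_trans (ip_cauchy_schwarz hip _ _) _.
  by rewrite ler_pM// vM//; lra.
have h3 : `|(t - s) * ip (v t - v s) w'| <= (t - s) * (e * `|w'|).
  rewrite normrM ger0_norm ?subr_ge0// ler_wpM2l ?subr_ge0//.
  by apply: le_trans (ip_cauchy_schwarz hip _ _) _; rewrite ler_wpM2r.
have -> : ip (v t) wt - ip (v s) ws - (t - s) * (ip (v s) w' - Q s (L ws)) =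
    (ip (v t - v s) ws + (t - s) * Q s (L ws)) + ip (v t) (wt - ws - (t - s) *: w')
    + (t - s) * ip (v t - v s) w'.
  by rewrite !ipBr !ipBl ipZr; ring.
apply: le_trans (ler_normD _ _) _.
apply: le_trans (lerD (ler_normD _ _) (lexx _)) _.
lra.
Qed.

Lemma ucont_sqnorm (f : R -> H) : ucont f -> ucont (fun t => `|f t| ^+ 2).
Proof. by move=> Hf; under eq_fun do rewrite hip; exact: ucont_ip. Qed.

Lemma ucont_P : ucont P.
Proof.
apply: ucontD (dyn_ucont_N dyn); have := ucont_sqnorm (dyn_ucont_z dyn).
by move=> /(ucontZ ((1 - m) / 2)).
Qed.

Lemma P_ge0 t : 0 <= t -> 0 <= P t.
Proof.
move=> t0; rewrite addr_ge0 ?(dyn_N_ge0 dyn)// mulr_ge0 ?sqr_ge0// divr_ge0//.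
by have := dyn_mass dyn; lra.
Qed.

Lemma Q_bounded T : exists2 K : R, 0 < K & forall (t : R) y, 0 <= t <= T -> `|Q t y| <= K * `|y|.
Proof.
have [K K0 HK] := ucont_bounded ucont_P T.
exists (1 + 2 * K); first by lra.
move=> t y tT; rewrite -(@ler_pXn2r _ 2)// ?nnegrE ?mulr_ge0//; last by lra.
rewrite real_normK ?num_real//; apply: le_trans (Qbound _ _) _; first by case/andP: tT.
rewrite exprMn ler_wpM2r ?sqr_ge0//.
have := HK t tT; rewrite ger0_norm ?P_ge0//; last by case/andP: tT.
by move=> h; nra.
Qed.

Lemma Q_sub_le t x y K : 0 <= t -> (forall x, `|Q t x| <= K * `|x|) ->
  `|Q t x - Q t y| <= K * `|x - y|.
Proof. by move=> t0 h; rewrite -(dyn_QB dyn). Qed.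

Lemma ucont_Q (h : R) (y : R -> H) : 0 <= h -> ucont y -> ucont (fun t => Q (t + h) (y t)).
Proof.
move=> h0 ucy T e e0.
have [K K0 HK] := Q_bounded (T + h).
have [My My0 HMy] := ucont_bounded ucy T.
have e1 : 0 < e / (K + My) by rewrite divr_gt0// addr_gt0.
have [d1 d10 H1] := dyn_Q_cont dyn (T + h) e1; have [d2 d20 H2] := ucy T _ e1.
exists (Num.min d1 d2); first by rewrite lt_min d10.
move=> s t /andP[s0 sT] /andP[t0 tT]; rewrite lt_min => /andP[st1 st2].
have -> : Q (s + h) (y s) - Q (t + h) (y t) =
    (Q (s + h) (y s) - Q (s + h) (y t)) + (Q (s + h) (y t) - Q (t + h) (y t)) by ring.
apply: le_trans (ler_normD _ _) _.
have sh : 0 <= s + h <= T + h by apply/andP; split; lra.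
have th : 0 <= t + h <= T + h by apply/andP; split; lra.
have -> : e = K * (e / (K + My)) + e / (K + My) * My.
  by field; rewrite gt_eqF// addr_gt0.
apply: lerD.
  apply: le_trans (Q_sub_le _ _ _ _) _; [by lra|by move=> x; exact: HK|].
  by rewrite ler_pM2l// H2 ?s0 ?t0.
have sth : `|s + h - (t + h)| < d1 by have -> : s + h - (t + h) = s - t by ring.
apply: le_trans (H1 _ _ sh th sth _) _.
by rewrite ler_pM2l// HMy ?t0.
Qed.

Lemma subrACA (V : zmodType) (a b c d : V) : a - b - (c - d) = a - c - (b - d).
Proof. by rewrite !opprD !opprK addrACA. Qed.

Lemma subr3ACA (V : zmodType) (a b c d p q : V) :
  a - b - (c - d) - (p - q) = a - c - p - (b - d - q).
Proof. by rewrite (subrACA a b) (subrACA (a - c)). Qed.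

Lemma ler_distlP (x y e : R) : `|x - y| <= e -> x - y <= e /\ y - x <= e.
Proof. by rewrite ler_norml => /andP[]; lra. Qed.

(** The product rule with w(t) = u(t+h) - u(t-h), which lies in the domain of [L] as a velocity need
    not. Since |w(s)| <= 2h (M + e), the feedback error is itself of order h and survives the later
    division by h. *)
Lemma symmetric_pairing_increment (s t h e eta M T : R) :
  0 < h -> h < s -> s <= t -> t + h <= T -> 0 <= e -> 0 <= eta ->
  (forall r : R, 0 <= r -> r <= t -> `|v r| <= M) ->
  (forall r : R, s - h <= r -> r <= s + h -> `|v r - v s| <= e /\ `|z r - z s| <= e) ->
  (forall a b r : R, b - a = t - s -> 0 <= a -> b <= T -> a <= r <= b -> `|v r - v a| <= eta / 2) ->
  (forall (r : R) y, s <= r <= t -> `|Q r y - Q s y| <= eta * `|y|) ->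
  `|ip (v t) (u (t + h) - u (t - h)) - ip (v s) (u (s + h) - u (s - h))
    - (t - s) * (ip (v s) (v (s + h)) - ip (v s) (v (s - h))
                 - (Q s (z (s + h)) - Q s (z (s - h))))| <=
  (t - s) * (eta * (M + 4 * e)) + 2 * h * M * (M + e) * (B t - B s).
Proof.
move=> h0 hs st tT e0 eta0 vM mod vclose Qclose.
have [s0 sh0 tT' t0] : [/\ 0 <= s, 0 <= s - h, t <= T & 0 <= t - h] by split; lra.
have vsM : `|v s| <= M := vM s s0 st.
have M0 : 0 <= M by exact: le_trans vsM.
have ts0 : 0 <= t - s by rewrite subr_ge0.
have B0 : 0 <= B t - B s by rewrite subr_ge0 (dyn_B_homo dyn).
have ws : `|u (s + h) - u (s - h)| <= 2 * h * (M + e).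
  have := derivative_increment_le hip (dyn_velocity dyn) (a := s - h) (b := s + h) (e := e) (w := v s).
  have -> : s + h - (s - h) = 2 * h by ring.
  move=> /(_ ltac:(lra) ltac:(lra)) hd.
  have {}hd : `|u (s + h) - u (s - h) - (2 * h) *: v s| <= e * (2 * h).
    by apply: hd => r /andP[r1 r2]; have [] := mod r r1 r2.
  have := ler_normD (u (s + h) - u (s - h) - (2 * h) *: v s) ((2 * h) *: v s).
  have h20 : 0 <= 2 * h by rewrite mulr_ge0// ltW.
  rewrite subrK normrZ ger0_norm// => hn; apply: le_trans hn _.
  by have := ler_wpM2l h20 vsM; lra.
have [Dw Lw] := dyn_linear dyn (dyn_domain dyn (t := s + h) ltac:(lra)) (dyn_domain dyn sh0).
have [v1 z1] := mod (s + h) ltac:(lra) ltac:(lra).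
have [v2 z2] := mod (s - h) ltac:(lra) ltac:(lra).
have split2 (a b c : H) : `|a - c| <= e -> `|b - c| <= e -> `|a - b| <= 2 * e.
  move=> ac bc; have -> : a - b = (a - c) - (b - c) by rewrite opprB addrA subrK.
  by apply: le_trans (ler_normB _ _) _; lra.
have ze := split2 _ _ _ z1 z2; have ve := split2 _ _ _ v1 v2.
have vt : `|v t - v s| <= eta.
  by have := vclose s t t erefl s0 tT'; rewrite st lexx => /(_ erefl); lra.
have du (a b : R) : b - a = t - s -> 0 < a -> b <= T ->
    `|u b - u a - (t - s) *: v a| <= eta / 2 * (t - s).
  move=> ba a0 bT; rewrite -ba.
  apply: (derivative_increment_le hip (dyn_velocity dyn)) => //; first by lra.
  by move=> r; apply: vclose => //; exact: ltW.
have wd : `|u (t + h) - u (t - h) - (u (s + h) - u (s - h)) -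
    (t - s) *: (v (s + h) - v (s - h))| <= eta * (t - s).
  have := du (s + h) (t + h) ltac:(ring) ltac:(lra) tT.
  have := du (s - h) (t - h) ltac:(ring) ltac:(lra) ltac:(lra).
  rewrite scalerBr subr3ACA => d1 d2.
  by apply: le_trans (ler_normB _ _) _; lra.
have := pairing_increment s0 st Dw vM Qclose vt wd.
rewrite Lw (dyn_QB dyn)// [ip (v s) (v _ - _)]ipBr => hp; apply: le_trans hp _; apply: lerD.
  rewrite ler_wpM2l// ler_wpM2l//; lra.
rewrite ler_wpM2r//; have -> : 2 * h * M * (M + e) = M * (2 * h * (M + e)) by ring.
by rewrite ler_wpM2l.
Qed.

(** [K], [PP], [NN], [Y] stand for primitives of the pairing of v(t) with v(t+h), of P, of N, and of
    Q(t+h) applied to z(t+h) - z(t). Formally, the [K] terms cancel the pairing of v(t) with v(t+h)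
    - v(t-h), and the [Y] terms turn the force on z(t+h) - z(t-h) into (Q(t) + Q(t+h)) applied to
    z(t+h) - z(t). That is the quantity bounded by the trapezoid inequality, so the derivative is
    nonpositive. *)
Definition shifted_energy (h e M : R) (K PP NN Y : R -> R) (t : R) :=
  ip (v t) (u (t + h) - u (t - h)) - (K t - K (t - h)) +
  2 * (PP (t + h) - PP t) + 2 * dlt * h * NN t - (Y t - Y (t - h)) -
  2 * cT * h * e ^+ 2 * t - 2 * h * M * (M + e) * B t.

                                                                            
                                                                        
                                                                               
Lemma symmetric_difference_pairing (t1 t2 h e M : R) (K PP NN Y : R -> R) :
  0 < t1 -> t1 <= t2 -> 0 < h -> h <= 1 -> h < t1 -> 0 <= e ->
  (forall r : R, 0 <= r -> r <= t2 -> `|v r| <= M) ->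
  (forall r r' : R, 0 <= r <= t2 + 1 -> 0 <= r' <= t2 + 1 -> `|r - r'| <= h ->
    `|v r - v r'| <= e /\ `|z r - z r'| <= e) ->
  primitive (fun t => ip (v t) (v (t + h))) K -> primitive P PP -> primitive N NN ->
  primitive (fun t => Q (t + h) (z (t + h) - z t)) Y ->
  shifted_energy h e M K PP NN Y t2 <= shifted_energy h e M K PP NN Y t1.
Proof.
move=> t10 t12 h0 h1 ht1 e0 vM mod pK pP pN pY.
have M0 : 0 <= M by apply: le_trans (vM 0 _ _); rewrite ?normr_ge0//; lra.
apply: le_of_small_increments => // e' e'0.
(* The errors in units of eta (t - s): M + 4e from the pairing, 8 from two increments each of [K],
   [Y] and (doubled) [PP], and the last term from [NN]. *)
pose C := M + 4 * e + 8 + 2 * `|dlt| * h.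
have C0 : 0 < C.
  have : 0 <= 2 * `|dlt| * h by rewrite !mulr_ge0// ltW.
  by rewrite /C; move: M0 e0; glra.
have hC : e' / C * C = e' by rewrite divfK// gt_eqF.
have eta0 : 0 < e' / C by rewrite divr_gt0.
move: (e' / C) hC eta0 => eta hC eta0.
have eta20 : 0 < eta / 2 by rewrite divr_gt0.
have ucvh : ucont (fun t => v (t + h)) by apply: ucont_shift (dyn_ucont_v dyn); exact: ltW.
have uczh : ucont (fun t => z (t + h)).
  by apply: (ucont_shift (F := fun t => z t)) (dyn_ucont_z dyn); exact: ltW.
have uczX : ucont (fun t => z (t + h) - z t).
  by apply: ucontD uczh _; under eq_fun do rewrite -scaleN1r; apply/ucontZ/(dyn_ucont_z dyn).
have [dv dv0 Hdv] := dyn_ucont_v dyn (t2 + 1) eta20.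
have [dQ dQ0 HdQ] := dyn_Q_cont dyn (t2 + 1) eta0.
have [dK dK0 HdK] := ucont_ip hip (dyn_ucont_v dyn) ucvh (t2 + 1) eta0.
have [dP dP0 HdP] := ucont_P (t2 + 1) eta0.
have [dN dN0 HdN] := dyn_ucont_N dyn (t2 + 1) eta0.
have [dY dY0 HdY] := ucont_Q (ltW h0) uczX (t2 + 1) eta0.
exists (Num.min dv (Num.min dQ (Num.min dK (Num.min dP (Num.min dN dY))))).
  by rewrite !lt_min dv0 dQ0 dK0 dP0 dN0 dY0.
move=> s t t1s st tt2; rewrite !lt_min => /andP[tv /andP[tQ /andP[tK /andP[tP /andP[tN tY]]]]].
have [s0 hs sh0 sT] : [/\ 0 <= s, h < s, 0 <= s - h & s + h <= t2 + 1].
  by split; move: t10 t1s ht1 st tt2 h1; glra.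
have [tT thT tmT] : [/\ t <= t2 + 1, t + h <= t2 + 1 & t - h <= t2 + 1].
  by split; move: tt2 h0 h1; glra.
have [sh0' st' st'' th0] : [/\ 0 <= s + h, s - h <= t - h, s + h <= t + h & 0 <= t].
  by split; move: s0 h0 st; glra.
have ep : t + h - (s + h) = t - s by ring.
have em : t - h - (s - h) = t - s by ring.
have Hpair : `|ip (v t) (u (t + h) - u (t - h)) - ip (v s) (u (s + h) - u (s - h))
    - (t - s) * (ip (v s) (v (s + h)) - ip (v s) (v (s - h))
                 - (Q s (z (s + h)) - Q s (z (s - h))))| <=
    (t - s) * (eta * (M + 4 * e)) + 2 * h * M * (M + e) * (B t - B s).
  apply: (@symmetric_pairing_increment s t h e eta M (t2 + 1)) => //.
  - exact: ltW.
  - by move=> r r0 rt; apply: vM => //; exact: le_trans tt2.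
  - move=> r r1 r2; apply: mod; rewrite ?ler_distl; apply/andP;
      by split; move: r1 r2 sh0 sT h0; glra.
  - move=> a b r ba a0 bT /andP[ar rb]; apply: Hdv.
    + by rewrite (le_trans a0 ar) (le_trans rb bT).
    + by rewrite a0 (le_trans ar (le_trans rb bT)).
    + by rewrite ger0_norm ?subr_ge0//; move: ba ar rb tv; glra.
  - move=> r y /andP[sr rt]; apply: HdQ.
    + by rewrite (le_trans s0 sr) (le_trans rt tT).
    + by rewrite s0 (le_trans st tT).
    + by rewrite ger0_norm ?subr_ge0//; move: sr rt tQ; glra.
have HK1 := primitive_increment_modulus pK HdK s0 st tT tK.
have HK2 := primitive_increment_modulus pK HdK sh0 st' tmT; rewrite em in HK2; have {}HK2 := HK2 tK.
have HP1 := primitive_increment_modulus pP HdP s0 st tT tP.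
have HP2 := primitive_increment_modulus pP HdP sh0' st'' thT; rewrite ep in HP2; have {}HP2 := HP2 tP.
have HN1 := primitive_increment_modulus pN HdN s0 st tT tN.
have HY1 := primitive_increment_modulus pY HdY s0 st tT tY.
have HY2 := primitive_increment_modulus pY HdY sh0 st' tmT; rewrite em in HY2; have {}HY2 := HY2 tY.
have Htrap : P (s + h) - P s + dlt * h * N s - cT * h * e ^+ 2 <=
    2^-1 * (Q s (z (s + h) - z s) + Q (s + h) (z (s + h) - z s)).
  apply: trapezoid => // r r' /andP[r1 r2] /andP[r3 r4].
  have [] // := mod r r'; rewrite ?ler_distl; apply/andP;
      by split; move: r1 r2 r3 r4 s0 sT; glra.
have ts0 : 0 <= t - s by rewrite subr_ge0.
have hd : 2 * dlt * h * (NN t - NN s - (t - s) * N s) <= 2 * `|dlt| * h * (eta * (t - s)).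
  apply: le_trans (ler_norm _) _; rewrite !normrM (ger0_norm (ltW h0)) ger0_norm//.
  by rewrite ler_wpM2l// !mulr_ge0// ltW.
rewrite subrK [ip (v (s - h)) _]ipC in HK2.
rewrite !subrK (dyn_QB dyn)// in HY2.
rewrite (dyn_QB dyn)// in HY1.
rewrite !(dyn_QB dyn)// in Htrap.
have hT := ler_wpM2l ts0 Htrap.
(* Only one side of each estimate is needed, so that the final comparison is linear. *)
have [{}Hpair _] := ler_distlP Hpair.
have [_ {}HK1] := ler_distlP HK1; have [{}HK2 _] := ler_distlP HK2.
have [_ {}HP1] := ler_distlP HP1; have [{}HP2 _] := ler_distlP HP2.
have [_ {}HY1] := ler_distlP HY1; have [{}HY2 _] := ler_distlP HY2.
rewrite /shifted_energy -hC /C.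
move: Hpair HK1 HK2 HP1 HP2 HY1 HY2 hd hT.
generalize (ip (v t) (u (t + h) - u (t - h))) (ip (v s) (u (s + h) - u (s - h))) => i1 i2.
generalize (ip (v s) (v (s + h))) (ip (v s) (v (s - h))) => i3 i4.
generalize (Q s (z (s + h))) (Q s (z s)) (Q s (z (s - h))) (Q (s + h) (z (s + h))) (Q (s + h) (z s))
  => q1 q2 q3 q4 q5.
generalize (Y t) (Y s) (Y (t - h)) (Y (s - h)) => y1 y2 y3 y4.
generalize (K t) (K s) (K (t - h)) (K (s - h)) => k1 k2 k3 k4.
generalize (PP t) (PP s) (PP (t + h)) (PP (s + h)) => p1 p2 p3 p4.
generalize (P s) (P (s + h)) (NN t) (NN s) (N s) (B t) (B s) => p5 p6 n1 n2 n3 b1 b2.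
glra.
Qed.

End Core.

(** * Passage to the limit in the symmetric difference *)

Section EnergyInequality.
Context {R : realType} {H : completeNormedModType R} (ip : {dot H for idfun}).
Hypothesis hip : norm_of_inner ip.
Variables (D : set H) (L : H -> H) (u v : R -> H) (m : R) (N : R -> R)
  (Q : R -> H -> R) (B : R -> R) (dlt cT cN : R).
Hypothesis dyn : dynamics ip D L u v m N Q B dlt cT cN.
Local Notation z t := (L (u t)).
Local Notation P := (elastic_energy L u m N).

(** To first order in h, u(t+h) - u(t-h) is 2h v(t), the increment of [K] is h |v|^2, that of [PP]
    is h P, and that of [Y] is negligible because z(t+h) - z(t) is small. What remains is h (|v|^2 +
    2P), that is 2h times the energy. *)
Lemma shifted_energy_endpoint (T t h e M MQ : R) (K PP NN Y : R -> R) :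
  0 < h -> h < t -> t + h <= T -> 0 <= e -> e <= 1 -> `|v t| <= M ->
  (forall (r : R) y, 0 <= r <= T -> `|Q r y| <= MQ * `|y|) -> 0 <= MQ ->
  (forall r r' : R, 0 <= r <= T -> 0 <= r' <= T -> `|r - r'| <= h ->
    [/\ `|v r - v r'| <= e, `|z r - z r'| <= e & `|P r - P r'| <= e]) ->
  primitive (fun t => ip (v t) (v (t + h))) K -> primitive P PP ->
  primitive (fun t => Q (t + h) (z (t + h) - z t)) Y ->
  `|ip (v t) (u (t + h) - u (t - h)) - (K t - K (t - h)) +
    2 * (PP (t + h) - PP t) - (Y t - Y (t - h)) - h * (`|v t| ^+ 2 + 2 * P t)| <=
  h * e * (4 * M + 3 + MQ).
Proof.
move=> h0 ht tT e0 e1 vM QM MQ0 mod pK pP pY.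
have M0 : 0 <= M by apply: le_trans vM.
have near_t (x : R) : t - h <= x -> x <= t + h ->
    [/\ `|v x - v t| <= e, `|z x - z t| <= e & `|P x - P t| <= e].
  move=> x1 x2; apply: mod; rewrite ?ler_distl; apply/andP; split; tlra.
have Hw : `|ip (v t) (u (t + h) - u (t - h)) - 2 * h * `|v t| ^+ 2| <= 2 * h * (e * M).
  have : `|u (t + h) - u (t - h) - (t + h - (t - h)) *: v t| <= e * (t + h - (t - h)).
    apply: (derivative_increment_le hip (dyn_velocity dyn)); [by tlra|by tlra|].
    by move=> r /andP[r1 r2]; have [] := near_t r r1 r2.
  have -> : t + h - (t - h) = 2 * h by ring.
  move=> h1; rewrite hip -ipZr -ipBr; apply: le_trans (ip_cauchy_schwarz hip _ _) _.
  have -> : 2 * h * (e * M) = M * (e * (2 * h)) by ring.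
  by rewrite ler_pM.
have HK : `|K t - K (t - h) - (t - (t - h)) * `|v t| ^+ 2| <= e * (2 * M + 1) * (t - (t - h)).
  apply: (primitive_increment_le pK); [by tlra|by tlra|].
  move=> x /andP[x1 x2]; rewrite hip; apply: le_trans (ipBB_le hip _ _ _ _) _.
  have [a1 _ _] := near_t x x1 ltac:(tlra).
  have [a2 _ _] := near_t (x + h) ltac:(tlra) ltac:(tlra).
  have a3 : `|v (x + h)| <= M + 1.
    have := ler_normD (v (x + h) - v t) (v t); rewrite subrK.
    by move: a2 vM e1; glra.
  have -> : e * (2 * M + 1) = e * (M + 1) + M * e by ring.
  by rewrite lerD// ler_pM.
have HP : `|PP (t + h) - PP t - (t + h - t) * P t| <= e * (t + h - t).
  apply: (primitive_increment_le pP); [by tlra|by tlra|].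
  by move=> x /andP[x1 x2]; have [] := near_t x ltac:(tlra) x2.
have HY : `|Y t - Y (t - h) - (t - (t - h)) * 0| <= MQ * e * (t - (t - h)).
  apply: (primitive_increment_le pY); [by tlra|by tlra|].
  move=> x /andP[x1 x2]; rewrite subr0; apply: le_trans (QM _ _ _) _.
    by apply/andP; split; tlra.
  rewrite ler_wpM2l//; have [] // := mod (x + h) x ltac:(apply/andP; split; tlra)
    ltac:(apply/andP; split; tlra) ltac:(rewrite ler_distl; apply/andP; split; tlra).
have ha : t - (t - h) = h by ring.
have hb : t + h - t = h by ring.
rewrite {}ha in HK HY; rewrite {}hb in HP; rewrite mulr0 subr0 in HY.
move: Hw HK HP HY.
move: (ip _ _) (K t - _) (PP (t + h) - _) (Y t - _) (`|v t| ^+ 2) (P t) => a1 a2 a3 a4 a5 a6.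
rewrite !ler_norml => /andP[b1 b2] /andP[b3 b4] /andP[b5 b6] /andP[b7 b8].
by apply/andP; split; move: b1 b2 b3 b4 b5 b6 b7 b8; glra.
Qed.

Lemma le0_of_le_eps (x C : R) : (forall e : R, 0 < e -> e <= 1 -> x <= e * C) -> x <= 0.
Proof.
move=> h; rewrite leNgt; apply/negP => x0.
have C0 : 0 < C by have := h 1 ltr01 (lexx _); rewrite mul1r; lra.
have e0 : 0 < x / (2 * (C + x)) by rewrite divr_gt0//; lra.
have := h _ e0; rewrite ler_pdivrMr; last by lra.
have -> : x / (2 * (C + x)) * C = x * (C / (2 * (C + x))) by rewrite mulrAC mulrA.
move=> /(_ ltac:(lra)); rewrite ler_pMr// ler_pdivlMr; lra.
Qed.

Definition energy_of (t : R) := 2^-1 * `|v t| ^+ 2 + P t.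
Local Notation E := energy_of.

(** Compare [shifted_energy] at [t1] and [t2], divide by 2h, and let the tolerance e, and h with it,
    tend to 0. *)
Lemma energy_inequality (t1 t2 M : R) (NN : R -> R) :
  0 < t1 -> t1 <= t2 -> (forall r : R, 0 <= r -> r <= t2 -> `|v r| <= M) ->
  primitive N NN ->
  E t2 - E t1 + dlt * (NN t2 - NN t1) <= M ^+ 2 * (B t2 - B t1).
Proof.
move=> t10 t12 vM pN.
have [MQ MQ0 HMQ] := Q_bounded hip dyn (t2 + 1).
have M0 : 0 <= M by apply: le_trans (vM 0 _ _); rewrite ?normr_ge0//; tlra.
rewrite -subr_le0.
apply: (@le0_of_le_eps _ (4 * M + 3 + MQ + `|cT| * (t2 - t1) + M * (B t2 - B t1))).
move=> e e0 e1.
have [dv dv0 Hdv] := dyn_ucont_v dyn (t2 + 1) e0.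
have [dz dz0 Hdz] := dyn_ucont_z dyn (t2 + 1) e0.
have [dP dP0 HdP] := ucont_P hip dyn (t2 + 1) e0.
(* The step lies below the moduli of v, z and P for tolerance e; the bound 1 is required by the
   trapezoid inequality and t1 / 2 keeps t1 - h positive. *)
pose h := Num.min (Num.min (dv / 2) (dz / 2)) (Num.min (dP / 2) (Num.min 1 (t1 / 2))).
have [p1 p2 p3 p4] : [/\ 0 < dv / 2, 0 < dz / 2, 0 < dP / 2 & 0 < t1 / 2].
  by split; rewrite divr_gt0.
have h0 : 0 < h by rewrite /h !lt_min p1 p2 p3 p4 ltr01.
have : h <= h by [].
rewrite {2}/h !le_min => /andP[/andP[hv hz] /andP[hP /andP[h1 ht1]]].
have mod (r r' : R) : 0 <= r <= t2 + 1 -> 0 <= r' <= t2 + 1 -> `|r - r'| <= h ->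
    [/\ `|v r - v r'| <= e, `|z r - z r'| <= e & `|P r - P r'| <= e].
  move=> rT r'T rr; split; [apply: Hdv|apply: Hdz|apply: HdP] => //; apply: le_lt_trans rr _.
  - by move: dv0 hv; glra.
  - by move: dz0 hz; glra.
  - by move: dP0 hP; glra.
clearbody h.
have h00 := ltW h0.
have ucvh : ucont (fun t => v (t + h)) by exact: ucont_shift (dyn_ucont_v dyn).
have uczh : ucont (fun t => z (t + h)).
  exact: (ucont_shift (F := fun t => z t)) (dyn_ucont_z dyn).
have uczX : ucont (fun t => z (t + h) - z t).
  apply: ucontD uczh _; under eq_fun do rewrite -scaleN1r.
  exact/ucontZ/(dyn_ucont_z dyn).
have [K pK] := ucont_primitive (ucont_ip hip (dyn_ucont_v dyn) ucvh).
have [PP pP] := ucont_primitive (ucont_P hip dyn).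
have [Y pY] := ucont_primitive (ucont_Q hip dyn h00 uczX).
have S21 : shifted_energy ip u v B dlt cT h e M K PP NN Y t2 <=
    shifted_energy ip u v B dlt cT h e M K PP NN Y t1.
  apply: (symmetric_difference_pairing hip dyn) => //; try tlra.
  by move=> r r' rT r'T rr; have [] := mod r r' rT r'T rr.
have end_ (t : R) : t1 <= t -> t <= t2 ->
  `|ip (v t) (u (t + h) - u (t - h)) - (K t - K (t - h)) +
    2 * (PP (t + h) - PP t) - (Y t - Y (t - h)) - h * (`|v t| ^+ 2 + 2 * P t)| <=
  h * e * (4 * M + 3 + MQ).
  move=> tt1 tt2; apply: (@shifted_energy_endpoint (t2 + 1)) => //; try tlra.
  by apply: vM; tlra.
have hcT : cT * e ^+ 2 * (t2 - t1) <= e * (`|cT| * (t2 - t1)).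
  rewrite [leRHS]mulrA ler_wpM2r ?subr_ge0// mulrC.
  apply: (@le_trans _ _ (e ^+ 2 * `|cT|)); first by rewrite ler_wpM2l ?sqr_ge0// ler_norm.
  by rewrite ler_wpM2r// expr2 ger_pMl.
have B12 : 0 <= B t2 - B t1 by rewrite subr_ge0; apply: (dyn_B_homo dyn) => //; exact: ltW.
have := end_ t1 (lexx _) t12; have := end_ t2 t12 (lexx _).
move: S21; rewrite /shifted_energy /energy_of.
move: (ip _ (u (t1 + h) - _)) (K t1 - _) (PP (t1 + h) - _) (Y t1 - _) => a1 a2 a3 a4.
move: (ip _ (u (t2 + h) - _)) (K t2 - _) (PP (t2 + h) - _) (Y t2 - _) => c1 c2 c3 c4.
move: (`|v t1| ^+ 2) (`|v t2| ^+ 2) (P t1) (P t2) (NN t1) (NN t2) (B t1) (B t2) B12 => k1 k2 k3 k4 n1 n2 b1 b2 B12.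
move=> S21 /ler_distlP[d1 d2] /ler_distlP[d3 d4].
rewrite -(ler_pM2l h0); move: (ler_wpM2l h00 hcT) S21 d2 d3; glra.
Qed.

End EnergyInequality.

(** * Boundedness of the energy and integrability of the memory energy *)

Lemma homo_bounded_tail {R : realType} (f : R -> R) (C : R) :
  (forall s t : R, 0 <= s -> s <= t -> f s <= f t) -> (forall t : R, 0 <= t -> f t <= C) ->
  forall e : R, 0 < e -> exists2 S : R, 0 < S &
    forall s t : R, S <= s -> s <= t -> f t - f s <= e.
Proof.
move=> fh fC e e0; pose A := [set f t | t in [set t | 0 <= t]].
have Asup : has_sup A.
  by split; [exists (f 0), 0 => //=|exists C => _ [t /= t0 <-]; exact: fC].
have [_ [t0 /= t00 <-] ht] := sup_adherent e0 Asup.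
exists (t0 + 1); first by lra.
move=> s t s0 st.
have h1 : f t <= sup A.
  by apply: sup_upper_bound => //; exists t => //=; lra.
have h2 : f t0 <= f s by apply: fh => //; lra.
lra.
Qed.

Section Boundedness.
Context {R : realType} {H : completeNormedModType R} (ip : {dot H for idfun}).
Hypothesis hip : norm_of_inner ip.
Variables (D : set H) (L : H -> H) (u v : R -> H) (m : R) (N : R -> R)
  (Q : R -> H -> R) (B : R -> R) (dlt cT cN : R).
Hypothesis dyn : dynamics ip D L u v m N Q B dlt cT cN.
Hypothesis dlt0 : 0 < dlt.
Variable Binf : R.
Hypothesis B_le : forall t : R, 0 <= t -> B t <= Binf.
Local Notation z t := (L (u t)).
Local Notation P := (elastic_energy L u m N).
Local Notation E := (energy_of L u v m N).

Lemma ucont_E : ucont E.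
Proof.
apply: ucontD (ucont_P hip dyn).
by have /(ucontZ 2^-1) := ucont_sqnorm hip (dyn_ucont_v dyn).
Qed.

Lemma E_ge0 (t : R) : 0 <= t -> 0 <= E t.
Proof.
by move=> t0; rewrite addr_ge0 ?(P_ge0 dyn)// mulr_ge0// ?sqr_ge0// invr_ge0.
Qed.

Lemma v_le_E (t K : R) : 0 <= t -> E t <= K -> `|v t| <= Num.sqrt (2 * K).
Proof.
move=> t0 tK; rewrite -[leLHS]ger0_norm// -sqrtr_sqr ler_wsqrtr//.
by have := P_ge0 dyn t0; move: tK; rewrite /energy_of; move: (P t) => p; glra.
Qed.

Lemma primitive_N_homo NN (s t : R) : primitive N NN -> 0 <= s -> s <= t -> NN s <= NN t.
Proof.
move=> pN s0 st; rewrite -subr_ge0; have [x /andP[sx _] ->] := pN s t s0 st.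
by rewrite mulr_ge0 ?subr_ge0// (dyn_N_ge0 dyn)// (le_trans s0).
Qed.

(** [K] has to bound the energy on all of [0, t2], because the feedback acts through an earlier
    velocity. *)
Lemma energy_growth (t1 t2 K : R) : 0 < t1 -> t1 <= t2 ->
  (forall r : R, 0 <= r -> r <= t2 -> E r <= K) -> E t2 - E t1 <= 2 * K * (B t2 - B t1).
Proof.
move=> t10 t12 hK; have [NN pN] := ucont_primitive (dyn_ucont_N dyn).
have K0 : 0 <= K by apply: le_trans (E_ge0 (lexx 0)) (hK _ _ _) => //; lra.
have := energy_inequality hip dyn t10 t12 (M := Num.sqrt (2 * K)) _ pN.
rewrite sqr_sqrtr ?mulr_ge0// => h.
have : E t2 - E t1 + dlt * (NN t2 - NN t1) <= 2 * K * (B t2 - B t1).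
  by apply: h => r r0 rt; apply: v_le_E => //; exact: hK.
have : 0 <= dlt * (NN t2 - NN t1).
  by rewrite mulr_ge0 ?(ltW dlt0)// subr_ge0 (primitive_N_homo pN)// ltW.
lra.
Qed.

(** Beyond a time [S] the increments of [B] are at most 1/8, so the growth bound contributes at most
    a quarter of the running supremum, which is absorbed on the left. *)
Lemma energy_bounded : exists2 K : R, 0 < K & forall t : R, 0 <= t -> E t <= K.
Proof.
have e8 : 0 < 8^-1 :> R by rewrite invr_gt0.
have [S S0 HS] := homo_bounded_tail (dyn_B_homo dyn) B_le e8.
have [K K0 HK] := ucont_bounded ucont_E S.
exists (2 * K); first by rewrite mulr_gt0.
move=> T T0; pose A := [set E t | t in [set t | 0 <= t <= T]].
have Asup : has_sup A.
  split; first by exists (E 0), 0 => //=; rewrite lexx.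
  have [C C0 HC] := ucont_bounded ucont_E T.
  by exists C => _ [t /= tT <-]; apply: le_trans (ler_norm _) (HC _ tT).
have EA (r : R) : 0 <= r -> r <= T -> E r <= sup A.
  by move=> r0 rT; apply: sup_upper_bound => //; exists r => //=; rewrite r0.
have sA : sup A <= K + sup A / 4.
  apply: ge_sup; first by case: Asup.
  move=> _ [t /= /andP[t0 tT] <-].
  have A0 : 0 <= sup A by apply: le_trans (E_ge0 t0) (EA t t0 tT).
  have [tS|St] := leP t S.
    have := HK t; rewrite t0 tS => /(_ erefl) /(le_trans (ler_norm _)); lra.
  have h1 := energy_growth S0 (ltW St) (fun r r0 rt => EA r r0 (le_trans rt tT)).
  have h2 := HS _ _ (lexx S) (ltW St).
  have h3 : E S <= K.
    by have := HK S; rewrite (ltW S0) lexx => /(_ erefl) /(le_trans (ler_norm _)).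
  have h4 : 2 * sup A * (B t - B S) <= 2 * sup A * 8^-1 by rewrite ler_wpM2l// mulr_ge0.
  lra.
have := EA T T0 (lexx _); lra.
Qed.

(** With the velocity bounded for all times, the feedback can inject only finitely much energy, and
    the dissipated amount [dlt] times the integral of [N] is bounded accordingly. *)
Lemma memory_integral_bounded NN : primitive N NN ->
  exists2 K : R, 0 < K & forall s t : R, 1 <= s -> s <= t -> NN t - NN s <= K.
Proof.
move=> pN; have [K K0 HK] := energy_bounded.
have K2 : 0 <= 2 * K by rewrite mulr_ge0// ltW.
have BB (s t : R) : 0 <= s -> s <= t -> B t - B s <= `|Binf - B 0|.
  move=> s0 st; apply: le_trans (ler_norm _).
  by have := dyn_B_homo dyn (lexx 0) s0; have := B_le (le_trans s0 st); lra.
exists ((K + 2 * K * `|Binf - B 0|) / dlt).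
  by rewrite divr_gt0// ltr_wpDr// mulr_ge0.
move=> s t s1 st; have s0 : 0 < s by lra.
have := energy_inequality hip dyn s0 st (M := Num.sqrt (2 * K)) _ pN.
rewrite sqr_sqrtr// => h.
have h1 : E t - E s + dlt * (NN t - NN s) <= 2 * K * (B t - B s).
  by apply: h => r r0 rt; apply: v_le_E => //; exact: HK.
rewrite ler_pdivlMr// mulrC.
have h2 : 2 * K * (B t - B s) <= 2 * K * `|Binf - B 0| by rewrite ler_wpM2l// BB// ltW.
have h3 := HK _ (ltW s0).
have h4 : 0 <= E t by apply: E_ge0; lra.
lra.
Qed.

End Boundedness.

                                            

(** * Integrals of continuous functions on compact intervals *)

Section IntegralOfUcont.
Context {R : realType}.
Local Notation leb := (@lebesgue_measure R).
Local Notation "'J' c f" := (\int[leb]_(s in `[0, c]) f s) (at level 0, c at level 0, f at level 0).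

Lemma ucont_cst {V : normedModType R} (k : V) : ucont (fun _ : R => k).
Proof. by move=> T e e0; exists 1 => // s t _ _ _; rewrite subrr normr0 ltW. Qed.

Lemma ucont_id : ucont (fun t : R => t : R^o).
Proof. by move=> T e e0; exists e => // s t _ _ /ltW. Qed.

Lemma ucontM (f g : R -> R) : ucont f -> ucont g -> ucont (fun t => f t * g t).
Proof.
move=> Hf Hg T e e0.
have [Mf Mf0 HMf] := ucont_bounded Hf T; have [Mg Mg0 HMg] := ucont_bounded Hg T.
have e1 : 0 < e / (Mf + Mg) by rewrite divr_gt0// addr_gt0.
have [d1 d10 H1] := Hf T _ e1; have [d2 d20 H2] := Hg T _ e1.
exists (Num.min d1 d2); first by rewrite lt_min d10.
move=> s t sT tT; rewrite lt_min => /andP[st1 st2].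
have -> : f s * g s - f t * g t = (f s - f t) * g s + f t * (g s - g t) by ring.
apply: le_trans (ler_normD _ _) _; rewrite !normrM.
have -> : e = e / (Mf + Mg) * Mg + Mf * (e / (Mf + Mg)).
  by field; rewrite gt_eqF// addr_gt0.
by rewrite lerD// ler_pM// ?H1 ?H2 ?HMf ?HMg.
Qed.

(** The truncation at 0 makes s -> f(t - s) continuous on the whole half line; it disappears where s
    <= t. *)
Lemma ucont_reflect {V : normedModType R} (t : R) (f : R -> V) : ucont f ->
  ucont (fun s => f (Num.max 0 (t - s))).
Proof.
move=> Hf T e e0; have [d d0 Hd] := Hf `|t| e e0; exists d => // s s' /andP[s0 sT] /andP[s'0 s'T] ss.
have h3 := ler_norm t; have h4 := normr_ge0 t.
have mt (x : R) : 0 <= x -> 0 <= Num.max 0 (t - x) <= `|t|.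
  move=> x0; rewrite le_max lexx/= ge_max h4/=; lra.
apply: Hd; [exact: mt|exact: mt|apply: le_lt_trans ss].
have h1 := ler_norm (s - s'); have h2 := ler_norm (s' - s); rewrite distrC in h2.
by case: (leP 0 (t - s)) => ?; case: (leP 0 (t - s')) => ?; rewrite ler_norml; apply/andP; split; lra.
Qed.

Lemma ucont_within (f : R -> R) (c : R) : ucont f -> {within `[0, c], continuous f}.
Proof.
move=> Hf; have := continuous_subspaceT (A := `[0, c]) (ucont_continuous_max Hf).
apply: subspace_eq_continuous => x; rewrite inE/= in_itv/= => /andP[x0 _].
by rewrite /from_subspace max_r.
Qed.

Lemma ucont_integrable (f : R -> R) (c : R) : ucont f -> leb.-integrable `[0, c] (EFin \o f).
Proof.
move=> Hf; apply: continuous_compact_integrable; first exact: segment_compact.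
exact: ucont_within.
Qed.

Lemma intD (f g : R -> R) (c : R) : ucont f -> ucont g ->
  J c (fun s => f s + g s) = J c f + J c g.
Proof. by move=> Hf Hg; apply: RintegralD => //; exact: ucont_integrable. Qed.

Lemma intZ (f : R -> R) (k c : R) : ucont f -> J c (fun s => k * f s) = k * J c f.
Proof. by move=> Hf; apply: RintegralZl => //; exact: ucont_integrable. Qed.

Lemma le_int (f g : R -> R) (c : R) : ucont f -> ucont g ->
  (forall s : R, 0 <= s -> s <= c -> f s <= g s) -> J c f <= J c g.
Proof.
move=> Hf Hg fg; apply: le_Rintegral => //; try exact: ucont_integrable.
by move=> x; rewrite /= in_itv/= => /andP[]; exact: fg.
Qed.

Lemma int_FTC (f F : R -> R) (c : R) : 0 < c -> ucont f ->
  (forall s : R, 0 <= s -> s <= c -> is_derive s 1 F (f s)) -> J c f = F c - F 0.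
Proof.
move=> c0 Hf dF; have cF (s : R) : 0 <= s -> s <= c -> {for s, continuous F}.
  move=> s0 sc; apply/differentiable_continuous/derivable1_diffP.
  by have [] := dF s s0 sc.
rewrite /Rintegral (@continuous_FTC2 _ f F 0 c)//.
- exact: ucont_within.
- split.
  + by move=> x /[!in_itv]/= /andP[x0 xc]; have [] := dF x (ltW x0) (ltW xc).
  + by apply: cvg_at_right_filter; apply: cF => //; exact: ltW.
  + by apply: cvg_at_left_filter; apply: cF => //; exact: ltW.
- move=> x /[!in_itv]/= /andP[x0 xc]; have [dFx <-] := dF x (ltW x0) (ltW xc).
  by rewrite derive1E.
Qed.

End IntegralOfUcont.

(** * The multipliers *)

Section Multipliers.
Context {R : realType} {H : completeNormedModType R} (ip : {dot H for idfun}).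
Hypothesis hip : norm_of_inner ip.
Variables (D : set H) (L : H -> H) (u v : R -> H) (m : R) (N : R -> R)
  (Q : R -> H -> R) (B : R -> R) (dlt cT cN : R).
Hypothesis dyn : dynamics ip D L u v m N Q B dlt cT cN.
Local Notation z t := (L (u t)).
Local Notation P := (elastic_energy L u m N).
Local Notation E := (energy_of L u v m N).
Local Notation leb := (@lebesgue_measure R).
Variables (cP s0 cH M Z : R).
Hypotheses (cP0 : 0 <= cP) (s00 : 0 < s0).
Hypothesis poincare : forall x, D x -> `|x| <= cP * `|L x|.
Hypothesis history : forall t : R, s0 <= t ->
  \int[leb]_(s in `[0, s0]) (`|z t - z (Num.max 0 (t - s))| ^+ 2) <= cH * N t.
Hypothesis vM : forall t : R, 0 <= t -> `|v t| <= M.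
Hypothesis zZ : forall t : R, 0 <= t -> `|z t| <= Z.

Lemma bounds_ge0 : 0 <= M /\ 0 <= Z.
Proof. by split; [apply: le_trans (vM (lexx 0))|apply: le_trans (zZ (lexx 0))]. Qed.

Lemma poincare_sub (s t : R) : 0 <= s -> 0 <= t -> `|u s - u t| <= cP * `|z s - z t|.
Proof.
move=> s0' t0; have [Dst <-] := dyn_linear dyn (dyn_domain dyn s0') (dyn_domain dyn t0).
exact: poincare.
Qed.

Lemma ucont_u : ucont u.
Proof.
move=> T e e0; have e1 : 0 < e / (1 + cP) by rewrite divr_gt0// ltr_wpDr.
have [d d0 Hd] := dyn_ucont_z dyn T e1; exists d => // s t sT tT st.
apply: le_trans (poincare_sub _ _) _; [by case/andP: sT|by case/andP: tT|].
have := Hd s t sT tT st; rewrite ler_pdivlMr ?ltr_wpDr// => h; apply: le_trans h.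
by have := normr_ge0 (z s - z t); glra.
Qed.

(** Product rules for the two multipliers. The step [d] is chosen before the delay s, so the second
    estimate is uniform in s and can be integrated over a window of delays. *)
Lemma pairing_local (T eta : R) : 0 < eta -> exists2 d : R, 0 < d &
  forall r t : R, 0 < r -> r <= t -> t <= T -> t - r < d ->
    `|ip (v t) (u t) - ip (v r) (u r) - (t - r) * (`|v r| ^+ 2 - Q r (z r))| <=
      (t - r) * (eta * (Z + 2 * M)) + M * (cP * Z) * (B t - B r) /\
    forall s : R, 0 <= s -> s < r ->
    `|ip (v t) (u t - u (t - s)) - ip (v r) (u r - u (r - s)) -
      (t - r) * (ip (v r) (v r - v (r - s)) - Q r (z r - z (r - s)))| <=
      (t - r) * (eta * (2 * Z + 3 * M)) + 2 * (M * (cP * Z)) * (B t - B r).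
Proof.
move=> eta0; have [M0 Z0] := bounds_ge0.
have eta20 : 0 < eta / 2 by rewrite divr_gt0.
have [dv dv0 Hdv] := dyn_ucont_v dyn T eta20.
have [dQ dQ0 HdQ] := dyn_Q_cont dyn T eta0.
exists (Num.min dv dQ); first by rewrite lt_min dv0.
move=> r t r0 rt tT; rewrite lt_min => /andP[rtv rtQ].
have B0 : 0 <= B t - B r by rewrite subr_ge0; apply: (dyn_B_homo dyn) => //; exact: ltW.
have tr0 : 0 <= t - r by rewrite subr_ge0.
have vclose (a b : R) : b - a = t - r -> 0 <= a -> b <= T ->
    forall x : R, a <= x <= b -> `|v x - v a| <= eta / 2.
  move=> ba a0 bT x /andP[ax xb]; apply: Hdv; try by apply/andP; split; tlra.
  by rewrite ger0_norm ?subr_ge0//; tlra.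
have Qclose (x : R) (y : H) : r <= x <= t -> `|Q x y - Q r y| <= eta * `|y|.
  move=> /andP[rx xt]; apply: HdQ; try by apply/andP; split; tlra.
  by rewrite ger0_norm ?subr_ge0//; tlra.
have vt : `|v t - v r| <= eta.
  have : `|v t - v r| <= eta / 2 by apply: (@vclose r t) => //; [tlra|rewrite rt lexx].
  by move: eta0; glra.
have du (a b : R) : b - a = t - r -> 0 < a -> b <= T ->
    `|u b - u a - (t - r) *: v a| <= eta / 2 * (t - r).
  move=> ba a0 bT; rewrite -ba.
  apply: (derivative_increment_le hip (dyn_velocity dyn)) => //; first by tlra.
  by apply: vclose => //; exact: ltW.
have ur : `|u r| <= cP * Z.
  apply: le_trans (poincare (dyn_domain dyn (ltW r0))) _.
  by rewrite ler_wpM2l// zZ// ltW.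
split.
  have := pairing_increment hip dyn (ltW r0) rt (dyn_domain dyn (ltW r0))
     (fun x x0 _ => vM x0) Qclose vt (wt := u t) (w' := v r).
  rewrite -hip => h; apply: le_trans (h _) _.
    by have := du r t erefl r0 tT; move: (mulr_ge0 (ltW eta20) tr0); glra.
  apply: lerD.
    rewrite ler_wpM2l// ler_wpM2l ?(ltW eta0)//.
    by move: (zZ (ltW r0)) (vM (ltW r0)); glra.
  by rewrite ler_wpM2r// ler_wpM2l.
move=> s s0' sr.
have rs0 : 0 <= r - s by tlra.
have [Dw Lw] := dyn_linear dyn (dyn_domain dyn (ltW r0)) (dyn_domain dyn rs0).
have ws : `|u r - u (r - s)| <= cP * (2 * Z).
  apply: le_trans (poincare_sub (ltW r0) rs0) _; rewrite ler_wpM2l//.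
  by apply: le_trans (ler_normB _ _) _; move: (zZ (ltW r0)) (zZ rs0); glra.
have := pairing_increment hip dyn (ltW r0) rt Dw
     (fun x x0 _ => vM x0) Qclose vt (wt := u t - u (t - s)) (w' := v r - v (r - s)).
rewrite Lw => h; apply: le_trans (h _) _.
  have -> : u t - u (t - s) - (u r - u (r - s)) - (t - r) *: (v r - v (r - s)) =
      (u t - u r - (t - r) *: v r) - (u (t - s) - u (r - s) - (t - r) *: v (r - s)).
    by rewrite scalerBr subr3ACA.
  apply: le_trans (ler_normB _ _) _.
  have := du r t erefl r0 tT; have := du (r - s) (t - s) ltac:(ring) ltac:(tlra) ltac:(tlra).
  glra.
apply: lerD.
  rewrite ler_wpM2l// ler_wpM2l ?(ltW eta0)//.
  have := ler_normB (z r) (z (r - s)); have := ler_normB (v r) (v (r - s)).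
  by move: (zZ (ltW r0)) (vM (ltW r0)) (zZ rs0) (vM rs0); glra.
rewrite ler_wpM2r// -mulrCA ler_wpM2l//.
by have -> : 2 * (cP * Z) = cP * (2 * Z) by ring.
Qed.

End Multipliers.

Section DelayedPairing.
Context {R : realType} {H : completeNormedModType R} (ip : {dot H for idfun}).
Hypothesis hip : norm_of_inner ip.
Variables (D : set H) (L : H -> H) (u v : R -> H) (m : R) (N : R -> R)
  (Q : R -> H -> R) (B : R -> R) (dlt cT cN : R).
Hypothesis dyn : dynamics ip D L u v m N Q B dlt cT cN.
Local Notation z t := (L (u t)).
Local Notation P := (elastic_energy L u m N).
Local Notation E := (energy_of L u v m N).
Local Notation leb := (@lebesgue_measure R).
Local Notation "'J' c f" := (\int[leb]_(s in `[0, c]) f s) (at level 0, c at level 0, f at level 0).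
Variables (cP s0 cH M Z : R).
Hypotheses (cP0 : 0 <= cP) (s00 : 0 < s0).
Hypothesis poincare : forall x, D x -> `|x| <= cP * `|L x|.
Hypothesis history : forall t : R, s0 <= t ->
  \int[leb]_(s in `[0, s0]) (`|z t - z (Num.max 0 (t - s))| ^+ 2) <= cH * N t.
Hypothesis vM : forall t : R, 0 <= t -> `|v t| <= M.
Hypothesis zZ : forall t : R, 0 <= t -> `|z t| <= Z.

Lemma ucont_cst_sub {V : normedModType R} (a : V) (f : R -> V) : ucont f -> ucont (fun s => a - f s).
Proof.
move=> Hf; apply: ucontD; first exact: ucont_cst.
by under eq_fun do rewrite -scaleN1r; exact: ucontZ.
Qed.

Lemma ucont_weight : ucont (fun s : R => s0 - s : R^o).
Proof. exact/(ucont_cst_sub (V := R^o))/ucont_id. Qed.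

Lemma int_weight : J s0 (fun s => s0 - s) = s0 ^+ 2 / 2.
Proof.
have dF (s : R) : 0 <= s -> s <= s0 ->
    is_derive s 1 (fun s => s0 * s - 2^-1 * (s * s)) (s0 - s).
  by move=> _ _; apply: is_derive_eq; rewrite /GRing.scale/=; field.
by rewrite (int_FTC s00 ucont_weight dF); field.
Qed.

Lemma int_cst (k : R) : J s0 (fun _ => k) = k * s0.
Proof.
have dF (s : R) : 0 <= s -> s <= s0 -> is_derive s 1 (fun s => k * s) k.
  by move=> _ _; apply: is_derive_eq; rewrite /GRing.scale/=; ring.
by rewrite (int_FTC s00 (ucont_cst (k : R^o)) dF) mulr0 subr0.
Qed.

                                                                                
(** Its time derivative contains s0^2 / 2 times |v|^2. The weight s0 - s vanishes at the end of the
    window, so that an integration by parts in s leaves no boundary term. *)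
Definition delayed_pairing (t : R) :=
  J s0 (fun s => (s0 - s) * ip (v t) (u t - u (Num.max 0 (t - s)))).

Lemma ucont_past (t : R) : ucont (fun s => u t - u (Num.max 0 (t - s))).
Proof. exact/ucont_cst_sub/ucont_reflect/(ucont_u dyn cP0 poincare). Qed.

Lemma ucont_ip_cst (a : H) (f : R -> H) : ucont f -> ucont (fun s => ip a (f s)).
Proof. by move=> Hf; apply: (ucont_ip hip) => //; exact: ucont_cst. Qed.

Lemma ucont_delayed (t : R) : ucont (fun s => (s0 - s) * ip (v t) (u t - u (Num.max 0 (t - s)))).
Proof. by apply: ucontM; [exact: ucont_weight|exact/ucont_ip_cst/ucont_past]. Qed.

(** The derivative in s of (s0 - s) times the pairing of v(r) with u(r) - u(r - s), for s below
    r. *)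
Let psi' (r s : R) := (s0 - s) * ip (v r) (v (Num.max 0 (r - s))) -
  ip (v r) (u r - u (Num.max 0 (r - s))).

Lemma ucont_psi' r : ucont (psi' r).
Proof.
apply: ucontD.
  apply: ucontM; first exact: ucont_weight.
  exact/ucont_ip_cst/ucont_reflect/(dyn_ucont_v dyn).
under eq_fun do rewrite -mulN1r.
exact/(ucontZ (V := R^o))/ucont_ip_cst/ucont_past.
Qed.

                                                                               
                                                                     
(** The primitive vanishes at s = 0, where the difference of positions is 0, and at s = s0, where
    the weight is 0. Velocities at two different times are thereby traded for differences of
    positions, which the memory controls. *)
Lemma int_psi' (r : R) : s0 < r -> J s0 (psi' r) = 0.
Proof.
move=> s0r.
have dF (s : R) : 0 <= s -> s <= s0 ->
    is_derive s 1 (fun s => (s0 - s) * ip (v r) (u r - u (r - s))) (psi' r s).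
  move=> s_ge0 ss0; have rs : 0 < r - s by lra.
  have d1 : is_derive s 1 (fun s => ip (u (r - s)) (v r)) (- ip (v (r - s)) (v r)).
    have dg : is_derive s 1 (fun s => r - s) (-1).
      by apply: is_derive_eq; rewrite add0r mul1r.
    have df : is_derive (r - s) 1 (fun s => ip (u s) (v r)) (ip (v (r - s)) (v r)).
      exact/(ip_is_derive hip)/(derivative_ge0_is_derive (dyn_velocity dyn)).
    by have := @is_derive1_comp R (fun s => ip (u s) (v r)) (fun s => r - s) s _ _ df dg; rewrite mulrN1.
  have -> : (fun s => (s0 - s) * ip (v r) (u r - u (r - s))) =
      (fun s => (s0 - s) * (ip (u r) (v r) - ip (u (r - s)) (v r))).
    by apply/funext => x; rewrite ipC ipBl.
  apply: is_derive_eq.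
  rewrite /psi' max_r ?(ltW rs)// /GRing.scale/= [ip (v r) (v _)]ipC [ip (v r) (_ - _)]ipC ipBl.
  by ring.
rewrite (int_FTC s00 (ucont_psi' r) dF).
by rewrite subrr mul0r !subr0 subrr ip0r mulr0 subrr.
Qed.

(** Young's inequality. With the coefficient 1/8 the energy costs s0^2 / 16 after integration of the
    weight, hence one half after multiplication by 8 / s0^2. *)
Lemma Q_le_E (r : R) (y : H) : 0 <= r -> `|Q r y| <= E r / 8 + 4 * `|y| ^+ 2.
Proof.
move=> r0; have P0 := P_ge0 dyn r0; have y2 : 0 <= `|y| ^+ 2 := sqr_ge0 _.
have PE : P r <= E r by rewrite /energy_of lerDr mulr_ge0// sqr_ge0.
rewrite -(@ler_pXn2r _ 2)// ?nnegrE//; last by move: (le_trans P0 PE) y2; lra.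
rewrite real_normK ?num_real//; apply: le_trans (Qbound dyn _ r0) _.
apply: (@le_trans _ _ (2 * E r * `|y| ^+ 2)); first by rewrite ler_wpM2r// ler_wpM2l.
move: (E r) (`|y| ^+ 2) => p q; rewrite -subr_ge0.
have -> : (p / 8 + 4 * q) ^+ 2 - 2 * p * q = (p / 8 - 4 * q) ^+ 2 by field.
exact: sqr_ge0.
Qed.

(** The weight integrates the kinetic term to s0^2 / 2 |v|^2; half of it pays for the pairing of v
    with differences of positions by Young's inequality. The remaining squares of z(r) - z(r - s)
    are bounded through [history] by the memory energy. *)
Lemma delayed_pairing_increment (r t err : R) : s0 < r -> r <= t ->
  (forall s : R, 0 <= s -> s <= s0 ->
    `|ip (v t) (u t - u (t - s)) - ip (v r) (u r - u (r - s)) -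
      (t - r) * (ip (v r) (v r - v (r - s)) - Q r (z r - z (r - s)))| <= err) ->
  (t - r) * (s0 ^+ 2 / 4 * `|v r| ^+ 2 - s0 ^+ 2 / 16 * E r
    - (cP ^+ 2 / s0 + 4 * s0) * cH * N r) - s0 ^+ 2 / 2 * err <=
  delayed_pairing t - delayed_pairing r.
Proof.
move=> s0r rt Herr; have r0 : 0 < r by exact: lt_trans s0r.
have tr0 : 0 <= t - r by rewrite subr_ge0.
pose zeta s := `|z r - z (Num.max 0 (r - s))| ^+ 2.
have uzeta : ucont zeta.
  apply: (ucont_sqnorm hip); apply: ucont_cst_sub.
  exact: (ucont_reflect r (f := fun t => z t) (dyn_ucont_z dyn)).
pose c := cP ^+ 2 / s0 + 4 * s0.
have c0 : 0 <= c.
  apply: addr_ge0; last by apply: mulr_ge0 => //; exact: ltW.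
  by apply: divr_ge0; [exact: sqr_ge0|exact: ltW].
pose a1 := (t - r) * (`|v r| ^+ 2 - E r / 8) - err.
pose a2 := - ((t - r) * (s0 / 4 * `|v r| ^+ 2)).
(* A pointwise lower bound for the integrand at time t whose integral is explicit: the multiple of
   [psi'] integrates to 0 and [zeta] is controlled by [history]. *)
pose g s := (s0 - s) * ip (v r) (u r - u (Num.max 0 (r - s))) +
  (a1 * (s0 - s) + (a2 + ((r - t) * psi' r s + ((r - t) * c) * zeta s))).
have u1 : ucont (fun s => (r - t) * psi' r s + ((r - t) * c) * zeta s).
  by apply: ucontD; [exact/(ucontZ (V := R^o))/ucont_psi'|exact: (ucontZ (V := R^o))].
have u2 : ucont (fun s => a2 + ((r - t) * psi' r s + ((r - t) * c) * zeta s)).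
  by apply: ucontD u1; exact: (ucont_cst (V := R^o)).
have u3 : ucont (fun s => a1 * (s0 - s) + (a2 + ((r - t) * psi' r s + ((r - t) * c) * zeta s))).
  by apply: ucontD u2; exact/(ucontZ (V := R^o))/ucont_weight.
have ug : ucont g by apply: ucontD u3; exact: ucont_delayed.
have Jg : J s0 g = delayed_pairing r + (a1 * (s0 ^+ 2 / 2) + (a2 * s0 + ((r - t) * c) * J s0 zeta)).
  rewrite intD//; last exact: ucont_delayed.
  congr (_ + _); rewrite intD//; last exact/(ucontZ (V := R^o))/ucont_weight.
  rewrite intZ; last exact: ucont_weight.
  rewrite int_weight; congr (_ + _).
  rewrite intD//; last exact: (ucont_cst (V := R^o)).
  rewrite int_cst; congr (_ + _).
  rewrite intD; [|exact/(ucontZ (V := R^o))/ucont_psi'|exact: (ucontZ (V := R^o))].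
  by rewrite !intZ//; [rewrite int_psi'// mulr0 add0r|exact: ucont_psi'].
have gle : J s0 g <= delayed_pairing t.
  apply: le_int => //; first exact: ucont_delayed.
  move=> s s_ge0 ss0.
  rewrite /g /zeta /psi' !max_r; try lra.
  have rs0 : 0 <= r - s by lra.
  have := Herr s s_ge0 ss0; rewrite ler_norml => /andP[+ _].
  have [ws1 ws2] : `|u r - u (r - s)| <= cP * `|z r - z (r - s)| /\
     ip (v r) (u r - u (r - s)) <= s0 / 4 * `|v r| ^+ 2 + cP ^+ 2 / s0 * `|z r - z (r - s)| ^+ 2.
    have h : `|u r - u (r - s)| <= cP * `|z r - z (r - s)|.
      exact: (poincare_sub dyn poincare (ltW r0) rs0).
    split => //; apply: le_trans (ip_le hip _ _) _.
    apply: (@le_trans _ _ (`|v r| * (cP * `|z r - z (r - s)|))); first by rewrite ler_wpM2l.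
    move: `|v r| `|_ - _| => x y; rewrite -subr_ge0.
    (* Young's inequality as a completed square. *)
    have -> : s0 / 4 * x ^+ 2 + cP ^+ 2 / s0 * y ^+ 2 - x * (cP * y) =
       s0^-1 * (s0 / 2 * x - cP * y) ^+ 2 by field; rewrite gt_eqF.
    by apply: mulr_ge0; rewrite ?sqr_ge0// invr_ge0 ltW.
  have [_ hQ] := ler_normlP _ _ (Q_le_E (z r - z (r - s)) (ltW r0)).
  have y2 : 0 <= `|z r - z (r - s)| ^+ 2 := sqr_ge0 _.
  have hi : ip (v r) (v r - v (r - s)) = `|v r| ^+ 2 - ip (v r) (v (r - s)) by rewrite ipBr -hip.
  move: hi hQ ws2 y2; rewrite /a1 /a2 /c.
  move: (ip (v r) (v r - _)) (Q r _) (ip (v r) (u r - _)) (ip (v t) _) (ip (v r) (v (r - s)))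
    (`|z r - _| ^+ 2) (`|v r| ^+ 2) (E r) => k1 k2 k3 k4 k5 k6 k7 k8 -> hQ ws2 y2 he.
  have k0 : 0 <= s0 - s by rewrite subr_ge0.
  have h1 := ler_wpM2l k0 he.
  have h2 := ler_wpM2l tr0 ws2.
  have h3 := ler_wpM2l tr0 (ler_wpM2l k0 hQ).
  have h4 : (t - r) * ((s0 - s) * (4 * k6)) <= (t - r) * (s0 * (4 * k6)).
    by rewrite ler_wpM2l// ler_wpM2r ?mulr_ge0//; lra.
  move: (cP ^+ 2 / s0) h1 h2 h3 h4 => cc h1 h2 h3 h4.
  lra.
have hz : (t - r) * c * J s0 zeta <= (t - r) * c * (cH * N r).
  by rewrite ler_wpM2l ?mulr_ge0// history// ltW.
move: gle hz; rewrite {}Jg /a1 /a2 -/c.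
move: (J s0 zeta) (delayed_pairing r) (delayed_pairing t) (`|v r| ^+ 2) (E r) (N r) => k1 k2 k3 k4 k5 k6.
clearbody c; lra.
Qed.

Lemma delayed_pairing_bounded (t : R) : s0 <= t -> `|delayed_pairing t| <= 2 * s0 ^+ 2 * (M * (cP * Z)).
Proof.
move=> s0t; have [M0 Z0] := bounds_ge0 vM zZ; have t0 : 0 <= t := le_trans (ltW s00) s0t.
have s0' := s00.
have K0 : 0 <= M * (cP * Z) by rewrite !mulr_ge0.
have fle (s : R) : 0 <= s -> s <= s0 ->
    `|(s0 - s) * ip (v t) (u t - u (Num.max 0 (t - s)))| <= s0 * (2 * (M * (cP * Z))).
  move=> s_ge0 ss0; rewrite normrM; apply: ler_pM => //.
    by rewrite ger0_norm; lra.
  rewrite max_r; last by lra.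
  apply: le_trans (ip_cauchy_schwarz hip _ _) _.
  have -> : 2 * (M * (cP * Z)) = M * (cP * (2 * Z)) by ring.
  apply: ler_pM => //; first exact: vM.
  have ts : 0 <= t - s by lra.
  apply: le_trans (poincare_sub dyn poincare t0 ts) _; rewrite ler_wpM2l//.
  apply: le_trans (ler_normB _ _) _; have := zZ t0; have := zZ ts; lra.
have J1 := int_cst (s0 * (2 * (M * (cP * Z)))).
have J2 := int_cst (- (s0 * (2 * (M * (cP * Z))))).
rewrite ler_norml; apply/andP; split.
  apply: (@le_trans _ _ (J s0 (fun _ => - (s0 * (2 * (M * (cP * Z))))))).
    by rewrite J2; lra.
  apply: le_int; [exact: (ucont_cst (V := R^o))|exact: ucont_delayed|].
  by move=> s s_ge0 ss0; have := fle s s_ge0 ss0; rewrite ler_norml => /andP[].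
apply: (@le_trans _ _ (J s0 (fun _ => s0 * (2 * (M * (cP * Z)))))).
  apply: le_int; [exact: ucont_delayed|exact: (ucont_cst (V := R^o))|].
  by move=> s s_ge0 ss0; have := fle s s_ge0 ss0; rewrite ler_norml => /andP[].
by rewrite J1; lra.
Qed.

End DelayedPairing.

(** * Integrability and decay of the energy *)

Section EnergyDecay.
Context {R : realType} {H : completeNormedModType R} (ip : {dot H for idfun}).
Hypothesis hip : norm_of_inner ip.
Variables (D : set H) (L : H -> H) (u v : R -> H) (m : R) (N : R -> R)
  (Q : R -> H -> R) (B : R -> R) (dlt cT cN : R).
Hypothesis dyn : dynamics ip D L u v m N Q B dlt cT cN.
Hypothesis dlt0 : 0 < dlt.
Variable Binf : R.
Hypothesis B_le : forall t : R, 0 <= t -> B t <= Binf.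
Local Notation z t := (L (u t)).
Local Notation P := (elastic_energy L u m N).
Local Notation E := (energy_of L u v m N).
Local Notation leb := (@lebesgue_measure R).
Variables (cP s0 cH : R).
Hypotheses (cP0 : 0 <= cP) (s00 : 0 < s0) (cH0 : 0 <= cH) (cN0 : 0 <= cN).
Hypothesis poincare : forall x, D x -> `|x| <= cP * `|L x|.
Hypothesis history : forall t : R, s0 <= t ->
  \int[leb]_(s in `[0, s0]) (`|z t - z (Num.max 0 (t - s))| ^+ 2) <= cH * N t.

(** The total coefficient of N in the derivative of the combined functional: from the delayed
    pairing, from the coercivity of the force, and from N as a part of E. *)
Definition memory_cost := 8 / s0 ^+ 2 * ((cP ^+ 2 / s0 + 4 * s0) * cH) + cN + 1.

                                                                               
                                                                   
(** The factor 8 / s0^2 turns the kinetic gain of the delayed pairing into 2 |v|^2, which dominates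
    the |v|^2 lost in the pairing of v with u, at the price of E/2. The pairing with u yields the
    elastic energy. The derivative is then at most E - |v|^2 - Q(z) plus memory terms paid by
    [memory_cost], hence nonpositive. The 9 collects feedback errors: 8 from the delayed pairing and
    1 from the other. *)
Definition lyapunov (M Z : R) (EE NN : R -> R) (t : R) :=
  EE t / 2 - 8 / s0 ^+ 2 * delayed_pairing ip u v s0 t + ip (v t) (u t)
  - memory_cost * NN t - 9 * (M * (cP * Z)) * B t.

Lemma memory_cost_ge0 : 0 <= memory_cost.
Proof.
have s20 : 0 < 8 / s0 ^+ 2 by rewrite divr_gt0// exprn_gt0.
have s_ge0 := ltW s00.
have p0 : 0 <= cP ^+ 2 / s0 + 4 * s0.
  by apply: addr_ge0; [apply: divr_ge0 => //; exact: sqr_ge0|apply: mulr_ge0].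
rewrite addr_ge0// addr_ge0//; apply: mulr_ge0; first exact: ltW.
exact: mulr_ge0.
Qed.

Lemma multiplier_increment (M Z eta r t : R) (EE NN : R -> R) :
  0 < eta -> s0 < r -> r <= t -> 0 <= M -> 0 <= Z ->
  `|EE t - EE r - (t - r) * E r| <= eta * (t - r) ->
  `|NN t - NN r - (t - r) * N r| <= eta * (t - r) ->
  `|ip (v t) (u t) - ip (v r) (u r) - (t - r) * (`|v r| ^+ 2 - Q r (z r))| <=
    (t - r) * (eta * (Z + 2 * M)) + M * (cP * Z) * (B t - B r) ->
  (forall s : R, 0 <= s -> s < r ->
    `|ip (v t) (u t - u (t - s)) - ip (v r) (u r - u (r - s)) -
      (t - r) * (ip (v r) (v r - v (r - s)) - Q r (z r - z (r - s)))| <=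
    (t - r) * (eta * (2 * Z + 3 * M)) + 2 * (M * (cP * Z)) * (B t - B r)) ->
  lyapunov M Z EE NN t - lyapunov M Z EE NN r <=
    (t - r) * (eta * (1 + 14 * M + 9 * Z + memory_cost)).
Proof.
move=> eta0 s0r rt M0 Z0 hE hN hphi hpsi.
have r0 : 0 < r by exact: lt_trans s0r.
have tr0 : 0 <= t - r by rewrite subr_ge0.
have := delayed_pairing_increment hip dyn cP0 s00 poincare history s0r rt
   (fun s s_ge0 ss0 => hpsi s s_ge0 (le_lt_trans ss0 s0r)).
move=> {hpsi} hG.
have s20 : 0 < 8 / s0 ^+ 2 by rewrite divr_gt0// exprn_gt0.
have {hG} := ler_wpM2l (ltW s20) hG.
have -> : 8 / s0 ^+ 2 * ((t - r) * (s0 ^+ 2 / 4 * `|v r| ^+ 2 - s0 ^+ 2 / 16 * E r -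
     (cP ^+ 2 / s0 + 4 * s0) * cH * N r) - s0 ^+ 2 / 2 *
     ((t - r) * (eta * (2 * Z + 3 * M)) + 2 * (M * (cP * Z)) * (B t - B r))) =
   (t - r) * (2 * `|v r| ^+ 2 - E r / 2 - (memory_cost - cN - 1) * N r) -
     4 * ((t - r) * (eta * (2 * Z + 3 * M)) + 2 * (M * (cP * Z)) * (B t - B r)).
  by rewrite /memory_cost; field; rewrite gt_eqF.
have c0 := memory_cost_ge0.
have hq := ler_wpM2l tr0 (dyn_Q_coercive dyn (ltW r0)).
have hEe : E r = 2^-1 * `|v r| ^+ 2 + ((1 - m) / 2 * `|z r| ^+ 2 + N r) by [].
have v2 : 0 <= (t - r) * `|v r| ^+ 2 by rewrite mulr_ge0// sqr_ge0.
have N0 : 0 <= N r := dyn_N_ge0 dyn (ltW r0).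
move/ler_distlP: hE => [hE _]; move/ler_distlP: hN => [_ hN]; move/ler_distlP: hphi => [hphi _].
have hN' := ler_wpM2l c0 hN.
rewrite /lyapunov.
have e1 : 0 <= (t - r) * eta by rewrite mulr_ge0// ltW.
move: hEe hq v2 N0 hE hN' hphi e1; move: memory_cost c0 => c c0.
move: (8 / s0 ^+ 2) (M * (cP * Z)) (ip (v t) _) (ip (v r) _) (B t) (B r) => k1 k2 k3 k4 k5 k6.
move: (`|v r| ^+ 2) ((1 - m) / 2 * `|z r| ^+ 2) (N r) (E r) (Q r _) => l1 l2 l3 l4 l5.
move: (delayed_pairing _ _ _ _ _) (delayed_pairing _ _ _ _ _) (EE t) (EE r) (NN t) (NN r) => p1 p2 p3 p4 p5 p6.
move=> ->.
lra.
Qed.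

(** The functional [lyapunov] is nonincreasing beyond 1 + s0, and each of its terms other than
    [EE t / 2] has bounded increments there. *)
Lemma energy_integral_bounded (EE : R -> R) : primitive E EE ->
  exists K : R, forall T : R, 1 + s0 <= T -> EE T - EE (1 + s0) <= K.
Proof.
move=> pE; have [K K0 HK] := energy_bounded hip dyn dlt0 B_le.
have [NN pN] := ucont_primitive (dyn_ucont_N dyn).
have [KN KN0 HKN] := memory_integral_bounded hip dyn dlt0 B_le pN.
have m1 : 0 < 1 - m by rewrite subr_gt0 (dyn_mass dyn).
pose M := Num.sqrt (2 * K); pose Z := Num.sqrt (2 * K / (1 - m)).
have vM (t : R) : 0 <= t -> `|v t| <= M.
  by move=> t0; apply: (v_le_E dyn t0); exact: HK.
have zZ (t : R) : 0 <= t -> `|z t| <= Z.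
  move=> t0; rewrite -[leLHS]ger0_norm// -sqrtr_sqr ler_wsqrtr// ler_pdivlMr//.
  have := HK t t0; have := dyn_N_ge0 dyn t0; have := sqr_ge0 `|v t|.
  rewrite /energy_of /elastic_energy; move: (`|v t| ^+ 2) (`|z t| ^+ 2) (N t) => a1 a2 a3.
  lra.
have [M0 Z0] := bounds_ge0 vM zZ.
have s1 := s00; have c0 := memory_cost_ge0.
have MZ0 : 0 <= M * (cP * Z) by rewrite !mulr_ge0.
have dec (T : R) : 1 + s0 <= T -> lyapunov M Z EE NN T <= lyapunov M Z EE NN (1 + s0).
  move=> sT; apply: le_of_small_increments => // e e0.
  pose C := 1 + 14 * M + 9 * Z + memory_cost.
  have C0 : 0 < C by rewrite /C; lra.
  have eta0 : 0 < e / C by rewrite divr_gt0.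
  have [d1 d10 H1] := pairing_local hip dyn cP0 poincare vM zZ T eta0.
  have [d2 d20 H2] := ucont_E hip dyn T eta0.
  have [d3 d30 H3] := dyn_ucont_N dyn T eta0.
  exists (Num.min d1 (Num.min d2 d3)); first by rewrite !lt_min d10 d20.
  move=> r t r1 rt tT; rewrite !lt_min => /andP[rt1 /andP[rt2 rt3]].
  have r0 : 0 < r by lra.
  have s0r : s0 < r by lra.
  have [h1 h2] := H1 r t r0 rt tT rt1.
  have := multiplier_increment eta0 s0r rt M0 Z0 (primitive_increment_modulus pE H2 (ltW r0) rt tT rt2)
    (primitive_increment_modulus pN H3 (ltW r0) rt tT rt3) h1 h2.
  by rewrite -/C divfK ?gt_eqF// mulrC.
have s1_ge0 : 0 <= 1 + s0 by lra.
exists (2 * (2 * (8 / s0 ^+ 2 * (2 * s0 ^+ 2 * (M * (cP * Z)))) + 2 * (M * (cP * Z)) +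
  memory_cost * KN + 9 * (M * (cP * Z)) * (Binf - B (1 + s0)))).
move=> T sT; have T0 : 0 <= T by lra.
have s20 : 0 <= 8 / s0 ^+ 2 by rewrite divr_ge0// exprn_ge0// ltW.
have phi (t : R) : 0 <= t -> `|ip (v t) (u t)| <= M * (cP * Z).
  move=> t0; apply: le_trans (ip_cauchy_schwarz hip _ _) _.
  apply: ler_pM => //; first exact: vM.
  apply: le_trans (poincare (dyn_domain dyn t0)) _.
  by rewrite ler_wpM2l// zZ.
have G (t : R) : s0 <= t -> `|8 / s0 ^+ 2 * delayed_pairing ip u v s0 t| <=
    8 / s0 ^+ 2 * (2 * s0 ^+ 2 * (M * (cP * Z))).
  move=> st; rewrite normrM (ger0_norm s20) ler_wpM2l//.
  exact: (delayed_pairing_bounded hip dyn cP0 s00 poincare vM zZ st).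
have hN := ler_wpM2l c0 (HKN (1 + s0) T ltac:(lra) sT).
have hB : 9 * (M * (cP * Z)) * (B T - B (1 + s0)) <= 9 * (M * (cP * Z)) * (Binf - B (1 + s0)).
  by rewrite ler_wpM2l ?mulr_ge0// lerD2r B_le.
have := dec T sT; rewrite /lyapunov.
move: (phi T T0) (phi _ s1_ge0) (G T ltac:(lra)) (G (1 + s0) ltac:(lra)).
rewrite !ler_norml => /andP[a1 a2] /andP[a3 a4] /andP[a5 a6] /andP[a7 a8].
move: hN hB a1 a2 a3 a4 a5 a6 a7 a8.
move: (8 / s0 ^+ 2 * delayed_pairing _ _ _ _ T) (8 / s0 ^+ 2 * delayed_pairing _ _ _ _ (1 + s0))
  (ip (v T) _) (ip (v (1 + s0)) _) (EE T) (EE (1 + s0)) (NN T) (NN (1 + s0))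
  (B T) (B (1 + s0)) memory_cost => x1 x2 x3 x4 x5 x6 x7 x8 x9 x10 x11.
move: (8 / s0 ^+ 2 * (2 * s0 ^+ 2 * (M * (cP * Z)))) (M * (cP * Z)) => x13 x12.
lra.
Qed.

(** A finite integral forces the energy below e/2 at some time past the point where feedback growth
    is limited to e/2; from then on it stays below e. *)
Lemma energy_vanishes (e : R) : 0 < e -> exists S : R, forall t : R, S <= t -> 0 <= E t <= e.
Proof.
move=> e0; have [K K0 HK] := energy_bounded hip dyn dlt0 B_le.
have K2 : 0 < 2 * K by rewrite mulr_gt0.
have eK : 0 < e / 2 / (2 * K) by rewrite !divr_gt0.
have [S S0 HS] := homo_bounded_tail (dyn_B_homo dyn) B_le eK.
have [EE pE] := ucont_primitive (ucont_E hip dyn).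
have [KE HKE] := energy_integral_bounded pE.
have s1 := s00.
pose S1 := Num.max S (1 + s0).
have S1S : S <= S1 by rewrite /S1 le_max lexx.
have S1s : 1 + s0 <= S1 by rewrite /S1 le_max lexx orbT.
have [t0 [St0 Et0]] : exists t0 : R, S1 <= t0 /\ E t0 <= e / 2.
  apply: contrapT => hno.
  have big (t : R) : S1 <= t -> e / 2 <= E t.
    move=> S1t; rewrite leNgt; apply/negP => Ete; apply: hno.
    by exists t; split => //; exact: ltW.
  (* An interval long enough that E >= e/2 on it would push the integral past its bound [KE]. *)
  pose w := (`|KE| + `|EE S1 - EE (1 + s0)| + 1) / (e / 2).
  have w0 : 0 < w by rewrite !divr_gt0// ltr_wpDl// addr_ge0.
  have [x /andP[x1 x2]] := pE S1 (S1 + w) ltac:(lra) ltac:(lra).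
  have -> : S1 + w - S1 = w by ring.
  move=> hx; have := ler_wpM2r (ltW w0) (big x x1).
  have -> : e / 2 * w = `|KE| + `|EE S1 - EE (1 + s0)| + 1.
    by rewrite mulrC divfK// gt_eqF// divr_gt0.
  rewrite -hx; have := HKE (S1 + w) ltac:(lra).
  have := ler_norm KE; have := ler_norm (- (EE S1 - EE (1 + s0))); rewrite normrN.
  move: (EE _) (EE _) (EE _) => y1 y2 y3; lra.
exists t0 => t t0t.
have t00 : 0 < t0 by lra.
have tge0 : 0 <= t by lra.
rewrite (E_ge0 dyn tge0)/=.
have h1 := energy_growth hip dyn dlt0 t00 t0t (fun r r0 _ => HK r r0).
have h2 := HS t0 t ltac:(lra) t0t.
have h3 : 2 * K * (B t - B t0) <= e / 2.
  have -> : e / 2 = 2 * K * (e / 2 / (2 * K)) by field; rewrite gt_eqF.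
  by rewrite ler_wpM2l// ltW.
lra.
Qed.

End EnergyDecay.

                                        

(** * Translation of integrals, Bochner measurability, and the weighted space *)

Section Shift.
Context {R : realType}.
Local Notation leb := (@lebesgue_measure R).

Lemma lebesgue_measure_shift (h : R) (A : set R) : measurable A ->
  leb A = leb ((fun x => x + h) @^-1` A).
Proof.
move=> mA.
have ms : measurable_fun [set: measurableTypeR R]
  (fun x : measurableTypeR R => x + h : measurableTypeR R) by exact: measurable_funD.
apply: (@lebesgue_measure_unique R (pushforward leb
  (fun x : measurableTypeR R => x + h : measurableTypeR R))) => //.
move=> X /ocitvP[->|[[a b] /= ab ->]]; first by rewrite !measure0.
rewrite /pushforward.
have -> : (fun x => x + h) @^-1` `]a, b] = `]a - h, b - h]%classic :> set R.
  by apply/seteqP; split => x /=; rewrite !in_itv/= => /andP[]; rewrite ltrBlDr lerBrDr => -> ->.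
by rewrite !lebesgue_measure_itv/= !lte_fin ltrD2r ab -!EFinB opprB addrA addrNK.
Qed.

Lemma integral_shift (f : R -> R) (h : R) : 0 <= h ->
  leb.-integrable `]0, +oo[ (EFin \o f) ->
  leb.-integrable `]0, +oo[ (fun s => (f (s + h))%:E) /\
  \int[leb]_(s in `]0, +oo[) f s =
    \int[leb]_(s in `]0, h]) f s + \int[leb]_(s in `]0, +oo[) f (s + h).
Proof.
move=> h0 intf.
have ms : measurable_fun [set: measurableTypeR R]
  (fun x : measurableTypeR R => x + h : measurableTypeR R) by exact: measurable_funD.
have pre : (fun x => x + h) @^-1` `]h, +oo[ = `]0, +oo[%classic :> set R.
  by apply/seteqP; split => x /=; rewrite !in_itv/= !andbT ltrDr.
have sub : (`]h, +oo[%classic : set R) `<=` `]0, +oo[.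
  by move=> x /=; rewrite !in_itv/= !andbT; exact: le_lt_trans.
have inth : leb.-integrable `]h, +oo[ (EFin \o f) by exact: integrableS intf.
have mf : measurable_fun `]h, +oo[ f.
  by have /integrableP[/measurable_EFinP] := inth.
have mfh : measurable_fun (`]0, +oo[%classic : set (measurableTypeR R)) (fun s : R => f (s + h)).
  rewrite -pre; apply: (measurable_comp _ _ mf) => //; last exact: measurable_funTS.
  by move=> _ [x xh <-].
have meas_eq (A : set R) : measurable A -> A `<=` `]h, +oo[ ->
    leb A = pushforward leb (fun x : measurableTypeR R => x + h : measurableTypeR R) A.
  by move=> mA _; exact: lebesgue_measure_shift.
have intfh : leb.-integrable `]0, +oo[ (fun s => (f (s + h))%:E).
  apply/integrableP; split; first exact/measurable_EFinP.
  suff <- : (\int[leb]_(s in `]h, +oo[) `|(EFin \o f) s| =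
      \int[leb]_(s in (`]0%R, +oo[%classic : set R)) `|(f (s + h)%R)%:E|)%E by have /integrableP[] := inth.
  rewrite (@eq_measure_integral _ _ _ _ (pushforward leb
    (fun x : measurableTypeR R => x + h : measurableTypeR R)) leb _ _)//.
  rewrite ge0_integral_pushforward//; first by rewrite pre.
  exact/measurableT_comp/measurable_EFinP.
split => //.
have -> : \int[leb]_(s in `]0, +oo[) f (s + h) = \int[leb]_(s in `]h, +oo[) f s.
  pose F := f \_ `]h, +oo[.
  have mF : measurable_fun setT (EFin \o F).
    by apply/measurable_EFinP/(measurable_restrictT _ _).1.
  have FE s : s \in (`]0, +oo[%classic : set R) -> F (s + h) = f (s + h).
    rewrite inE/= in_itv/= andbT => s0; rewrite /F patchE mem_set//=.
    by rewrite in_itv/= andbT ltrDr.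
  rewrite /Rintegral; congr fine.
  transitivity (\int[leb]_(s in `]h, +oo[) (EFin \o F) s)%E; last first.
    by apply: eq_integral => s sh /=; rewrite /F patchE sh.
  have -> : (\int[leb]_(s in `]h, +oo[) (EFin \o F) s =
    \int[pushforward leb (fun x : measurableTypeR R => (x + h)%R : measurableTypeR R)]_(s in `]h, +oo[)
      (EFin \o F) s)%E by exact: eq_measure_integral.
  rewrite [RHS]integral_pushforward//; last first.
    rewrite pre; apply: eq_integrable intfh => //.
    by move=> s s0 /=; rewrite FE.
  by rewrite pre; apply: eq_integral => s s0 /=; rewrite FE.
by rewrite -(@Rintegral_itvB _ f (BRight 0) +oo%O h)// ?bnd_simp// addrC subrK.
Qed.

End Shift.

Section StronglyMeasurable.
Context {R : realType} {H : completeNormedModType R}.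

(** Two simple functions take finitely many pairs of values, so the preimage is a finite union of
    measurable sets whatever [psi] and [Y] are. *)
Lemma measurable_preimage_fimfun2 {T : Type} (psi : H -> H -> T) (g1 g2 : {fimfun R >-> H}) (Y : set T) :
  (forall y, measurable (g1 @^-1` [set y])) -> (forall y, measurable (g2 @^-1` [set y])) ->
  measurable ((fun s => psi (g1 s) (g2 s)) @^-1` Y).
Proof.
move=> m1 m2.
have -> : (fun s => psi (g1 s) (g2 s)) @^-1` Y =
    \bigcup_(x in range g1) \bigcup_(y in range g2 `&` [set y | Y (psi x y)])
      (g1 @^-1` [set x] `&` g2 @^-1` [set y]).
  apply/seteqP; split => [s /= Ys|s [x _ [y [_ /= Yxy] [/= fx gy]]]].
    by exists (g1 s); [exists s|exists (g2 s); [split; [exists s|]|split]].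
  by rewrite fx gy.
apply: fin_bigcup_measurable; first exact: fimfunP.
move=> x _; apply: fin_bigcup_measurable; first exact/finite_setIl/fimfunP.
by move=> y _; exact: measurableI.
Qed.

Lemma strongly_measurable_ip (ip : {dot H for idfun}) (D : set R) (f g : R -> H) :
  norm_of_inner ip -> measurable D -> strongly_measurable D f -> strongly_measurable D g ->
  measurable_fun D (fun s => ip (f s) (g s)).
Proof.
move=> hip mD [fn mfn fnf] [gn mgn gng].
apply: (@measurable_fun_cvg _ _ _ D (fun n s => ip (fn n s) (gn n s))).
  move=> n _ Y mY; apply: measurableI => //.
  exact: measurable_preimage_fimfun2.
by move=> s Ds; apply: (cvg_ip hip); [exact: fnf|exact: gng].
Qed.

Lemma strongly_measurable_cst (D : set R) (y : H) : strongly_measurable D (fun=> y).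
Proof.
exists (fun _ => cst_fimfun y) => [n x|s _]; last exact: cvg_cst.
rewrite /= preimage_cst; case: ifPn => _; [exact: measurableT|exact: measurable0].
Qed.

Lemma strongly_measurableB (D : set R) (f g : R -> H) :
  strongly_measurable D f -> strongly_measurable D g ->
  strongly_measurable D (fun s => f s - g s).
Proof.
move=> [fn mfn fnf] [gn mgn gng].
exists (fun n => (fn n \- gn n : {fimfun R >-> H})) => [n y|s Ds].
  exact: (@measurable_preimage_fimfun2 _ (fun a b => a - b)).
by apply: cvgB; [exact: fnf|exact: gng].
Qed.

Lemma strongly_measurableZ (D : set R) (a : R) (f : R -> H) :
  strongly_measurable D f -> strongly_measurable D (fun s => a *: f s).
Proof.
move=> [fn mfn fnf].
exists (fun n => ( *:%R a \o fn n : {fimfun R >-> H})) => [n y|s Ds].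
  exact: (@measurable_preimage_fimfun2 _ (fun x _ => a *: x) (fn n) (fn n)).
by apply: cvgZr; exact: fnf.
Qed.

End StronglyMeasurable.

Section EFinIntegrable.
Context {R : realType}.
Local Notation leb := (@lebesgue_measure R).

Lemma integrable_addr (D : set (measurableTypeR R)) (f g : R -> R) : measurable D ->
  leb.-integrable D (EFin \o f) -> leb.-integrable D (EFin \o g) ->
  leb.-integrable D (EFin \o (fun s => f s + g s)).
Proof. by move=> mD If Ig; apply: eq_integrable (integrableD mD If Ig). Qed.

Lemma integrable_mull (D : set (measurableTypeR R)) (k : R) (f : R -> R) : measurable D ->
  leb.-integrable D (EFin \o f) -> leb.-integrable D (EFin \o (fun s => k * f s)).
Proof. by move=> mD If; apply: eq_integrable (integrableZl mD k If). Qed.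

End EFinIntegrable.

Section WeightedL2.
Context {R : realType} {H : completeNormedModType R} (ip : {dot H for idfun}).
Hypothesis hip : norm_of_inner ip.
Local Notation leb := (@lebesgue_measure R).
Variable mu : R -> R.
Hypothesis mu_ge0 : forall t : R, 0 <= t -> 0 <= mu t.
Hypothesis mu_int : leb.-integrable `[0, +oo[ (EFin \o mu).

Definition Lsq (f : R -> H) := strongly_measurable `]0, +oo[ f /\
  leb.-integrable `]0, +oo[ (fun s => (mu s * `|f s| ^+ 2)%:E).

Definition dotmu (f g : R -> H) := \int[leb]_(s in `]0, +oo[) (mu s * ip (f s) (g s)).

Lemma mu_int_oo : leb.-integrable `]0, +oo[ (EFin \o mu).
Proof. by apply: integrableS mu_int => // x; rewrite /= !in_itv/= !andbT => /ltW. Qed.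

Lemma mu_measurable : measurable_fun (`]0, +oo[%classic : set (measurableTypeR R)) mu.
Proof. by have /integrableP[/measurable_EFinP] := mu_int_oo. Qed.

Lemma dotmu_integrable f g : Lsq f -> Lsq g ->
  leb.-integrable `]0, +oo[ (fun s => (mu s * ip (f s) (g s))%:E).
Proof.
move=> [mf intf] [mg intg].
have intfg : leb.-integrable `]0, +oo[
  (fun s => (mu s * `|f s| ^+ 2)%:E + (mu s * `|g s| ^+ 2)%:E)%E by exact: integrableD.
apply: le_integrable intfg => //.
  apply/measurable_EFinP/measurable_funM; first exact: mu_measurable.
  exact: strongly_measurable_ip.
move=> s /=; rewrite in_itv/= andbT => s0.
have ms := mu_ge0 (ltW s0); rewrite lee_fin normrM (ger0_norm ms).
rewrite [leRHS]ger0_norm; last by rewrite addr_ge0// mulr_ge0// sqr_ge0.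
rewrite -mulrDr ler_wpM2l//; apply: le_trans (ip_cauchy_schwarz hip _ _) _.
rewrite -subr_ge0; move: `|f s| `|g s| => x y.
have -> : x ^+ 2 + y ^+ 2 - x * y = (x - y / 2) ^+ 2 + 3 / 4 * y ^+ 2 by field.
by rewrite addr_ge0 ?sqr_ge0// mulr_ge0 ?sqr_ge0// divr_ge0.
Qed.

Lemma dotmuC f g : dotmu f g = dotmu g f.
Proof. by apply: eq_Rintegral => s _; rewrite ipC. Qed.

Lemma dotmuBl f g k : Lsq f -> Lsq g -> Lsq k ->
  dotmu (fun s => f s - g s) k = dotmu f k - dotmu g k.
Proof.
move=> Lf Lg Lk; rewrite -RintegralB//; try exact: dotmu_integrable.
by apply: eq_Rintegral => s _; rewrite ipBl mulrBr.
Qed.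

Lemma dotmuBr f g k : Lsq f -> Lsq g -> Lsq k ->
  dotmu k (fun s => f s - g s) = dotmu k f - dotmu k g.
Proof. by move=> Lf Lg Lk; rewrite dotmuC dotmuBl// ![dotmu k _]dotmuC. Qed.

Lemma dotmuZr a f g : Lsq f -> Lsq g -> dotmu f (fun s => a *: g s) = a * dotmu f g.
Proof.
move=> Lf Lg; rewrite -RintegralZl//; last exact: dotmu_integrable.
by apply: eq_Rintegral => s _; rewrite ipZr mulrCA.
Qed.

Lemma dotmu_ge0 f : 0 <= dotmu f f.
Proof.
apply: Rintegral_ge0 => s; rewrite /= in_itv/= andbT => s0.
by rewrite mulr_ge0 ?(mu_ge0 (ltW s0))// -hip sqr_ge0.
Qed.

Lemma dotmu_sqnorm f : dotmu f f = \int[leb]_(s in `]0, +oo[) (mu s * `|f s| ^+ 2).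
Proof. by apply: eq_Rintegral => s _; rewrite hip. Qed.

Lemma massE : mass mu = \int[leb]_(s in `]0, +oo[) mu s.
Proof. by rewrite /mass -Rintegral_itv_obnd_cbnd//; exact: mu_int_oo. Qed.

Lemma mass_ge0 : 0 <= mass mu.
Proof. by apply: Rintegral_ge0 => s; rewrite /= in_itv/= andbT => s0; exact: mu_ge0. Qed.

Lemma Lsq_cst (y : H) : Lsq (fun=> y).
Proof.
split; first exact: strongly_measurable_cst.
have -> : (fun s => (mu s * `|y| ^+ 2)%:E) = (fun s => (`|y| ^+ 2)%:E * (mu s)%:E)%E.
  by apply/funext => s; rewrite -EFinM mulrC.
by apply: integrableZl => //; exact: mu_int_oo.
Qed.

Lemma dotmu_cst (x y : H) : dotmu (fun=> x) (fun=> y) = mass mu * ip x y.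
Proof. by rewrite massE -RintegralZr//; exact: mu_int_oo. Qed.

Lemma LsqB f g : Lsq f -> Lsq g -> Lsq (fun s => f s - g s).
Proof.
move=> Lf Lg; have [mf _] := Lf; have [mg _] := Lg.
split; first exact: strongly_measurableB.
have -> : (fun s => (mu s * `|f s - g s| ^+ 2)%:E) =
  (fun s => (mu s * ip (f s) (f s))%:E - 2%:E * (mu s * ip (f s) (g s))%:E +
            (mu s * ip (g s) (g s))%:E)%E.
  apply/funext => s; rewrite hip ipBl !ipBr -EFinM -EFinB -EFinD; congr (_%:E).
  by rewrite [ip (g s) (f s)]ipC; ring.
apply: integrableD => //; last exact: dotmu_integrable.
apply: integrableB => //; first exact: dotmu_integrable.
by apply: integrableZl => //; exact: dotmu_integrable.
Qed.

Lemma sqr_le_of_quadratic (a q c : R) : 0 <= c ->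
  (forall l : R, 0 <= a - 2 * l * q + l ^+ 2 * c) -> q ^+ 2 <= a * c.
Proof.
rewrite le_eqVlt => /predU1P[<- h|c0 h].
  have [->|q0] := eqVneq q 0; first by rewrite expr0n/= mulr0.
  have := h ((a + 1) / (2 * q)); rewrite mulr0 addr0.
  have -> : 2 * ((a + 1) / (2 * q)) * q = a + 1 by field.
  lra.
have := h (q / c).
have -> : a - 2 * (q / c) * q + (q / c) ^+ 2 * c = (a * c - q ^+ 2) / c by field; rewrite gt_eqF.
by rewrite ler_pdivlMr// mul0r subr_ge0.
Qed.

Lemma LsqZ a f : Lsq f -> Lsq (fun s => a *: f s).
Proof.
move=> [mf intf]; split; first exact: strongly_measurableZ.
have -> : (fun s => (mu s * `|a *: f s| ^+ 2)%:E) =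
    (fun s => (`|a| ^+ 2)%:E * (mu s * `|f s| ^+ 2)%:E)%E.
  by apply/funext => s; rewrite normrZ exprMn -EFinM mulrCA.
exact: integrableZl.
Qed.

Lemma dotmu_cauchy_schwarz f g : Lsq f -> Lsq g -> dotmu f g ^+ 2 <= dotmu f f * dotmu g g.
Proof.
move=> Lf Lg; apply: sqr_le_of_quadratic; first exact: dotmu_ge0.
move=> l; pose k s := l *: g s; have Lk : Lsq k by exact: LsqZ.
have := dotmu_ge0 (fun s => f s - k s).
rewrite dotmuBl//; last exact: LsqB.
rewrite !dotmuBr// [dotmu k f]dotmuC !dotmuZr// [dotmu k g]dotmuC dotmuZr//.
lra.
Qed.

                                                                        
(** Cauchy-Schwarz in the product of H and the weighted space, against the pair formed by y and the
    constant history y. That pair has squared norm (1 - m) |y|^2 + m |y|^2 = |y|^2. *)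
Lemma phase_cauchy_schwarz (x y : H) f : mass mu < 1 -> Lsq f ->
  ((1 - mass mu) * ip x y + dotmu f (fun=> y)) ^+ 2 <=
  ((1 - mass mu) * `|x| ^+ 2 + dotmu f f) * `|y| ^+ 2.
Proof.
move=> m1 Lf; apply: sqr_le_of_quadratic; first exact: sqr_ge0.
move=> l; pose k (_ : R) := l *: y.
have Lk : Lsq k by exact: Lsq_cst.
have Lfk := LsqB Lf Lk.
have h1 : 0 <= (1 - mass mu) * `|x - l *: y| ^+ 2.
  by rewrite mulr_ge0 ?sqr_ge0//; lra.
have h2 := dotmu_ge0 (fun s => f s - k s).
move: h1 h2; rewrite dotmuBl// !dotmuBr// [dotmu k f]dotmuC.
rewrite dotmuZr//; last exact: Lsq_cst.
rewrite dotmu_cst [`|_ - _| ^+ 2]hip ipBl !ipBr !ipZl !ipZr -!hip [ip y x]ipC.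
by lra.
Qed.

End WeightedL2.

                                       

(** * The inequality of Poincaré type and the memory kernel *)

Section Poincare.
Context {R : realType} {H : completeNormedModType R} (ip : {dot H for idfun}).
Hypothesis hip : norm_of_inner ip.

Lemma linear_operatorB (S : @operator R H) (x y : H) : linear_operator S ->
  dom S x -> dom S y -> dom S (x - y) /\ S (x - y) = S x - S y.
Proof.
move=> [_ Slin] Sx Sy; have [] := Slin (-1) y x Sy Sx.
by rewrite !scaleN1r !(addrC (- _)).
Qed.

Lemma self_adjoint_sym (S : @operator R H) x y : self_adjoint ip S ->
  dom S x -> dom S y -> ip (S x) y = ip x (S y).
Proof. by move=> [_ Ssa] Sx Sy; apply: (Ssa y (S y)).2. Qed.

(** A compact inverse K is bounded by some C. Then |x|^2 = <A K x, x> is the pairing of Ah K x with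
    Ah x, while |Ah K x|^2 = <K x, x> <= C |x|^2. *)
Lemma poincare_of_compact_inverse (A Ah : @operator R H) :
  positive_self_adjoint ip A -> compact_inverse A -> is_positive_sqrt ip Ah A ->
  exists2 c : R, 0 <= c & forall x, dom Ah x -> `|x| <= c * `|Ah x|.
Proof.
move=> [Alin _ _] [K [AK KA Kc]] [[_ Ahsa _] AAh AhE].
have [C C0 HC] : exists2 C : R, 0 < C & forall y, `|K y| <= C * `|y|.
  pose U : set H := [set y | `|y| <= 1].
  have Ubnd : bounded_set U.
    by exists 1; split; [exact: num_real|move=> M M1 y /= y1; apply: (le_trans y1); exact: ltW].
  have := Kc U Ubnd; rewrite precompactE => /compact_bounded[M [_ HM]].
  have Kscale a y : K (a *: y) = a *: K y.
    have [Ky AKy] := AK y; have [A0 _] := Alin.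
    have [DA AE] := Alin.2 a (K y) 0 Ky A0.
    rewrite addr0 in DA AE; rewrite -[RHS]KA//; congr K; rewrite AE AKy.
    have [_] := Alin.2 (-1) 0 0 A0 A0.
    by rewrite scaler0 addr0 scaleN1r addNr => ->; rewrite addr0.
  exists (`|M| + 1); first by rewrite ltr_wpDl.
  move=> y; have [->|y0] := eqVneq y 0.
    by rewrite -(scale0r 0) Kscale scale0r normr0 mulr_ge0// addr_ge0.
  have ny : 0 < `|y| by rewrite normr_gt0.
  have : `|K (`|y|^-1 *: y)| <= `|M| + 1.
    apply: HM; first by have := ler_norm M; lra.
    apply: subset_closure; exists (`|y|^-1 *: y) => //=.
    by rewrite /U/= normrZ normfV normr_id mulVf// gt_eqF.
  by rewrite Kscale normrZ normfV normr_id mulrC ler_pdivrMr.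
exists (Num.sqrt C); first exact: sqrtr_ge0.
move=> x xh; have [Kx AKx] := AK x.
have [Kxh AhKxh] := (AAh (K x)).1 Kx.
have h1 : `|x| ^+ 2 <= `|Ah x| * `|Ah (K x)|.
  rewrite hip -[X in ip X x]AKx AhE// (self_adjoint_sym Ahsa)// ipC.
  exact: ip_le.
have h2 : `|Ah (K x)| ^+ 2 <= C * `|x| ^+ 2.
  rewrite hip (self_adjoint_sym Ahsa)// -AhE// AKx.
  apply: le_trans (ip_le hip _ _) _.
  by rewrite expr2 mulrA ler_wpM2r.
have [->|x0] := eqVneq x 0; first by rewrite normr0 mulr_ge0 ?sqrtr_ge0.
have nx : 0 < `|x| by rewrite normr_gt0.
rewrite -(@ler_pXn2r _ 2)// ?nnegrE ?mulr_ge0 ?sqrtr_ge0//.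
rewrite exprMn sqr_sqrtr ?(ltW C0)//.
have x2 : 0 < `|x| ^+ 2 by rewrite exprn_gt0.
rewrite -(ler_pM2l x2); apply: (@le_trans _ _ ((`|Ah x| * `|Ah (K x)|) ^+ 2)).
  by rewrite -expr2 ler_pXn2r// nnegrE ?mulr_ge0// ltW.
rewrite exprMn; have := ler_wpM2l (sqr_ge0 `|Ah x|) h2; lra.
Qed.

End Poincare.

Section Kernel.
Context {R : realType}.
Local Notation leb := (@lebesgue_measure R).

Lemma derivative_ge0_cvg {V : normedModType R} (f f' : R -> V) (t : R) :
  derivative_ge0 f f' -> 0 <= t -> f s @[s --> within `[0, +oo[ (nbhs t)] --> f t.
Proof.
move=> Hf t0; apply/cvgrPdist_le => e e0.
have /cvgrPdist_le/(_ 1 ltr01) := Hf t t0.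
rewrite near_withinE => -[d /= d0 Hd].
have C0 : 0 < `|f' t| + 1 by rewrite ltr_wpDl.
have d'0 : 0 < Num.min d (e / (`|f' t| + 1)) by rewrite lt_min d0 divr_gt0.
rewrite near_withinE; exists (Num.min d (e / (`|f' t| + 1))) => //= s /=.
rewrite lt_min => /andP[sd se] s0.
have [->|st] := eqVneq s t; first by rewrite subrr normr0 ltW.
have st0 : s - t != 0 by rewrite subr_eq0.
have q1 : `|(s - t)^-1 *: (f s - f t)| <= `|f' t| + 1.
  have := Hd s sd st s0; set q := (X in f' t - X) => h.
  have := ler_normB (f' t) (f' t - q); rewrite subKr.
  by move=> h1; apply: le_trans h1 _; rewrite lerD2l.
have -> : f t - f s = - ((s - t) *: ((s - t)^-1 *: (f s - f t))).
  by rewrite scalerA divff// scale1r opprB.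
rewrite normrN normrZ; apply: le_trans (_ : `|s - t| * (`|f' t| + 1) <= _).
  by rewrite ler_wpM2l.
by rewrite -ler_pdivlMr// distrC ltW.
Qed.

Variable mu : R -> R.
Hypothesis hmu : admissible_kernel mu.

Lemma kernel_ge0 (t : R) : 0 <= t -> 0 <= mu t.
Proof. by case: hmu => + _ _ _ _; exact. Qed.

Lemma kernel_integrable : leb.-integrable `[0, +oo[ (EFin \o mu).
Proof. by case: hmu. Qed.

Lemma kernel_MVT : exists2 delta : R, 0 < delta &
  forall s t : R, 0 <= s -> s < t ->
    exists2 c : R, s < c < t & mu t - mu s <= - delta * mu c * (t - s).
Proof.
case: hmu => mu0 _ _ _ [dmu [Hd _ [delta delta0 Hdelta]]].
exists delta => // s t s0 st.
have cmu : {within `[s, t], continuous mu}.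
  apply/subspace_continuousP => x; rewrite /= in_itv/= => /andP[sx xt].
  have x0 : 0 <= x := le_trans s0 sx.
  apply: cvg_trans (derivative_ge0_cvg Hd x0); apply: cvg_app.
  by apply: within_subset => y; rewrite /= !in_itv/= andbT => /andP[sy _]; exact: le_trans sy.
have [|c cst ->] := MVT st _ cmu (df := dmu).
  move=> x; rewrite in_itv/= => /andP[sx _].
  by apply: (derivative_ge0_is_derive (V := R^o) Hd); exact: le_lt_trans sx.
move: cst; rewrite in_itv/= => cst; exists c => //.
rewrite ler_wpM2r//; first by rewrite subr_ge0 ltW.
by apply: Hdelta; case/andP: cst => sc _; apply: le_trans (ltW sc).
Qed.

Lemma kernel_homo (s t : R) : 0 <= s -> s <= t -> mu t <= mu s.
Proof.
move=> s0; rewrite le_eqVlt => /predU1P[->//|st].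
have [delta delta0 /(_ s t s0 st)[c /andP[sc _]]] := kernel_MVT.
have c0 : 0 <= mu c by apply: kernel_ge0; lra.
have : 0 <= delta * mu c * (t - s).
  by apply: mulr_ge0; [apply: mulr_ge0 => //; exact: ltW|rewrite subr_ge0 ltW].
lra.
Qed.

(** The differential inequality for the kernel in difference form: mean value theorem, then
    monotonicity to replace the intermediate point by s + h. *)
Lemma kernel_decay : exists2 delta : R, 0 < delta &
  forall s h : R, 0 <= s -> 0 < h -> mu (s + h) * (1 + delta * h) <= mu s.
Proof.
have [delta delta0 Hd] := kernel_MVT; exists delta => // s h s0 h0.
have sh : s < s + h by lra.
have [c /andP[sc csh]] := Hd s (s + h) s0 sh.
have -> : s + h - s = h by ring.
have hc : mu (s + h) <= mu c by apply: kernel_homo; lra.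
have : delta * h * mu (s + h) <= delta * h * mu c by rewrite ler_wpM2l//; apply: mulr_ge0; exact: ltW.
lra.
Qed.

Lemma kernel_lower : exists2 s0 : R, 0 < s0 & forall s : R, 0 <= s -> s <= s0 -> mu 0 / 2 <= mu s.
Proof.
have mu0 : 0 < mu 0 by case: hmu.
case: hmu => _ _ _ _ [dmu [Hd _ _]].
have e0 : 0 < mu 0 / 2 by lra.
have /cvgrPdist_le/(_ _ e0) := derivative_ge0_cvg Hd (lexx 0).
rewrite near_withinE => -[d /= d0 Hdd].
exists (d / 2); first by rewrite divr_gt0.
move=> s s_ge0 sd; have := Hdd s.
rewrite /ball_/= sub0r normrN ger0_norm// in_itv/= andbT.
move=> /(_ ltac:(lra) s_ge0); rewrite ler_norml => /andP[_]; lra.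
Qed.

End Kernel.

(** * Regularity and force estimates for solutions *)

Section SolutionDynamics.
Context {R : realType} {H : completeNormedModType R} (ip : {dot H for idfun}).
Hypothesis hip : norm_of_inner ip.
Variables (Ah : @operator R H) (mu : R -> R).
Hypothesis Ahlin : linear_operator Ah.
Hypothesis hmu : admissible_kernel mu.
Local Notation leb := (@lebesgue_measure R).
Variables (u v : R -> H).
Hypothesis huv : derivative_ge0 u v.
Hypothesis hphase : phase_continuous Ah mu u v.
Local Notation z t := (Ah (u t)).
Local Notation m := (mass mu).
Let zeta (t s : R) : H := Ah (past u t s).
Local Notation "'dotm'" := (dotmu ip mu).

Let mu_ge0 := kernel_ge0 hmu.
Let mu_int := kernel_integrable hmu.

Lemma mass_lt1 : m < 1. Proof. by case: hmu. Qed.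

Lemma dom_u (t : R) : 0 <= t -> dom Ah (u t).
Proof. by move=> t0; have [[]] := hphase t0. Qed.

Lemma dom_past (t s : R) : 0 <= t -> 0 < s -> dom Ah (past u t s).
Proof. by move=> t0 s0; have [[_ [+ _ _]] _] := hphase t0; apply. Qed.

Lemma Lsq_zeta (t : R) : 0 <= t -> Lsq mu (zeta t).
Proof. by move=> t0; have [[_ [_ ? ?]] _] := hphase t0; split. Qed.

Definition memory_energy (t : R) := 2^-1 * \int[leb]_(s in `]0, +oo[) (mu s * `|Ah (past u t s)| ^+ 2).

(** With u(t - s) = u(t) - eta(s), the operator terms of the equation become (1 - m) A u plus the
    weighted integral of A eta; paired with x they give this value at y = Ah x. *)
Definition elastic_force (t : R) (y : H) := (1 - m) * ip (z t) y + dotm (zeta t) (fun=> y).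

Lemma memory_energyE t : memory_energy t = 2^-1 * dotm (zeta t) (zeta t).
Proof. by rewrite (dotmu_sqnorm hip). Qed.

(** The squared phase distance of two states. The operator is applied before subtracting, so
    symmetry and the weak triangle inequality do not involve its linearity. *)
Let dist2 (s t : R) := (1 - m) * `|z s - z t| ^+ 2 + `|v s - v t| ^+ 2 +
  dotm (fun r => zeta s r - zeta t r) (fun r => zeta s r - zeta t r).

Lemma dist2_ge (s t : R) : [/\ (1 - m) * `|z s - z t| ^+ 2 <= dist2 s t,
  `|v s - v t| ^+ 2 <= dist2 s t &
  dotm (fun r => zeta s r - zeta t r) (fun r => zeta s r - zeta t r) <= dist2 s t].
Proof.
have h1 : 0 <= (1 - m) * `|z s - z t| ^+ 2.
  by rewrite mulr_ge0 ?sqr_ge0// subr_ge0 ltW// mass_lt1.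
have h2 : 0 <= `|v s - v t| ^+ 2 := sqr_ge0 _.
have h3 := dotmu_ge0 hip mu_ge0 (fun r => zeta s r - zeta t r).
by rewrite /dist2; split; move: h1 h2 h3; lra.
Qed.

Lemma dist2C s t : dist2 s t = dist2 t s.
Proof.
rewrite /dist2 distrC [`|v s - v t|]distrC; congr (_ + _).
by apply: eq_Rintegral => r _; rewrite -!hip distrC.
Qed.

Lemma sqnorm_tri (a b c : H) : `|a - c| ^+ 2 <= 2 * (`|a - b| ^+ 2 + `|b - c| ^+ 2).
Proof.
have := sqr_ge0 `|(a - b) - (b - c)|; rewrite !hip !ipBl !ipBr ?ipBl ?ipBr.
by rewrite [ip b a]ipC [ip c a]ipC [ip c b]ipC; lra.
Qed.

Lemma dotmu_tri (f g k : R -> H) : Lsq mu f -> Lsq mu g -> Lsq mu k ->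
  dotm (fun r => f r - k r) (fun r => f r - k r) <=
  2 * (dotm (fun r => f r - g r) (fun r => f r - g r) + dotm (fun r => g r - k r) (fun r => g r - k r)).
Proof.
move=> Lf Lg Lk.
have Lfg := LsqB hip mu_ge0 mu_int Lf Lg; have Lgk := LsqB hip mu_ge0 mu_int Lg Lk.
have Lfk := LsqB hip mu_ge0 mu_int Lf Lk.
have I := dotmu_integrable hip mu_ge0 mu_int.
rewrite -RintegralD//; try exact: I.
rewrite -RintegralZl//; last by apply: integrable_addr => //; exact: I.
apply: le_Rintegral => //; first exact: I.
  by apply: integrable_mull => //; apply: integrable_addr => //; exact: I.
move=> s; rewrite /= in_itv/= andbT => s0.
have := ler_wpM2l (mu_ge0 (ltW s0)) (sqnorm_tri (f s) (g s) (k s)).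
by rewrite !hip; lra.
Qed.

Lemma dist2_tri (s r t : R) : 0 <= s -> 0 <= r -> 0 <= t ->
  dist2 s t <= 2 * (dist2 s r + dist2 r t).
Proof.
move=> s0 r0 t0.
have h3 := dotmu_tri (Lsq_zeta s0) (Lsq_zeta r0) (Lsq_zeta t0).
have h2 := sqnorm_tri (v s) (v r) (v t).
have m1 : 0 <= 1 - m by rewrite subr_ge0 ltW// mass_lt1.
have h1 := ler_wpM2l m1 (sqnorm_tri (z s) (z r) (z t)).
by rewrite /dist2; move: h1 h2 h3; lra.
Qed.

Lemma dist2_cvg (t : R) : 0 <= t -> dist2 s t @[s --> within `[0, +oo[ (nbhs t)] --> 0.
Proof.
move=> t0; have [_ ht] := hphase t0.
apply/cvgrPdist_le => e e0.
move/cvgrPdist_le : ht => /(_ e e0); rewrite !near_withinE.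
apply: filterS => s + s0 => /(_ s0).
suff -> : dist2 s t = phase_sqnorm Ah mu (u s - u t) (v s - v t) (past u s \- past u t) by [].
have s0' : 0 <= s by move: s0; rewrite /= in_itv/= andbT.
rewrite /dist2 /phase_sqnorm (dotmu_sqnorm hip).
have [_ ->] := linear_operatorB Ahlin (dom_u s0') (dom_u t0).
congr (_ + _); apply: eq_Rintegral => r; rewrite inE/= in_itv/= andbT => r0.
by have [_ ->] := linear_operatorB Ahlin (dom_past s0' r0) (dom_past t0 r0).
Qed.

Lemma dist2_ucont (T e : R) : 0 < e -> exists2 d : R, 0 < d &
  forall s t : R, 0 <= s <= T -> 0 <= t <= T -> `|s - t| < d -> dist2 s t <= e.
Proof.
(* [heine] asks for a triangle inequality at all real times, whereas the memory is square integrable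
   only at nonnegative ones. *)
move=> e0; pose d' (s t : R) := dist2 (Num.max 0 s) (Num.max 0 t).
have max_ge0 (s : R) : 0 <= Num.max 0 s by rewrite le_max lexx.
have [|||d d0 Hd] := @heine R d' _ _ _ T e e0.
- by move=> s t; exact: dist2C.
- by move=> s r t; apply: dist2_tri.
- move=> t t0; rewrite /d'; apply/cvgrPdist_le => e' e'0.
  move/cvgrPdist_le : (dist2_cvg t0) => /(_ e' e'0); rewrite !near_withinE.
  apply: filterS => s + s0 => /(_ s0); rewrite !max_r//.
  by move: s0; rewrite /= in_itv/= andbT.
exists d => // s t /andP[s0 sT] /andP[t0 tT] st.
have := Hd s t; rewrite s0 sT t0 tT => /(_ erefl erefl st).
by rewrite /d' !max_r.
Qed.

Lemma solution_ucont_v : ucont v.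
Proof.
move=> T e e0; have e2 : 0 < e ^+ 2 by rewrite exprn_gt0.
have [d d0 Hd] := dist2_ucont T e2; exists d => // s t sT tT st.
rewrite -(@ler_pXn2r _ 2)// ?nnegrE ?(ltW e0)//.
by apply: le_trans (Hd s t sT tT st); have [] := dist2_ge s t.
Qed.

Lemma solution_ucont_z : ucont (fun t => z t).
Proof.
have m1 : 0 < 1 - m by rewrite subr_gt0 mass_lt1.
move=> T e e0; have e2 : 0 < (1 - m) * e ^+ 2 by rewrite mulr_gt0// exprn_gt0.
have [d d0 Hd] := dist2_ucont T e2; exists d => // s t sT tT st.
rewrite -(@ler_pXn2r _ 2)// ?nnegrE ?(ltW e0)// -(ler_pM2l m1).
by apply: le_trans (Hd s t sT tT st); have [] := dist2_ge s t.
Qed.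

(** The reverse triangle inequality for the weighted seminorm; the memory energy is then half the
    square of a continuous function. *)
Lemma ucont_sqrt_memory : ucont (fun t => Num.sqrt (dotm (zeta t) (zeta t)) : R^o).
Proof.
move=> T e e0; have e2 : 0 < e ^+ 2 by rewrite exprn_gt0.
have [d d0 Hd] := dist2_ucont T e2; exists d => //.
have key (s t : R) : 0 <= s <= T -> 0 <= t <= T -> `|s - t| < d ->
    Num.sqrt (dotm (zeta s) (zeta s)) - Num.sqrt (dotm (zeta t) (zeta t)) <= e.
  move=> sT tT st; have /andP[s0 _] := sT; have /andP[t0 _] := tT.
  have Ls := Lsq_zeta s0; have Lt := Lsq_zeta t0.
  have hd : dotm (fun r => zeta s r - zeta t r) (fun r => zeta s r - zeta t r) <= e ^+ 2.
    by apply: le_trans (Hd s t sT tT st); have [] := dist2_ge s t.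
  have p0 := dotmu_ge0 hip mu_ge0.
  have Ld := LsqB hip mu_ge0 mu_int Ls Lt.
  have cs := dotmu_cauchy_schwarz hip mu_ge0 mu_int Lt Ld.
  set b := Num.sqrt (dotm (zeta t) (zeta t)).
  have b0 : 0 <= b := sqrtr_ge0 _.
  have b2 : b ^+ 2 = dotm (zeta t) (zeta t) by rewrite sqr_sqrtr.
  have h1 : dotm (zeta t) (fun r => zeta s r - zeta t r) <= b * e.
    apply: le_trans (ler_norm _) _.
    rewrite -(@ler_pXn2r _ 2)// ?nnegrE ?mulr_ge0 ?(ltW e0)//.
    rewrite real_normK ?num_real// exprMn b2; apply: le_trans cs _.
    by rewrite ler_wpM2l// p0.
  rewrite lerBlDr -[leRHS]ger0_norm ?addr_ge0 ?(ltW e0)// -sqrtr_sqr ler_wsqrtr//.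
  have : dotm (zeta s) (zeta s) = dotm (zeta t) (zeta t) +
      2 * dotm (zeta t) (fun r => zeta s r - zeta t r) +
      dotm (fun r => zeta s r - zeta t r) (fun r => zeta s r - zeta t r).
    rewrite (dotmuBl hip mu_ge0 mu_int Ls Lt Ld) !(dotmuBr hip mu_ge0 mu_int)//.
    by rewrite [dotm (zeta t) (zeta s)]dotmuC; ring.
  by move=> ->; rewrite -b2; move: h1 hd; nra.
move=> s t sT tT st; rewrite ler_distl; apply/andP; split.
  by have := key t s tT sT; rewrite distrC => /(_ st); lra.
by have := key s t sT tT st; lra.
Qed.

Lemma solution_ucont_N : ucont memory_energy.
Proof.
have h : memory_energy = (fun t => 2^-1 * (Num.sqrt (dotm (zeta t) (zeta t)) * Num.sqrt (dotm (zeta t) (zeta t)))).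
  apply/funext => t; rewrite memory_energyE -expr2 sqr_sqrtr//.
  exact: (dotmu_ge0 hip mu_ge0).
rewrite h; apply: (ucontZ (V := R^o)).
by apply: ucontM; exact: ucont_sqrt_memory.
Qed.

Lemma memory_energy_ge0 t : 0 <= memory_energy t.
Proof. by rewrite memory_energyE mulr_ge0// (dotmu_ge0 hip mu_ge0). Qed.

Lemma elastic_forceB (t : R) (x y : H) : 0 <= t ->
  elastic_force t (x - y) = elastic_force t x - elastic_force t y.
Proof.
move=> t0; rewrite /elastic_force ipBr.
have -> : dotm (zeta t) (fun=> x - y) = dotm (zeta t) (fun=> x) - dotm (zeta t) (fun=> y).
  by apply: (dotmuBr hip mu_ge0 mu_int (f := fun=> x) (g := fun=> y)); [exact: Lsq_cst|exact: Lsq_cst|exact: Lsq_zeta].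
by ring.
Qed.

Lemma elastic_force_bound (t : R) (y : H) : 0 <= t ->
  elastic_force t y ^+ 2 <= 2 * ((1 - m) / 2 * `|z t| ^+ 2 + memory_energy t) * `|y| ^+ 2.
Proof.
move=> t0; have := phase_cauchy_schwarz hip mu_ge0 mu_int (z t) y mass_lt1 (Lsq_zeta t0).
congr (_ <= _); congr (_ * _); rewrite memory_energyE; by field.
Qed.

Lemma elastic_force_cont (T e : R) : 0 < e -> exists2 d : R, 0 < d &
  forall s t : R, 0 <= s <= T -> 0 <= t <= T -> `|s - t| < d ->
    forall y, `|elastic_force s y - elastic_force t y| <= e * `|y|.
Proof.
move=> e0; have e2 : 0 < e ^+ 2 by rewrite exprn_gt0.
have [d d0 Hd] := dist2_ucont T e2; exists d => // s t sT tT st y.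
have /andP[s0 _] := sT; have /andP[t0 _] := tT.
have Ls := Lsq_zeta s0; have Lt := Lsq_zeta t0.
have Ld := LsqB hip mu_ge0 mu_int Ls Lt.
have := phase_cauchy_schwarz hip mu_ge0 mu_int (z s - z t) y mass_lt1 Ld.
rewrite (dotmuBl hip mu_ge0 mu_int Ls Lt (Lsq_cst mu_int y)) ipBl => h.
rewrite -(@ler_pXn2r _ 2)// ?nnegrE ?mulr_ge0 ?(ltW e0)//.
rewrite real_normK ?num_real// exprMn.
have -> : elastic_force s y - elastic_force t y = (1 - m) * (ip (z s) y - ip (z t) y) +
  (dotm (zeta s) (fun=> y) - dotm (zeta t) (fun=> y)) by rewrite /elastic_force; ring.
apply: le_trans h _; rewrite ler_wpM2r ?sqr_ge0//.
apply: le_trans (Hd s t sT tT st); rewrite /dist2.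
have : 0 <= `|v s - v t| ^+ 2 := sqr_ge0 _.
lra.
Qed.

(** Positivity of the weighted square of zeta + (1 - m) z bounds the cross term from below, with
    half of (1 - m) |z|^2 to spare because m < 1. *)
Lemma elastic_force_coercive (t : R) : 0 <= t ->
  (1 - m) / 2 * `|z t| ^+ 2 - (1 - m)^-1 * memory_energy t <= elastic_force t (z t).
Proof.
move=> t0; have Lt := Lsq_zeta t0.
have m1 : 0 < 1 - m by rewrite subr_gt0 mass_lt1.
have m0 : 0 <= m := mass_ge0 mu_ge0.
have Lc := Lsq_cst mu_int (- (1 - m) *: z t).
have := dotmu_ge0 hip mu_ge0 (fun s => zeta t s - - (1 - m) *: z t).
rewrite (dotmuBl hip mu_ge0 mu_int Lt Lc (LsqB hip mu_ge0 mu_int Lt Lc)) !(dotmuBr hip mu_ge0 mu_int)//.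
rewrite (dotmuC ip mu (fun=> - (1 - m) *: z t) (zeta t)).
rewrite (dotmuZr hip mu_ge0 mu_int _ Lt (Lsq_cst mu_int (z t))).
rewrite (dotmu_cst _ mu_int) ipZl ipZr -hip /elastic_force -hip memory_energyE.
move: (dotm _ _) (dotm _ _) (`|z t| ^+ 2) (sqr_ge0 `|z t|) => c a w w0 h.
have m1' : 1 - m != 0 by rewrite gt_eqF.
rewrite -(ler_pM2l m1).
have -> : (1 - m) * ((1 - m) / 2 * w - (1 - m)^-1 * (2^-1 * a)) =
  (1 - m) ^+ 2 / 2 * w - a / 2 by field.
have : (1 - m) ^+ 2 * m * w <= (1 - m) ^+ 2 * w.
  by rewrite ler_wpM2r// ger_pMr ?exprn_gt0// ltW// mass_lt1.
move: h; lra.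
Qed.

End SolutionDynamics.

(** * The trapezoid inequality for the stored energy *)

Section Trapezoid.
Context {R : realType} {H : completeNormedModType R} (ip : {dot H for idfun}).
Hypothesis hip : norm_of_inner ip.
Variables (Ah : @operator R H) (mu : R -> R).
Hypothesis Ahlin : linear_operator Ah.
Hypothesis hmu : admissible_kernel mu.
Local Notation leb := (@lebesgue_measure R).
Variables (u v : R -> H).
Hypothesis hphase : phase_continuous Ah mu u v.
Local Notation z t := (Ah (u t)).
Local Notation m := (mass mu).
Local Notation zeta t := (fun s : R => Ah (past u t s)).
Local Notation "'dotm'" := (dotmu ip mu).
Local Notation P := (elastic_energy Ah u m (memory_energy Ah mu u)).

Let mu_ge0 := kernel_ge0 hmu.
Let mu_int := kernel_integrable hmu.

Lemma zeta_recent (t s : R) : 0 < s -> s <= t -> Ah (past u t s) = z t - z (t - s).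
Proof.
move=> s0 st; have t0 : 0 <= t by apply: le_trans st; exact: ltW.
have [_ ->] // := linear_operatorB Ahlin (dom_u hphase t0) (dom_u hphase (t := t - s) ltac:(lra)).
Qed.

(** The transport of the memory integrated along a diagonal: the past instant t - s is the same
    before and after the shift, so only the present position changes. *)
Lemma zeta_shift (t h s : R) : 0 <= t -> 0 < h -> 0 < s ->
  Ah (past u (t + h) (s + h)) = Ah (past u t s) + (z (t + h) - z t).
Proof.
move=> t0 h0 s0; have th0 : 0 <= t + h by lra.
have D1 := dom_past hphase th0 (s := s + h) ltac:(lra).
have D2 := dom_past hphase t0 s0.
have [D3 E3] := linear_operatorB Ahlin (dom_u hphase th0) (dom_u hphase t0).
have [_ E] := linear_operatorB Ahlin D1 D2.
have -> : Ah (past u (t + h) (s + h)) = (Ah (past u (t + h) (s + h)) - Ah (past u t s)) + Ah (past u t s).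
  by rewrite subrK.
rewrite -E -E3 addrC; congr (_ + Ah _).
rewrite /past; have -> : t + h - (s + h) = t - s by ring.
by rewrite opprB addrA subrK.
Qed.

Lemma mass_head (h : R) : 0 <= h ->
  \int[leb]_(s in `]0, h]) mu s <= mu 0 * h.
Proof.
move=> h0; have h1 : leb.-integrable `]0, h] (EFin \o mu).
  apply: integrableS mu_int => // x; rewrite /= !in_itv/= andbT => /andP[x0 _]; exact: ltW.
have mh : fine (leb `]0, h]) = h.
  rewrite lebesgue_measure_itv/= lte_fin; case: ifPn => [_|]/=; first by rewrite subr0.
  by rewrite -leNgt => h0'; apply/eqP; rewrite eq_le h0 h0'.
apply: (@le_trans _ _ (\int[leb]_(s in `]0, h]) mu 0)); last by rewrite Rintegral_cst// mh.
apply: le_Rintegral => //.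
  have -> : EFin \o (fun=> mu 0) = cst (mu 0)%:E by [].
  apply/integrableP; split; first exact: measurable_cst.
  rewrite integral_cst//= lebesgue_measure_itv/= lte_fin; case: ifPn => _.
    by rewrite -EFinB -EFinM ltry.
  by rewrite mule0.
by move=> s; rewrite /= in_itv/= => /andP[s0 _]; apply: (kernel_homo hmu) => //; exact: ltW.
Qed.

                                                                                    
                                                                                 
                                                                                        
(** The elastic part is an exact polarization identity. In the memory part, split the integral at
    time t + h at s = h and shift the older portion by h. With w = zeta^t(s), the integrands combine
    to (mu(s) - mu(s+h)) (|w|^2 + <w, X>), which is at least (mu(s) - mu(s+h)) (|w|^2 - |X|^2) / 2.
    Kernel decay makes the first term dissipation, and the second integrates to the mass of mu on
    ]0, h], of order h. *)
Lemma trapezoid_inequality : exists2 dlt : R, 0 < dlt &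
  forall t h e : R, 0 <= t -> 0 < h -> h <= 1 ->
  (forall r r' : R, t <= r <= t + h -> t <= r' <= t + h -> `|z r - z r'| <= e) ->
  P (t + h) - P t + dlt * h * memory_energy Ah mu u t - 2 * mu 0 * h * e ^+ 2 <=
  2^-1 * (elastic_force ip Ah mu u t (z (t + h) - z t) +
          elastic_force ip Ah mu u (t + h) (z (t + h) - z t)).
Proof.
have [d d0 Hd] := kernel_decay hmu.
have d1 : 0 < 1 + d by rewrite ltr_wpDl// ltW.
exists (d / (1 + d) / 2); first by rewrite !divr_gt0.
move=> t h e t0 h0 h1 He; set X := z (t + h) - z t.
have th0 : 0 <= t + h by lra.
have mu00 : 0 <= mu 0 by exact: mu_ge0.
have e0 : 0 <= e by apply: le_trans (He t t _ _) => //; rewrite lexx lerDl ltW.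
have Xe : `|X| <= e by apply: He; rewrite lexx lerDl ltW.
have La := Lsq_zeta hphase t0; have La' := Lsq_zeta hphase th0.
have LX := Lsq_cst mu_int X.
have LXa := LsqB hip mu_ge0 mu_int LX La'.
have I := dotmu_integrable hip mu_ge0 mu_int.
pose phi s := mu s * ip (Ah (past u (t + h) s)) (X - Ah (past u (t + h) s)).
have Iphi : leb.-integrable `]0, +oo[ (EFin \o phi) := I _ _ La' LXa.
have [Ish Esh] := integral_shift (ltW h0) Iphi.
have [Im Em] := integral_shift (ltW h0) (mu_int_oo mu_int).
(* From mu(s+h) <= mu(s) / (1 + d h) the relative loss is d h / (1 + d h), at least [k] since h <=
   1. *)
pose k := d / (1 + d) * h.
have k0 : 0 <= k by rewrite mulr_ge0 ?divr_ge0 ?ltW.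
have muk (s : R) : 0 < s -> k * mu s <= mu s - mu (s + h).
  move=> s0; have := Hd s h (ltW s0) h0; have := mu_ge0 (ltW s0).
  have : mu (s + h) <= mu s by apply: (kernel_homo hmu); [exact: ltW|rewrite lerDl ltW].
  move: (mu s) (mu (s + h)) => x y yx x0 hy.
  have -> : k * x = d * h * x / (1 + d) by rewrite /k; field; rewrite gt_eqF.
  rewrite ler_pdivrMr//.
  have : (x - y) * (d * h) <= (x - y) * d by rewrite ler_wpM2l ?subr_ge0// ger_pMr.
  lra.
pose f1 s := k / 2 * (mu s * ip (zeta t s) (zeta t s)) +
  (- (`|X| ^+ 2 / 2) * mu s + `|X| ^+ 2 / 2 * mu (s + h)).
pose f2 s := (mu s * ip (zeta t s) (zeta t s) + mu s * ip (zeta t s) X) + phi (s + h).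
have le12 : \int[leb]_(s in `]0, +oo[) f1 s <= \int[leb]_(s in `]0, +oo[) f2 s.
  apply: le_Rintegral => //.
  - apply: integrable_addr => //; first by apply: integrable_mull => //; exact: I.
    apply: integrable_addr => //; last exact: integrable_mull.
    by apply: integrable_mull => //; exact: mu_int_oo.
  - by apply: integrable_addr => //; apply: integrable_addr => //; exact: I.
  move=> s; rewrite /= in_itv/= andbT => s0; rewrite /f1 /f2 /phi zeta_shift//.
  have := muk s s0; have : mu (s + h) <= mu s by apply: (kernel_homo hmu); [exact: ltW|rewrite lerDl ltW].
  rewrite -/X; move: (mu s) (mu (s + h)) (Ah (past u t s)) (X) => x y w Y yx kx.
  have -> : Y - (w + Y) = - w by rewrite opprD addrCA subrr addr0.
  have -> : ip (w + Y) (- w) = - ip w w - ip w Y by rewrite -scaleN1r ipZr ipDl (ipC _ Y w); ring.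
  rewrite -hip; have : 0 <= `|w + Y| ^+ 2 := sqr_ge0 _.
  rewrite (hip (w + Y)) ipDl !ipDr (ipC _ Y w) -!hip.
  have : 0 <= `|w| ^+ 2 := sqr_ge0 _.
  move: (ip w Y) (`|w| ^+ 2 : R) (`|Y| ^+ 2 : R) => p q r q0 pq.
  have h2 : 0 <= (x - y) * (q + p + (p + r)) by rewrite mulr_ge0 ?subr_ge0.
  have h3 := ler_wpM2r q0 kx.
  move: h2 h3; glra.
have E1 : \int[leb]_(s in `]0, +oo[) f1 s = k / 2 * dotm (zeta t) (zeta t) -
    `|X| ^+ 2 / 2 * \int[leb]_(s in `]0, h]) mu s.
  rewrite RintegralD//; last first.
  - apply: integrable_addr => //; last exact: integrable_mull.
    by apply: integrable_mull => //; exact: mu_int_oo.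
  - by apply: integrable_mull => //; exact: I.
  rewrite RintegralZl//; last exact: I.
  rewrite RintegralD//; last first.
  - exact: integrable_mull.
  - by apply: integrable_mull => //; exact: mu_int_oo.
  rewrite !RintegralZl//; last exact: mu_int_oo.
  by rewrite Em /dotmu; ring.
have E2 : \int[leb]_(s in `]0, +oo[) f2 s = dotm (zeta t) (zeta t) + dotm (zeta t) (fun=> X) +
    \int[leb]_(s in `]0, +oo[) phi (s + h).
  rewrite RintegralD//; last by apply: integrable_addr => //; exact: I.
  by rewrite RintegralD//; exact: I.
have E3 : dotm (zeta (t + h)) (fun=> X) - dotm (zeta (t + h)) (zeta (t + h)) =
    \int[leb]_(s in `]0, h]) phi s + \int[leb]_(s in `]0, +oo[) phi (s + h).
  by rewrite -Esh -(dotmuBr hip mu_ge0 mu_int).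
(* For s <= h the history involves only times in [t, t+h], so w is at most e and X - w at most 2e in
   norm. *)
have Hh : - (2 * e ^+ 2) * (mu 0 * h) <= \int[leb]_(s in `]0, h]) phi s.
  have sub : (`]0, h]%classic : set R) `<=` `]0, +oo[.
    by move=> x; rewrite /= !in_itv/= andbT => /andP[].
  have Imh : leb.-integrable `]0, h] (EFin \o mu) by apply: integrableS (mu_int_oo mu_int).
  apply: (@le_trans _ _ (\int[leb]_(s in `]0, h]) (- (2 * e ^+ 2) * mu s))).
    rewrite RintegralZl// !mulNr lerN2 ler_wpM2l ?mulr_ge0 ?sqr_ge0//.
    by apply: mass_head; exact: ltW.
  apply: le_Rintegral => //; first exact: integrable_mull.
    exact: integrableS Iphi.
  move=> s; rewrite /= in_itv/= => /andP[s0 sh]; rewrite /phi mulrC.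
  have ms := mu_ge0 (ltW s0); rewrite ler_wpM2l//.
  rewrite zeta_recent//; last by rewrite ler_wpDl.
  set w := z (t + h) - _.
  have q1 : t <= t + h - s by rewrite -addrA lerDl subr_ge0.
  have q2 : t + h - s <= t + h by rewrite gerBl ltW.
  have q3 : t <= t + h by rewrite lerDl ltW.
  have we : `|w| <= e by apply: He; rewrite ?q1 ?q2 ?q3 ?lexx.
  have : `|ip w (X - w)| <= e * (2 * e).
    apply: le_trans (ip_cauchy_schwarz hip _ _) _; apply: ler_pM => //.
    by rewrite mulr_natl mulr2n; apply: le_trans (ler_normB _ _) _; exact: lerD.
  by rewrite ler_norml => /andP[+ _]; rewrite mulrCA -expr2.
have mh := mass_head (ltW h0).
have X2 : `|X| ^+ 2 <= e ^+ 2 by rewrite ler_pXn2r// nnegrE.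
have mh0 : 0 <= \int[leb]_(s in `]0, h]) mu s.
  by apply: Rintegral_ge0 => s; rewrite /= in_itv/= => /andP[s0 _]; apply: mu_ge0; exact: ltW.
have h5 : `|X| ^+ 2 / 2 * \int[leb]_(s in `]0, h]) mu s <= e ^+ 2 / 2 * (mu 0 * h).
  by apply: ler_pM => //; rewrite ?divr_ge0 ?sqr_ge0// ler_pM2r// invr_gt0.
have hz : (1 - m) / 2 * `|z (t + h)| ^+ 2 - (1 - m) / 2 * `|z t| ^+ 2 =
   2^-1 * ((1 - m) * ip (z t) X + (1 - m) * ip (z (t + h)) X).
  by rewrite /X !ipBr -!hip (ipC _ (z (t + h)) (z t)); field.
rewrite /elastic_energy /elastic_force !(memory_energyE hip).
have -> : d / (1 + d) / 2 * h = k / 2 by rewrite /k; ring.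
rewrite E1 E2 in le12; move: le12 E3 Hh h5 hz.
move: (dotm (zeta t) (zeta t)) (dotm (zeta t) (fun=> X)) (dotm (zeta (t + h)) (fun=> X))
  (dotm (zeta (t + h)) (zeta (t + h))) => c1 c2 c3 c4.
move: (\int[leb]_(s in `]0, h]) phi s) (\int[leb]_(s in `]0, +oo[) phi (s + h))
  (\int[leb]_(s in `]0, h]) mu s) mh0 => c5 c6 c7 mh0.
move: (`|z (t + h)| ^+ 2) (`|z t| ^+ 2) (ip (z t) X) (ip (z (t + h)) X) => c8 c9 c10 c11.
have e2 : 0 <= e ^+ 2 * (mu 0 * h) by rewrite !mulr_ge0 ?sqr_ge0// ltW.
clearbody k phi f1 f2; move: e2; lra.
Qed.

End Trapezoid.

(** * The weak form of the equation over a time interval *)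

Section RintegralBounds.
Context {R : realType}.
Local Notation leb := (@lebesgue_measure R).

Lemma ae_le_normr_Rintegral (D : set (measurableTypeR R)) (f k : R -> R) : measurable D ->
  leb.-integrable D (EFin \o f) -> leb.-integrable D (EFin \o k) ->
  {ae leb, forall r, D r -> `|f r| <= k r} ->
  `|\int[leb]_(r in D) f r| <= \int[leb]_(r in D) k r.
Proof.
move=> mD If Ik fk; apply: le_trans (le_normr_Rintegral mD If) _.
have kE : \int[leb]_(r in D) k r = \int[leb]_(r in D) `|k r|.
  congr fine; apply: ae_eq_integral => //.
  - by have /integrableP[] := Ik.
  - exact: (measurable_int leb (integrable_norm Ik)).
  apply: filterS fk => r /= fk Dr; rewrite ger0_norm//.
  by apply: le_trans (fk Dr).
rewrite kE; apply: fine_le.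
- exact/integrable_fin_num/integrable_norm.
- exact/integrable_fin_num/integrable_norm.
apply: ae_ge0_le_integral => //=.

- exact: (measurable_int leb (integrable_norm If)).

- exact: (measurable_int leb (integrable_norm Ik)).
apply: filterS fk => r fk Dr; rewrite lee_fin.
by apply: le_trans (fk Dr) _; exact: ler_norm.
Qed.

Lemma Rintegral_itv_cst (s t k : R) : s <= t -> \int[leb]_(r in `]s, t]) k = k * (t - s).
Proof.
move=> st; have h : fine (leb `]s, t]) = t - s.
  rewrite lebesgue_measure_itv/= lte_fin; case: ifPn => //.
  by rewrite -leNgt => ts; apply/eqP; rewrite eq_sym subr_eq0 eq_le st ts.
by rewrite Rintegral_cst// h.
Qed.

Lemma integrable_itv_cst (s t k : R) : leb.-integrable `]s, t] (EFin \o fun=> k).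
Proof.
apply/integrableP; split; first exact: measurable_cst.
rewrite integral_cst//= lebesgue_measure_itv/= lte_fin; case: ifPn => _.
  by rewrite -EFinB -EFinM ltry.
by rewrite mule0.
Qed.

End RintegralBounds.

Section WeakForm.
Context {R : realType} {H : completeNormedModType R} (ip : {dot H for idfun}).
Hypothesis hip : norm_of_inner ip.
Variables (A Ah : @operator R H) (mu : R -> R) (tau : R).
Local Notation leb := (@lebesgue_measure R).
Variables (b : R -> R) (t1 : R).
Hypothesis b_int : leb.-integrable `]0, +oo[ (EFin \o b).
Hypothesis b_off : forall r : R, 0 <= r -> r < t1 -> b r = 0.
Hypotheses (tau0 : 0 < tau) (tau_t1 : tau <= t1).
Variables (u v : R -> H) (g : R -> H -> R).
Hypothesis hg : dual_derivative ip Ah v g.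
Hypothesis heq : {ae leb, forall t, 0 < t ->
  momentum_equation ip Ah mu tau b u v g t /\ transport_equation ip A mu u v t}.

Definition feedback_mass (t : R) := \int[leb]_(r in `]0, t]) `|b r|.

Let b_norm_int (t : R) : leb.-integrable `]0, t] (EFin \o (fun r => `|b r|)).
Proof.
have /integrable_norm := b_int.
by apply: integrableS => // x; rewrite /= !in_itv/= andbT => /andP[].
Qed.

Lemma feedback_massB (s t : R) : 0 <= s -> s <= t ->
  feedback_mass t - feedback_mass s = \int[leb]_(r in `]s, t]) `|b r|.
Proof. by move=> s0 st; apply: Rintegral_itvB; rewrite ?bnd_simp. Qed.

Lemma feedback_mass_homo (s t : R) : 0 <= s -> s <= t -> feedback_mass s <= feedback_mass t.
Proof. by move=> s0 st; rewrite -subr_ge0 feedback_massB// Rintegral_ge0. Qed.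

Lemma feedback_mass_le (t : R) : feedback_mass t <= \int[leb]_(r in `]0, +oo[) `|b r|.
Proof.
have sub : (`]0, t]%classic : set (measurableTypeR R)) `<=` `]0, +oo[.
  by move=> x; rewrite /= !in_itv/= andbT => /andP[].
apply: fine_le; last first.
  by apply: ge0_subset_integral => //=; exact: (measurable_int leb (integrable_norm b_int)).
- exact/integrable_fin_num/integrable_norm.
- exact: (integrable_fin_num _ (b_norm_int t)).
Qed.

(** Integrate the momentum equation over ]s, t]: freezing the force at time s costs the first error
    term, and the feedback is at most M |x| |b|. *)
Lemma weak_increment (s t M e : R) x : 0 <= s -> s <= t -> dom Ah x ->
  (forall r : R, 0 <= r -> r <= t -> `|v r| <= M) ->
  (forall (r : R) y, s <= r <= t ->
     `|elastic_force ip Ah mu u r y - elastic_force ip Ah mu u s y| <= e * `|y|) ->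
  `|ip (v t - v s) x + (t - s) * elastic_force ip Ah mu u s (Ah x)| <=
    e * (t - s) * `|Ah x| + M * `|x| * (feedback_mass t - feedback_mass s).
Proof.
move=> s0 st Dx vM Qe; set q := elastic_force ip Ah mu u s (Ah x).
have t0 := le_trans s0 st.
have [It Et] := hg.2 x Dx t t0; have [_ Es] := hg.2 x Dx s s0.
have Ist : leb.-integrable `]s, t] (EFin \o (fun r => g r x)).
  apply: integrableS It => // r; rewrite /= !in_itv/= => /andP[sr ->].
  by rewrite (le_trans s0 (ltW sr)).
have Ib : leb.-integrable `]s, t] (EFin \o (fun r => `|b r|)).
  by apply: integrableS (b_norm_int t) => // r; rewrite /= !in_itv/= => /andP[/(le_lt_trans s0) -> ->].
have -> : ip (v t - v s) x + (t - s) * q = \int[leb]_(r in `]s, t]) (g r x + q).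
  rewrite RintegralD//; last exact: integrable_itv_cst.
  rewrite Rintegral_itv_cst// mulrC; congr (_ + _).
  rewrite -(Rintegral_itvB It) ?bnd_simp// -Et -Es ipBl; ring.
rewrite feedback_massB//.
have -> : e * (t - s) * `|Ah x| + M * `|x| * \int[leb]_(r in `]s, t]) `|b r| =
    \int[leb]_(r in `]s, t]) (e * `|Ah x| + M * `|x| * `|b r|).
  rewrite RintegralD//; [|exact: integrable_itv_cst|exact: integrable_mull].
  by rewrite Rintegral_itv_cst// RintegralZl// mulrAC.
apply: ae_le_normr_Rintegral => //.
- by apply: integrable_addr => //; exact: integrable_itv_cst.
- by apply: integrable_addr => //; [exact: integrable_itv_cst|exact: integrable_mull].
apply: (@filterS _ _ (ae_filter_ringOfSetsType leb) _ _ _ heq) => r + /=; rewrite in_itv/= => + /andP[sr rt].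
have r0 := le_lt_trans s0 sr.
move=> /(_ r0)[/(_ x Dx) -> _].
have h1 := Qe r (Ah x); rewrite (ltW sr) rt in h1; have {}h1 := h1 erefl.
have h2 : `|ip (delay_term tau b v r) x| <= M * `|x| * `|b r|.
  (* Before [t1] the coefficient is 0; afterwards r - tau is nonnegative, so the bound on the
     velocity applies. *)
  rewrite /delay_term; have [rt1|t1r] := ltP r t1.
    by rewrite b_off ?(ltW r0)// scale0r oppr0 ip0l !normr0 mulr0.
  apply: le_trans (ip_cauchy_schwarz hip _ _) _.
  rewrite normrN normrZ -mulrA [leRHS]mulrC ler_wpM2l// ler_wpM2r//.
  by apply: vM; [rewrite subr_ge0 (le_trans tau_t1)|rewrite lerBlDr (le_trans rt)// lerDl ltW].
rewrite distrC in h1.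
apply: le_trans (lerD h1 h2); apply: le_trans (ler_normD _ _).
rewrite le_eqVlt; apply/orP; left; apply/eqP; congr `|_|.
rewrite /q /elastic_force /dotmu; ring.
Qed.

End WeakForm.

(** * Stability for an integrable feedback coefficient *)

Section Stability.
Context {R : realType} {H : completeNormedModType R} (ip : {dot H for idfun}).
Hypothesis hip : norm_of_inner ip.
Variables (A Ah : @operator R H).
Hypotheses (hA : positive_self_adjoint ip A) (hK : compact_inverse A)
  (hAh : is_positive_sqrt ip Ah A).
Variables (tau : R) (mu : R -> R).
Hypotheses (tau0 : 0 < tau) (hmu : admissible_kernel mu).
Local Notation leb := (@lebesgue_measure R).

(** On a short window the kernel is at least [mu 0 / 2], so the unweighted integral is at most 2 /
    mu(0) times the weighted one, which is twice the memory energy. *)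
Lemma history_le_memory (u v : R -> H) : phase_continuous Ah mu u v -> linear_operator Ah ->
  exists2 s0 : R, 0 < s0 & forall t : R, s0 <= t ->
    \int[leb]_(s in `[0, s0]) (`|Ah (u t) - Ah (u (Num.max 0 (t - s)))| ^+ 2) <=
      4 / mu 0 * memory_energy Ah mu u t.
Proof.
move=> hph Ahlin; have [s0 s00 Hs] := kernel_lower hmu; exists s0 => // t s0t.
have mu00 : 0 < mu 0 by case: hmu.
have t0 : 0 <= t := le_trans (ltW s00) s0t.
have uz := solution_ucont_z hip Ahlin hmu hph.
have uf : ucont (fun s => `|Ah (u t) - Ah (u (Num.max 0 (t - s)))| ^+ 2 : R^o).
  apply: (ucont_sqnorm hip); apply: ucontD; first exact: ucont_cst.
  have := ucontZ (-1) (ucont_reflect t uz).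
  by under eq_fun do rewrite scaleN1r.
have If := ucont_integrable s0 uf.
have Ifo : leb.-integrable `]0, s0] (EFin \o (fun s => `|Ah (u t) - Ah (u (Num.max 0 (t - s)))| ^+ 2)).
  by apply: integrableS If => // x; rewrite /= !in_itv/= => /andP[/ltW -> ->].
have Im := (Lsq_zeta hph t0).2.
have sub : (`]0, s0]%classic : set (measurableTypeR R)) `<=` `]0, +oo[.
  by move=> x; rewrite /= !in_itv/= andbT => /andP[].
rewrite -Rintegral_itv_obnd_cbnd; last by have /integrableP[/measurable_EFinP] := Ifo.
have -> : 4 / mu 0 * memory_energy Ah mu u t =
    2 / mu 0 * \int[leb]_(s in `]0, +oo[) (mu s * `|Ah (past u t s)| ^+ 2).
  by rewrite /memory_energy; field; rewrite gt_eqF.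
have m0 : 0 <= 2 / mu 0 by rewrite divr_ge0 ?ltW.
apply: (@le_trans _ _ (2 / mu 0 * \int[leb]_(s in `]0, s0]) (mu s * `|Ah (past u t s)| ^+ 2))).
  rewrite -RintegralZl//; last exact: integrableS Im.
  apply: le_Rintegral => //; first by apply: integrable_mull => //; exact: integrableS Im.
  move=> s; rewrite /= in_itv/= => /andP[sp ss].
  rewrite (zeta_recent Ahlin hph sp (le_trans ss s0t)) max_r ?subr_ge0 ?(le_trans ss)//.
  have h := Hs s (ltW sp) ss; rewrite mulrA ler_peMl ?sqr_ge0//.
  by rewrite mulrAC ler_pdivlMr// mul1r mulrC -ler_pdivrMr.
rewrite ler_wpM2l//; apply: fine_le.
- exact: (integrable_fin_num _ (integrableS _ _ sub Im)).
- exact: (integrable_fin_num _ Im).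
apply: ge0_subset_integral => //=; first exact: (measurable_int leb Im).
by move=> s; rewrite in_itv/= andbT => sp; rewrite lee_fin mulr_ge0 ?sqr_ge0// (kernel_ge0 hmu)// ltW.
Qed.

Lemma stable_of_integrable (b : R -> R) (t1 : R) :
  leb.-integrable `]0, +oo[ (EFin \o b) ->
  (forall r : R, 0 <= r -> r < t1 -> b r = 0) -> tau <= t1 ->
  asymptotically_stable ip A Ah mu tau b.
Proof.
move=> b_int b_off tau_t1 u0 v0 u v [_ _ huv hph [g hg heq]].
have [[Ahlin _ _] _ _] := hAh.
have [cP cP0 HcP] := poincare_of_compact_inverse hip hA hK hAh.
have [dlt dlt0 Htr] := trapezoid_inequality hip Ahlin hmu hph.
have [s0 s00 Hhist] := history_le_memory hph Ahlin.
have m1 : 0 < 1 - mass mu by rewrite subr_gt0 (mass_lt1 hmu).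
have mu00 : 0 < mu 0 by case: hmu.
have dyn : dynamics ip (dom Ah) Ah u v (mass mu) (memory_energy Ah mu u)
    (elastic_force ip Ah mu u) (feedback_mass b) dlt (2 * mu 0) (1 - mass mu)^-1.
  split => //.
  - by move=> x y; exact: linear_operatorB.
  - by move=> t; exact: (dom_u hph).
  - exact: (solution_ucont_v hip Ahlin hmu hph).
  - exact: (solution_ucont_z hip Ahlin hmu hph).
  - exact: (mass_lt1 hmu).
  - exact: (solution_ucont_N hip Ahlin hmu hph).
  - by move=> t _; exact: (memory_energy_ge0 hip Ah hmu).
  - by move=> t x y; exact: (elastic_forceB hip hmu hph).
  - by move=> t y; exact: (elastic_force_bound hip hmu hph).
  - by move=> T e; exact: (elastic_force_cont hip Ahlin hmu hph).
  - by move=> t; exact: (elastic_force_coercive hip hmu hph).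
  - exact: (feedback_mass_homo b_int).
  - exact: (weak_increment hip b_int b_off tau0 tau_t1 hg heq).
have cH0 : 0 <= 4 / mu 0 by rewrite divr_ge0 ?ltW.
have cN0 : 0 <= (1 - mass mu)^-1 by rewrite invr_ge0 ltW.
have B_le (t : R) : 0 <= t -> feedback_mass b t <= \int[leb]_(r in `]0, +oo[) `|b r|.
  by move=> _; exact: feedback_mass_le.
have Hv := energy_vanishes hip dyn dlt0 B_le cP0 s00 cH0 cN0 HcP Hhist.
apply/cvgrPdist_le => e e0; have [S HS] := Hv e e0.
exists S; split; first exact: num_real.
move=> t /ltW/HS; rewrite sub0r normrN.
have -> : energy Ah mu u v t = energy_of Ah u v (mass mu) (memory_energy Ah mu u) t.
  by rewrite /energy /energy_of /elastic_energy addrA.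
by move=> /andP[h1 h2]; rewrite ger0_norm.
Qed.

End Stability.

                                                   

(** * The logarithmic series *)

Section LogarithmicSeries.
Context {R : realType}.
Implicit Types a c beta : R^nat.

(** If the truncated series converged, its terms would tend to 0 and so eventually exceed - L; the
    two series would then differ by a constant and [a] would be summable. *)
Lemma series_maxr_cvgNy a (L : R) : 0 < L -> (forall n, a n <= 0) ->
  series a @ \oo --> -oo -> series (fun n => Num.max (a n) (- L)) @ \oo --> -oo.
Proof.
move=> L0 a0 aNy; set m := fun n => _.
have m0 n : m n <= 0 by rewrite /m ge_max a0 oppr_le0 ltW.
have dm : nonincreasing_seq (series m).
  by apply/nonincreasing_seqP => n; rewrite seriesSr gerDl.
apply: contrapT => /cvgrNyPle/existsNP[l lm].
have cm : cvgn (series m).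
  apply: nonincreasing_is_cvgn => //; exists l => _ [n _ <-].
  rewrite leNgt; apply/negP => mnl; apply: lm; exists n => // k /= nk.
  exact: le_trans (dm _ _ nk) (ltW mnl).
have [N _ HN] : \forall n \near \oo, m n = a n.
  have /cvgrPdist_lt/(_ _ L0) := cvg_series_cvg_0 cm.
  apply: filterS => n; rewrite sub0r normrN ler0_norm// /m ltrNl lt_max ltxx orbF.
  by move=> h; rewrite max_l ?ltW.
have /cvgrNyPle/(_ (series a N + (limn (series m) - series m N) - 1))[N' _ HN'] := aNy.
have := HN' (maxn N N') (leq_maxr _ _); rewrite leNgt => /negP; case.
have := sub_series_geq a (leq_maxl N N'); have := sub_series_geq m (leq_maxl N N').
have -> : \sum_(N <= k < maxn N N') m k = \sum_(N <= k < maxn N N') a k.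
  by apply: eq_big_nat => k /andP[Nk _]; exact: HN.
have := nonincreasing_cvgn_ge dm cm (maxn N N').
move: (series a _) (series m _) (series a N) (series m N) (limn _) (\sum_(_ <= _ < _) _) => p q r s x w.
lra.
Qed.

(** If c >= 1/4, factor out c and use ln(1 + beta/c) <= 4 beta. If c < 1/4, then c + beta <= 1/2,
    which is why the truncation level is - ln 2: beta may be far larger than c. *)
Lemma ln_feedback_le (c beta : R) : 0 < c -> 0 <= beta -> beta <= 4^-1 ->
  ln (expR (2 * beta) * (c + beta)) <= 6 * beta + Num.max (ln c) (- ln 2).
Proof.
move=> c0 b0 b4; have cb : 0 < c + beta by rewrite ltr_pwDl.
rewrite lnM ?posrE ?expR_gt0// expRK.
have [c4|c4] := leP 4^-1 c.
  have -> : c + beta = c * (1 + beta / c) by field; rewrite gt_eqF.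
  have bc : 0 <= beta / c by rewrite divr_ge0// ltW.
  rewrite lnM ?posrE// ?ltr_wpDr//.
  have h1 : ln (1 + beta / c) <= beta / c by apply: le_ln1Dx; lra.
  have h2 : beta / c <= 4 * beta by rewrite ler_pdivrMr//; nra.
  have h3 : ln c <= Num.max (ln c) (- ln 2) by rewrite le_max lexx.
  lra.
have h1 : ln (c + beta) <= - ln 2.
  rewrite -lnV ?posrE// ler_ln ?posrE ?invr_gt0//; lra.
have h3 : - ln 2 <= Num.max (ln c) (- ln 2) by rewrite le_max lexx orbT.
lra.
Qed.

Lemma series_ln_feedback c beta : (forall n, 0 < c n < 1) -> (forall n, 0 <= beta n) ->
  cvgn (series beta) -> series (fun n => ln (c n)) @ \oo --> -oo ->
  series (fun n => ln (expR (2 * beta n) * (c n + beta n))) @ \oo --> -oo.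
Proof.
move=> c01 b0 cb cNy; set f := fun n => _.
have L0 : 0 < ln (2 : R) by rewrite ln_gt0// ltr1n.
have lc0 n : ln (c n) <= 0 by rewrite ln_le0//; case/andP: (c01 n) => _ /ltW.
have mNy := series_maxr_cvgNy L0 lc0 cNy; set m := fun n => _ in mNy.
have db : nondecreasing_seq (series beta).
  by apply/nondecreasing_seqP => n; rewrite seriesSr lerDl.
have [N _ HN] : \forall n \near \oo, beta n <= 4^-1.
  have e0 : 0 < 4^-1 :> R by rewrite invr_gt0.
  have /cvgrPdist_le/(_ _ e0) := cvg_series_cvg_0 cb.
  by apply: filterS => n; rewrite sub0r normrN ger0_norm.
have fm n : (N <= n)%N -> f n <= 6 * beta n + m n.
  by move=> Nn; apply: ln_feedback_le => //; [case/andP: (c01 n)|exact: HN].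
apply/cvgrNyPle => K.
have /cvgrNyPle/(_ (K - (series f N + 6 * (limn (series beta) - series beta N) - series m N)))[N' _ HN'] := mNy.
exists (maxn N N') => // n; rewrite /= geq_max => /andP[Nn /HN'].
have : \sum_(N <= k < n) f k <= 6 * (\sum_(N <= k < n) beta k) + \sum_(N <= k < n) m k.
  rewrite mulr_sumr -big_split/= big_nat [leRHS]big_nat.
  by apply: ler_sum => k /andP[Nk _]; exact: fm.
rewrite -!sub_series_geq//; have := nondecreasing_cvgn_le db cb n.
move: (series f n) (series m n) (series beta n) (series f N) (series m N) (series beta N) (limn _)
  => p q r s l w x.
rewrite /=; lra.
Qed.

End LogarithmicSeries.

(** * Integrability of the on-off coefficient *)

Section OnOff.
Context {R : realType}.
Local Notation leb := (@lebesgue_measure R).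
Variables (b : R -> R) (ts bb : nat -> R) (tau : R).
Hypothesis mb : measurable_fun (`]0, +oo[%classic : set (measurableTypeR R)) b.
Hypothesis onoff : on_off_coefficient b ts bb.
Hypotheses (tau0 : 0 < tau) (tauT : forall n, tau <= ts n.*2.+1 - ts n.*2).
Local Notation head m := (`]0, ts m[%classic : set (measurableTypeR R)).

Let mabs : measurable_fun (`]0, +oo[%classic : set (measurableTypeR R)) (fun r => `|b r|%:E).
Proof. by apply/measurable_EFinP; exact: measurableT_comp. Qed.

Lemma head_integral_step (m : nat) (c : R) : 0 <= c ->
  (forall r : R, ts m <= r < ts m.+1 -> `|b r| <= c) ->
  (\int[leb]_(r in head m.+1) `|b r|%:E <=
     \int[leb]_(r in head m) `|b r|%:E + (c * (ts m.+1 - ts m))%:E)%E.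
Proof.
move=> c0 bc; have [_ tsS _ _ _] := onoff.
pose J : set (measurableTypeR R) := `]0, +oo[%classic `&` `[ts m, ts m.+1[%classic.
have mJ : measurable J by exact: measurableI.
have headS : head m.+1 = head m `|` J.
  have := tsS m; rewrite /J; move: (ts m) (ts m.+1) => x y xy.
  apply/seteqP; split => r /=; rewrite !in_itv/= ?andbT.
    by move=> /andP[-> ry]; have [rx|xr] := ltP r x; [left|right].
  by move=> [/andP[-> /lt_trans]|[-> /andP[]]]; [apply|].
have subJ : J `<=` `]0, +oo[ by move=> r [].
have subh : head m `<=` `]0, +oo[ by move=> r; rewrite /= !in_itv/= andbT => /andP[].
rewrite headS ge0_integral_setU//; first last.
- apply/disj_setPS => r [/=]; rewrite /J/= !in_itv/= => /andP[_ rm] [_ /andP[mr _]].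
  by move: (lt_le_trans rm mr); rewrite ltxx.
- by apply: measurable_funS mabs => // r [/subh|/subJ].
rewrite leeD2l//; apply: (@le_trans _ _ (c%:E * leb J)%E).
  have mbJ : measurable_fun J (EFin \o b).
    by apply/measurable_EFinP; apply: measurable_funS mb.
  apply: le_trans (integral_le_bound _ mJ mbJ _ _); rewrite ?lee_fin//.
  by apply: aeW => r [_ /=]; rewrite in_itv/= lee_fin => /bc.
rewrite EFinM lee_wpmul2l ?lee_fin//.
have -> : (ts m.+1 - ts m)%:E = leb `[ts m, ts m.+1[%classic.
  by rewrite lebesgue_measure_itv/= lte_fin tsS EFinB.
by apply: le_measure; rewrite ?inE//; exact: subIsetr.
Qed.

Lemma head_integral_le (n : nat) :
  (\int[leb]_(r in head n.*2) `|b r|%:E <=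
    (series (fun k => bb k.*2.+1 * (ts k.*2.+2 - ts k.*2.+1)) n)%:E)%E.
Proof.
have [ts0 tsS bb0 boff bon] := onoff.
elim: n => [|n IH].
  by rewrite double0 ts0 set_itvoo0 integral_set0 /series/= big_geq.
rewrite doubleS seriesSr EFinD.
apply: le_trans (head_integral_step (ltW (bb0 n)) _) _.
  by move=> r /bon/ltW.
rewrite leeD2r//; apply: le_trans IH.
apply: le_trans (head_integral_step (lexx 0) _) _.
  by move=> r /boff ->; rewrite normr0.
by rewrite mul0r adde0.
Qed.

(** Each off interval lasts at least tau, so the switching times are unbounded and the intervals
    exhaust the half line. *)
Lemma switching_time_ge (n : nat) : n%:R * tau <= ts n.*2.
Proof.
have [ts0 tsS _ _ _] := onoff.
elim: n => [|n IH]; first by rewrite mul0r double0 ts0.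
rewrite doubleS -natr1 mulrDl mul1r.
by have := tsS n.*2.+1; have := tauT n; lra.
Qed.

Lemma on_off_integrable :
  cvgn (series (fun k => bb k.*2.+1 * (ts k.*2.+2 - ts k.*2.+1))) ->
  leb.-integrable `]0, +oo[ (EFin \o b).
Proof.
move=> cs; have [ts0 tsS bb0 boff bon] := onoff.
have headU : \bigcup_n head n.*2 = `]0, +oo[%classic.
  apply/seteqP; split => r /=; first by move=> [n _] /=; rewrite !in_itv/= andbT => /andP[].
  rewrite in_itv/= andbT => r0; exists (Num.bound (r / tau)) => //=.
  rewrite in_itv/= r0/=; apply: lt_le_trans (switching_time_ge _).
  by rewrite -ltr_pdivrMr//; apply: archi_boundP; rewrite divr_ge0// ltW.
have ndts : nondecreasing_seq ts by apply/nondecreasing_seqP => n; exact: ltW.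
apply/integrableP; split; first exact/measurable_EFinP.
have cv : (\int[leb]_(r in head n.*2) `|b r|%:E @[n --> \oo] -->
    \int[leb]_(r in \bigcup_n head n.*2) `|b r|%:E)%E.
  apply: ge0_nondecreasing_set_cvg_integral => //.
  - move=> i j ij; rewrite subsetEset => r /=; rewrite !in_itv/= => /andP[-> ri].
    by apply: lt_le_trans ri _; apply: ndts; rewrite leq_double.
  - by move=> n; apply: measurable_funS mabs => // r; rewrite /= !in_itv/= andbT => /andP[].
rewrite headU in cv.
have nds : nondecreasing_seq (series (fun k => bb k.*2.+1 * (ts k.*2.+2 - ts k.*2.+1))).
  apply/nondecreasing_seqP => n; rewrite seriesSr lerDl mulr_ge0 ?subr_ge0//; exact: ltW.
apply: (@le_lt_trans _ _ (limn (series (fun k => bb k.*2.+1 * (ts k.*2.+2 - ts k.*2.+1))))%:E); last exact: ltry.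
apply: (cvge_to_le cv); apply: nearW => n.
apply: le_trans (head_integral_le n) _; rewrite lee_fin.
exact: nondecreasing_cvgn_le.
Qed.

End OnOff.

(** * Conclusion *)

Unset Implicit Arguments.
Theorem mainTheorem2 (R : realType) (H : completeNormedModType R)
    (ip : {dot H for idfun}) (hip : norm_of_inner ip)
    (A Ah : @operator R H)
    (hA : positive_self_adjoint ip A) (hK : compact_inverse A)
    (hAh : is_positive_sqrt ip Ah A)
    (tau : R) (htau : 0 < tau)
    (mu : R -> R) (hmu : admissible_kernel mu)
    (b : R -> R) (ts bb : nat -> R)
    (hb : Linfty_loc b) (honoff : on_off_coefficient b ts bb)
    (C alpha : R) (hdecay : decay_constants ip A Ah mu tau C alpha) :
  let T := fun n : nat => ts n.+1 - ts n in
  let c := fun n : nat => C * expR (- alpha * T n.*2) in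
  (forall n, tau <= T n.*2) ->
  (forall n, alpha^-1 * ln C < T n.*2) ->
  (         
   cvgn (series (fun n => bb n.*2.+1 * T n.*2.+1)) ->
   series (fun n => ln (c n)) @ \oo --> -oo ->
   series (fun n => ln (expR (2 * bb n.*2.+1 * T n.*2.+1)
                        * (c n + T n.*2.+1 * bb n.*2.+1))) @ \oo --> -oo
   /\ asymptotically_stable ip A Ah mu tau b)
  /\
  (         
   (@lebesgue_measure R).-integrable `]0, +oo[ (EFin \o b) ->
   (exists Tbar : R, [/\ alpha^-1 * ln C < Tbar, tau <= Tbar &
      forall n, Tbar <= T n.*2]) ->
   asymptotically_stable ip A Ah mu tau b).
Proof.
move=> T c tauT lnT.
have [ts0 tsS bb0 boff _] := honoff.
have [C1 alpha0 _] := hdecay.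
have C0 : 0 < C := lt_trans ltr01 C1.
have stable : (@lebesgue_measure R).-integrable `]0, +oo[ (EFin \o b) ->
    asymptotically_stable ip A Ah mu tau b.
  move=> bI.
  apply: (stable_of_integrable hip hA hK hAh htau hmu (t1 := ts 1%N) bI).
  (* The first off interval is [0, t_1), of length at least tau. *)
  - by move=> r r0 r1; apply: (boff 0%N); rewrite ts0 r0.
  - by have := tauT 0%N; rewrite /T ts0 subr0.
split; last by move=> bI _; exact: stable.
move=> cvbT lncNy; split; last first.
  by apply: stable; apply: on_off_integrable hb.1 honoff htau tauT cvbT.
(* The upper bound is the lower bound (1/alpha) ln C < T_{2n} after exponentiation. *)
have c01 n : 0 < c n < 1.
  rewrite /c mulr_gt0 ?expR_gt0//= mulrC mulNr expRN -ltr_pdivlMr//.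
  rewrite mul1r ltf_pV2 ?posrE ?expR_gt0//.
  rewrite -[ltLHS]lnK ?posrE// ltr_expR -ltr_pdivrMl//; exact: lnT.
have := series_ln_feedback c01 (beta := fun n => bb n.*2.+1 * T n.*2.+1) _ cvbT lncNy.
rewrite (_ : (fun n => _) = (fun n => ln (expR (2 * bb n.*2.+1 * T n.*2.+1)
                        * (c n + T n.*2.+1 * bb n.*2.+1)))).
  by apply=> n; rewrite mulr_ge0 ?(ltW (bb0 n))// subr_ge0 ltW.
by apply/funext => n; rewrite mulrA [bb _ * _]mulrC.
Qed.
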